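(* Let $A\in\mathrm{GL}_2(\mathbb R)$ and $\mathbb T^2_A=\mathbb R^2/(A\mathbb Z^2)$, and let $\gamma>0$ be such that $|2\pi m|^2\in\gamma\mathbb N$ for every $m\in(A^{-1})^*\mathbb Z^2$. Let $u_0\in L^2(\mathbb T^2_A)$, $F\in L^1((0,\tfrac{2\pi}{\gamma}),L^2(\mathbb T^2_A))$, and let $u$ be the solution of $$i\partial_tu+\Delta u=F,\qquad u(0,\cdot)=u_0 .$$ Then $$\|u\|_{L^4(\mathbb T^2_A,L^2(0,\frac{2\pi}{\gamma}))}\le\Big(\frac{12\pi^2}{\gamma^2|\det A|}\Big)^{\frac14}\Big(\|u_0\|_{L^2(\mathbb T^2_A)}+\|F\|_{L^1((0,\frac{2\pi}{\gamma}),L^2(\mathbb T^2_A))}\Big).$$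
   Context: $(A^{-1})^*$ is the transpose of $A^{-1}$, and $\mathbb N$ contains $0$. The numbers $|2\pi m|^2$, $m\in(A^{-1})^*\mathbb Z^2$, are the eigenvalues of $-\Delta$ on $L^2(\mathbb T^2_A)$. The solution is the Duhamel (mild) solution on the time interval $(0,\frac{2\pi}{\gamma})$. The mixed norm is $\|u\|_{L^4(\mathbb T^2_A,L^2(0,\tau))}=\Big(\int_{\mathbb T^2_A}\big(\int_0^\tau|u(t,x)|^2\,\mathrm dt\big)^2\mathrm dx\Big)^{1/4}$. *)

(* Defs.v *)
From HB Require Import structures.
From mathcomp Require Import all_boot all_order all_algebra.
From mathcomp Require Import complex.
From mathcomp Require Import all_classical all_reals all_analysis.

Set Implicit Arguments.
Unset Strict Implicit.
Unset Printing Implicit Defensive.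

Import Order.TTheory GRing.Theory Num.Theory.
Import numFieldNormedType.Exports.

Local Open Scope classical_set_scope.
Local Open Scope ring_scope.
Local Open Scope complex_scope.

(** Points of [R^2] are pairs, which carry the product (Borel) sigma-algebra.
    A function on the torus [R^2 / A Z^2] is an [A Z^2]-periodic function on
    [R^2], integrated over the fundamental cell [A [0,1)^2].  Elements of
    [L^2] are handled through representatives. *)

Notation leb1 R := (@lebesgue_measure R).
Notation leb2 R := (@lebesgue_measure R \x @lebesgue_measure R)%E.
Notation timeR R := (measurableTypeR R).
Notation planeR R := (measurableTypeR R * measurableTypeR R)%type.

Section Torus.
Context {R : realType}.
Implicit Types (A : 'M[R]_2) (f g : R * R -> R[i]).

Definition mulmxp A (x : R * R) : R * R :=
  (A ord0 ord0 * x.1 + A ord0 ord_max * x.2,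
   A ord_max ord0 * x.1 + A ord_max ord_max * x.2).

Definition intp (k : int * int) : R * R := (k.1%:~R, k.2%:~R).

Definition dotp (x y : R * R) : R := x.1 * y.1 + x.2 * y.2.

Definition cell A : set (R * R) :=
  mulmxp A @` [set y | 0 <= y.1 < 1 /\ 0 <= y.2 < 1].

Definition lattice_periodic A f : Prop :=
  forall (k : int * int) (x : R * R), f (x + mulmxp A (intp k)) = f x.

Definition sqmod (z : R[i]) : R := complex.Re z ^+ 2 + complex.Im z ^+ 2.

Definition norm2 A f : \bar R :=
  ((\int[leb2 R]_(x in cell A) (sqmod (f x))%:E) `^ (2^-1))%E.

Definition in_L2 A f : Prop :=
  [/\ lattice_periodic A f,
      measurable_fun setT (fun x : planeR R => complex.Re (f x)),
      measurable_fun setT (fun x : planeR R => complex.Im (f x))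
    & (norm2 A f < +oo)%E].

(** [dual_pt A k], for [k] in [Z^2], enumerates the dual lattice
    [(A^{-1})^* Z^2]. *)
Definition dual_pt A (k : int * int) : R * R := mulmxp (invmx A)^T (intp k).

Definition eigval A (k : int * int) : R :=
  (2 * pi * (dual_pt A k).1) ^+ 2 + (2 * pi * (dual_pt A k).2) ^+ 2.

Definition expi (theta : R) : R[i] := cos theta +i* sin theta.

Definition fmode A (k : int * int) (x : R * R) : R[i] :=
  expi (2 * pi * dotp (dual_pt A k) x).

Definition cintegral A f : R[i] :=
  (\int[leb2 R]_(x in cell A) complex.Re (f x))%R
  +i* (\int[leb2 R]_(x in cell A) complex.Im (f x))%R.

Definition fcoef A f (k : int * int) : R[i] :=
  (`|\det A|^-1)%:C * cintegral A (fun x => f x * (fmode A k x)^*).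

(** Partial sum, over the box [-N <= k_1, k_2 <= N], of the series
    [e^{it Delta} f = sum_k e^{-it |2 pi m_k|^2} \hat f(k) e^{2 pi i m_k . x}]
    with [m_k = dual_pt A k]. *)
Definition flow_partial A (t : R) f (N : nat) (x : R * R) : R[i] :=
  \sum_(i < N.*2.+1) \sum_(j < N.*2.+1)
    let k := ((i : nat)%:Z - N%:Z, (j : nat)%:Z - N%:Z) in
    expi (- (t * eigval A k)) * fcoef A f k * fmode A k x.

(** [g = e^{it Delta} f] in [L^2]. *)
Definition is_flow A (t : R) f g : Prop :=
  in_L2 A g /\
  (fun N => norm2 A (fun x => flow_partial A t f N x - g x)) @ \oo --> 0%E.

(** Bochner integration of [L^2]-valued functions on a bounded measurable set
    of times [I]. *)
Record step_fun A (I : set R) := StepFun {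
  sf_size : nat;
  sf_set : 'I_sf_size -> set R;
  sf_val : 'I_sf_size -> R * R -> R[i];
  sf_measurable : forall j, measurable (sf_set j : set (timeR R));
  sf_sub : forall j, sf_set j `<=` I;
  sf_L2 : forall j, in_L2 A (sf_val j)
}.

Definition step_eval A (I : set R) (S : step_fun A I) (s : R) (x : R * R)
    : R[i] :=
  \sum_(j < sf_size S) (\1_(sf_set j) s)%:C * @sf_val A I S j x.

Definition step_integral A (I : set R) (S : step_fun A I) (x : R * R) : R[i] :=
  \sum_(j < sf_size S) (fine (leb1 R (sf_set j)))%:C * @sf_val A I S j x.

Definition ae_approx A (I : set R) (G : R -> R * R -> R[i])
    (S : nat -> step_fun A I) : Prop :=
  {ae leb1 R, forall s, I s ->
    (fun n => norm2 A (fun x => G s x - step_eval (S n) s x)) @ \oo --> 0%E}.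

Definition normL1L2 A (I : set R) (G : R -> R * R -> R[i]) : \bar R :=
  (\int[leb1 R]_(s in I) norm2 A (G s))%E.

Definition in_L1L2 A (I : set R) (G : R -> R * R -> R[i]) : Prop :=
  [/\ forall s, I s -> in_L2 A (G s),
      exists S : nat -> step_fun A I, ae_approx G S
    & (normL1L2 A I G < +oo)%E].

Definition is_bochner_integral A (I : set R) (G : R -> R * R -> R[i])
    (v : R * R -> R[i]) : Prop :=
  [/\ forall s, I s -> in_L2 A (G s),
      in_L2 A v
    & exists S : nat -> step_fun A I,
      [/\ ae_approx G S,
          (fun n => normL1L2 A I (fun s x => G s x - step_eval (S n) s x))
            @ \oo --> 0%E
        & (fun n => norm2 A (fun x => step_integral (S n) x - v x))
            @ \oo --> 0%E]].

(** Mild solution of [i d_t u + Delta u = F], [u(0) = u0] on [(0,tau)]: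
    [u(t) = e^{it Delta} u0 - i int_0^t e^{i(t-s) Delta} F(s) ds] in [L^2] for
    every [t], represented by a function that is jointly measurable in time
    and space, so that its mixed norm makes sense. *)
Definition is_mild_solution A (tau : R) (u0 : R * R -> R[i])
    (F u : R -> R * R -> R[i]) : Prop :=
  [/\ measurable_fun ((`]0, tau[%classic : set (timeR R)) `*` (setT : set (planeR R)))
        (fun z : timeR R * planeR R => complex.Re (u z.1 z.2)),
      measurable_fun ((`]0, tau[%classic : set (timeR R)) `*` (setT : set (planeR R)))
        (fun z : timeR R * planeR R => complex.Im (u z.1 z.2)),
      forall t, 0 < t < tau -> lattice_periodic A (u t)
    & forall t, 0 < t < tau ->
      exists w (G : R -> R * R -> R[i]) v,
      [/\ is_flow A t u0 w,
          forall s, 0 < s < t -> is_flow A (t - s) (F s) (G s),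
          is_bochner_integral A `]0, t[ G v
        & {ae leb2 R, forall x, u t x = w x - 'i * v x}]].

Definition normL4L2 A (tau : R) (u : R -> R * R -> R[i]) : \bar R :=
  ((\int[leb2 R]_(x in cell A)
      (\int[leb1 R]_(t in `]0%R, tau[) (sqmod (u t x))%:E) ^+ 2) `^ (4^-1))%E.

End Torus.

(* Main.v *)
Require Import Defs.
From HB Require Import structures.
From mathcomp Require Import all_boot all_order all_algebra.
From mathcomp Require Import complex ring lra zify.
From mathcomp Require Import all_classical all_reals all_analysis.
From mathcomp Require Import measurable_realfun.

(** Write [m] for [|det A|], [tau] for [2 pi / gamma], and [e_k] for the modes
    [fmode A k], which are orthogonal on the cell with square norm [m].

    For the free equation with finitely many modes, [u = sum_k c_k e^{-it lam_k}
    e_k], all the [lam_k] are integer multiples of [gamma].  Integrating over the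
    full period [(0, tau)] therefore removes the products with different
    eigenvalues, and the time integral of [|u|^2] at [x] is [tau] times the
    trigonometric polynomial [sum_{lam_k = lam_l} c_k conj(c_l) e_{k-l}(x)].  Its
    square norm counts quadruples with [lam_k1 = lam_k2], [lam_k3 = lam_k4] and
    [k1 - k2 = k3 - k4].  In the dual lattice [k1 - k3 = k2 - k4] is a vector
    joining two circles centred at the origin, and a nonzero one has at most two
    positions ([circle_chord_unique]); together with the diagonal
    [k1 = k3] this gives the constant [3] ([sum4_bound]) and
    [homogeneous_estimate].  Since [sum |c_k|^2 = |u_0|^2 / m], the constant of
    the theorem is [3 tau^2 / m = 12 pi^2 / (gamma^2 m)].

    The inhomogeneous equation follows by superposition.  Spreading the initial
    datum over [(-1, 0]] writes [u(t)] as an integral over [r < t] of free waves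
    with data [psi(r)], where the data have total mass at most
    [m^{-1/2} (|u_0| + |F|)].  Taking absolute values, the constraint [r < t] can
    be dropped, each free wave then fills a whole period, and Minkowski's
    inequality in time and in space ([minkowski_L2]) moves the mixed norm inside
    the integral over [r].  This is [duhamel_estimate], again for finitely many
    modes.

    It remains to let the number of modes grow.  At each fixed time the
    truncations converge to [u(t)] in the space of square-integrable functions:
    for the free part by definition of the flow, for the Duhamel part because a
    Bochner integral is determined by scalar integrals ([pettis]) and stays in
    the closed span of the modes ([duhamel_trunc_small]).  The errors are bounded
    uniformly in time, hence tend to [0] in space-time, and the mixed norm is
    lower semicontinuous under that convergence ([mixed_norm_limit]).

    The forcing is only known to be a limit of step functions almost everywhere,
    so [s |-> norm2 A (F s)] need not be Borel measurable; the bounds that involve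
    it use that the integral of nonnegative functions is monotone in any case
    ([le_integral_lower]). *)

Set Implicit Arguments.
Unset Strict Implicit.
Unset Printing Implicit Defensive.

Import Order.TTheory GRing.Theory Num.Theory.
Import numFieldNormedType.Exports.

Local Open Scope classical_set_scope.
Local Open Scope complex_scope.
Local Open Scope ring_scope.

Notation Re := complex.Re.
Notation Im := complex.Im.
Notation normc := complex.ComplexField.Normc.normc.

(** * Complex-valued functions and their integrals *)

Section ComplexNumbers.
Context {R : realType}.
Implicit Types (z w : R[i]).

Lemma cReD z w : Re (z + w) = Re z + Re w. Proof. by case: z; case: w. Qed.
Lemma cImD z w : Im (z + w) = Im z + Im w. Proof. by case: z; case: w. Qed.
Lemma cReN z : Re (- z) = - Re z. Proof. by case: z. Qed.
Lemma cImN z : Im (- z) = - Im z. Proof. by case: z. Qed.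
Lemma cReM z w : Re (z * w) = Re z * Re w - Im z * Im w.
Proof. by case: z; case: w. Qed.
Lemma cImM z w : Im (z * w) = Re z * Im w + Im z * Re w.
Proof. by case: z => a b; case: w => c d /=; ring. Qed.
Lemma cReJ z : Re (z^*) = Re z. Proof. by case: z. Qed.
Lemma cImJ z : Im (z^*) = - Im z. Proof. by case: z. Qed.

Lemma cRe_sum I (s : seq I) (P : pred I) (F : I -> R[i]) :
  Re (\sum_(i <- s | P i) F i) = \sum_(i <- s | P i) Re (F i).
Proof. by apply: (big_morph _ cReD). Qed.
Lemma cIm_sum I (s : seq I) (P : pred I) (F : I -> R[i]) :
  Im (\sum_(i <- s | P i) F i) = \sum_(i <- s | P i) Im (F i).
Proof. by apply: (big_morph _ cImD). Qed.

Lemma complex_eqP z w : Re z = Re w -> Im z = Im w -> z = w.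
Proof. by case: z; case: w => /= ? ? ? ? -> ->. Qed.

Lemma sqmod_ge0 z : 0 <= sqmod z.
Proof. by rewrite addr_ge0 // sqr_ge0. Qed.

Lemma sqmodE z : sqmod z = normc z ^+ 2.
Proof. by case: z => a b; rewrite /sqmod /= sqr_sqrtr // addr_ge0 // sqr_ge0. Qed.

Lemma normcE z : normc z = Num.sqrt (sqmod z).
Proof. by case: z. Qed.

Lemma normc_ge0 z : 0 <= normc z.
Proof. by rewrite normcE sqrtr_ge0. Qed.

Lemma sqmodM z w : sqmod (z * w) = sqmod z * sqmod w.
Proof. by rewrite /sqmod cReM cImM; ring. Qed.

Lemma sqmodJ z : sqmod (z^*) = sqmod z.
Proof. by rewrite /sqmod cReJ cImJ sqrrN. Qed.

Lemma sqmodN z : sqmod (- z) = sqmod z.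
Proof. by rewrite /sqmod cReN cImN !sqrrN. Qed.

Lemma sqmod_real (x : R) : sqmod (x%:C) = x ^+ 2.
Proof. by rewrite /sqmod /= expr0n addr0. Qed.

Lemma sqmod0 : sqmod (0 : R[i]) = 0.
Proof. by rewrite /sqmod /= !expr0n addr0. Qed.

Lemma mulJ_sqmod z : z * z^* = (sqmod z)%:C.
Proof. by apply: complex_eqP; rewrite ?cReM ?cImM cReJ cImJ /sqmod /=; ring. Qed.

Lemma normcJ z : normc (z^*) = normc z.
Proof. by rewrite !normcE sqmodJ. Qed.

Lemma normc_mul z w : normc (z * w) = normc z * normc w.
Proof. exact: complex.ComplexField.Normc.normcM. Qed.

Lemma normc_opp z : normc (- z) = normc z.
Proof. by rewrite !normcE sqmodN. Qed.

Lemma normc_add z w : normc (z + w) <= normc z + normc w.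
Proof. exact: le_normcD. Qed.

Lemma normc_eq0 z : normc z = 0 -> z = 0.
Proof. exact: complex.ComplexField.Normc.eq0_normc. Qed.

Lemma normc00 : normc (0 : R[i]) = 0.
Proof. by rewrite normcE sqmod0 sqrtr0. Qed.

Lemma normRe z : `|Re z| <= normc z.
Proof.
by rewrite normcE -sqrtr_sqr ler_wsqrtr // lerDl sqr_ge0.
Qed.

Lemma normIm z : `|Im z| <= normc z.
Proof.
by rewrite normcE -sqrtr_sqr ler_wsqrtr // lerDr sqr_ge0.
Qed.

Lemma le_Re_normc z : Re z <= normc z.
Proof. exact: le_trans (ler_norm _) (normRe _). Qed.

Lemma normc_leD z : normc z <= `|Re z| + `|Im z|.
Proof.
rewrite normcE -[leRHS]ger0_norm ?addr_ge0 // -sqrtr_sqr ler_wsqrtr //.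
rewrite /sqmod sqrrD -[Re z ^+ 2]real_normK ?num_real //.
rewrite -[Im z ^+ 2]real_normK ?num_real //.
rewrite addrAC lerDl mulrn_wge0 // mulr_ge0 //.
Qed.

Lemma Re_mul_le z w : Re (z * w) <= 2^-1 * (sqmod z + sqmod w).
Proof.
rewrite -subr_ge0; have -> : 2^-1 * (sqmod z + sqmod w) - Re (z * w) =
  2^-1 * ((Re z - Re w) ^+ 2 + (Im z + Im w) ^+ 2).
  by rewrite cReM /sqmod; field.
by rewrite mulr_ge0 // addr_ge0 // sqr_ge0.
Qed.

Lemma normc_mul_le z w : normc (z * w) <= 2^-1 * (sqmod z + sqmod w).
Proof.
rewrite normc_mul !sqmodE.
have := sqr_ge0 (normc z - normc w); lra.
Qed.

Lemma sqmodD_le z w : sqmod (z + w) <= 2 * sqmod z + 2 * sqmod w.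
Proof.
rewrite -subr_ge0; have -> : 2 * sqmod z + 2 * sqmod w - sqmod (z + w) =
  sqmod (z - w) by rewrite /sqmod !cReD !cImD cReN cImN; ring.
exact: sqmod_ge0.
Qed.

Lemma sqmodB z w : sqmod (z - w) = sqmod z - 2 * Re (w^* * z) + sqmod w.
Proof. by rewrite /sqmod !cReD !cImD cReN cImN cReM cReJ cImJ; ring. Qed.

Lemma sqmod_expi (t : R) : sqmod (expi t) = 1.
Proof. by rewrite /sqmod /= cos2Dsin2. Qed.

Lemma expiD (s t : R) : expi (s + t) = expi s * expi t.
Proof.
apply: complex_eqP; rewrite ?cReM ?cImM /= ?cosD ?sinD; ring.
Qed.

Lemma expiN (t : R) : expi (- t) = (expi t)^*.
Proof. by rewrite /expi cosN sinN. Qed.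

Lemma expi0 : expi (0 : R) = 1.
Proof. by rewrite /expi cos0 sin0. Qed.

End ComplexNumbers.

Section ComplexMeasurable.
Context {R : realType} d (T : measurableType d).
Implicit Types (D : set T) (f g : T -> R[i]).

Definition cmeasurable D f :=
  measurable_fun D (fun x => Re (f x)) /\ measurable_fun D (fun x => Im (f x)).

Lemma eq_cmeasurable D f g : {in D, f =1 g} -> cmeasurable D f -> cmeasurable D g.
Proof.
move=> fg [f1 f2]; split; [apply: eq_measurable_fun f1|apply: eq_measurable_fun f2];
  by move=> x xD /=; rewrite fg.
Qed.

Lemma cmeasurable_cst D (z : R[i]) : cmeasurable D (fun=> z).
Proof. by split; exact: measurable_cst. Qed.

Lemma cmeasurableD D f g : cmeasurable D f -> cmeasurable D g ->
  cmeasurable D (fun x => f x + g x).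
Proof.
move=> [f1 f2] [g1 g2]; split; under eq_fun do rewrite ?cReD ?cImD;
  exact: measurable_funD.
Qed.

Lemma cmeasurableN D f : cmeasurable D f -> cmeasurable D (fun x => - f x).
Proof.
by move=> [f1 f2]; split; under eq_fun do rewrite ?cReN ?cImN;
  exact: measurable_funN.
Qed.

Lemma cmeasurableB D f g : cmeasurable D f -> cmeasurable D g ->
  cmeasurable D (fun x => f x - g x).
Proof. by move=> mf mg; apply: cmeasurableD => //; exact: cmeasurableN. Qed.

Lemma cmeasurableM D f g : cmeasurable D f -> cmeasurable D g ->
  cmeasurable D (fun x => f x * g x).
Proof.
move=> [f1 f2] [g1 g2]; split; under eq_fun do rewrite ?cReM ?cImM.
  by apply: measurable_funB; exact: measurable_funM.
by apply: measurable_funD; exact: measurable_funM.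
Qed.

Lemma cmeasurableJ D f : cmeasurable D f -> cmeasurable D (fun x => (f x)^*).
Proof.
move=> [f1 f2]; split; first by under eq_fun do rewrite cReJ.
by under eq_fun do rewrite cImJ; exact: measurable_funN.
Qed.

Lemma cmeasurable_real D (h : T -> R) : measurable_fun D h ->
  cmeasurable D (fun x => (h x)%:C).
Proof. by move=> mh; split => //=; exact: measurable_cst. Qed.

Lemma cmeasurable_sum D I (s : seq I) (F : I -> T -> R[i]) :
  (forall i, cmeasurable D (F i)) -> cmeasurable D (fun x => \sum_(i <- s) F i x).
Proof.
move=> mF; split.
  under eq_fun do rewrite cRe_sum.
  by apply: measurable_sum => i; exact: (mF i).1.
under eq_fun do rewrite cIm_sum.
by apply: measurable_sum => i; exact: (mF i).2.
Qed.

Lemma cmeasurable_expi D (h : T -> R) : measurable_fun D h ->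
  cmeasurable D (fun x => expi (h x)).
Proof.
move=> mh; split => /=.
  apply: (@measurableT_comp _ _ _ _ _ _ cos) => //.
  by apply: continuous_measurable_fun; exact: continuous_cos.
apply: (@measurableT_comp _ _ _ _ _ _ sin) => //.
by apply: continuous_measurable_fun; exact: continuous_sin.
Qed.

Lemma measurable_sqmod D f : cmeasurable D f ->
  measurable_fun D (fun x => sqmod (f x)).
Proof. by move=> [f1 f2]; apply: measurable_funD; exact: measurable_funX. Qed.

Lemma measurable_sqrt D (h : T -> R) : measurable_fun D h ->
  measurable_fun D (fun x => Num.sqrt (h x)).
Proof.
move=> mh; apply: (@measurableT_comp _ _ _ _ _ _ (@Num.sqrt R)) => //.
by apply: continuous_measurable_fun; exact: sqrt_continuous.
Qed.

Lemma measurable_normc D f : cmeasurable D f ->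
  measurable_fun D (fun x => normc (f x)).
Proof.
move=> mf; under eq_fun do rewrite normcE.
by apply: measurable_sqrt; exact: measurable_sqmod.
Qed.

Lemma cmeasurableS (D E : set T) f : measurable E -> D `<=` E ->
  cmeasurable E f -> cmeasurable D f.
Proof. by move=> mE DE [f1 f2]; split; apply: (measurable_funS mE DE). Qed.

End ComplexMeasurable.

Lemma cmeasurable_comp {R : realType} d1 d2 (T1 : measurableType d1)
    (T2 : measurableType d2) (f : T2 -> R[i]) (h : T1 -> T2) :
  cmeasurable setT f -> measurable_fun setT h -> cmeasurable setT (fun x => f (h x)).
Proof.
move=> [f1 f2] mh; split.
  exact: (@measurableT_comp _ _ _ _ _ _ (fun x => Re (f x))).
exact: (@measurableT_comp _ _ _ _ _ _ (fun x => Im (f x))).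
Qed.

Section ComplexIntegral.
Context {R : realType} d (T : measurableType d).
Variables (mu : {measure set T -> \bar R}) (D : set T) (mD : measurable D).
Implicit Types (f g : T -> R[i]).

Definition cint f : R[i] :=
  (\int[mu]_(x in D) Re (f x))%R +i* (\int[mu]_(x in D) Im (f x))%R.

Definition cintegrable f :=
  mu.-integrable D (fun x => (Re (f x))%:E) /\
  mu.-integrable D (fun x => (Im (f x))%:E).

Lemma eq_cint f g : {in D, f =1 g} -> cint f = cint g.
Proof.
by move=> fg; rewrite /cint; congr (_ +i* _); apply: eq_Rintegral => x xD;
  rewrite fg.
Qed.

Lemma eq_cintegrable f g : {in D, f =1 g} -> cintegrable f -> cintegrable g.
Proof.
move=> fg [f1 f2]; split; [apply: eq_integrable f1|apply: eq_integrable f2] => //;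
  by move=> x xD /=; rewrite fg.
Qed.

Lemma cintegrable_measurable f : cintegrable f -> cmeasurable D f.
Proof.
move=> [/(measurable_int mu) f1 /(measurable_int mu) f2].
by split; apply/measurable_EFinP.
Qed.

Lemma cintegrableP f (h : T -> R) : cmeasurable D f ->
  mu.-integrable D (fun x => (h x)%:E) -> (forall x, D x -> normc (f x) <= h x) ->
  cintegrable f.
Proof.
move=> [f1 f2] ih fh; split; apply: (le_integrable mD _ _ ih);
  try exact/measurable_EFinP.
all: move=> x Dx; rewrite /= lee_fin (le_trans _ (ler_norm _)) // (le_trans _ (fh x Dx)) //.
- exact: normRe.
- exact: normIm.
Qed.

Lemma cintegrable_normc f : cintegrable f ->
  mu.-integrable D (fun x => (normc (f x))%:E).
Proof.
move=> fi; have [f1 f2] := fi; have mf := cintegrable_measurable fi.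
have i12 : mu.-integrable D ((fun x => `|(Re (f x))%:E|%E) \+ (fun x => `|(Im (f x))%:E|%E)).
  by apply: integrableD => //; exact: integrable_abse.
apply: (le_integrable mD _ _ i12).
  by apply/measurable_EFinP; exact: measurable_normc.
move=> x Dx /=; rewrite !lee_fin [leRHS]ger0_norm ?addr_ge0 //.
by rewrite ger0_norm ?normc_ge0 // normc_leD.
Qed.

Lemma cintegrableD f g : cintegrable f -> cintegrable g ->
  cintegrable (fun x => f x + g x).
Proof.
move=> [f1 f2] [g1 g2]; split.
  under eq_fun do rewrite cReD EFinD; exact: integrableD.
under eq_fun do rewrite cImD EFinD; exact: integrableD.
Qed.

Lemma cintD f g : cintegrable f -> cintegrable g ->
  cint (fun x => f x + g x) = cint f + cint g.
Proof.
move=> [f1 f2] [g1 g2]; apply: complex_eqP; rewrite ?cReD ?cImD /=.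
  by under eq_Rintegral do rewrite cReD; rewrite RintegralD.
by under eq_Rintegral do rewrite cImD; rewrite RintegralD.
Qed.

Lemma cintegrableZ (z : R[i]) f : cintegrable f -> cintegrable (fun x => z * f x).
Proof.
move=> [f1 f2]; split.
  under eq_fun do rewrite cReM EFinB !EFinM.
  by apply: integrableB => //; exact: integrableZl.
under eq_fun do rewrite cImM EFinD !EFinM.
by apply: integrableD => //; exact: integrableZl.
Qed.

Lemma cintZ (z : R[i]) f : cintegrable f -> cint (fun x => z * f x) = z * cint f.
Proof.
move=> [f1 f2]; have iZ r (h : T -> R) : mu.-integrable D (EFin \o h) ->
    mu.-integrable D (EFin \o (fun x => r * h x)).
  move=> ih; rewrite (_ : _ \o _ = (fun x => r%:E * (h x)%:E)%E) //.
  exact: integrableZl.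
apply: complex_eqP; rewrite ?cReM ?cImM /=.
  under eq_Rintegral do rewrite cReM.
  by rewrite RintegralB ?RintegralZl //; apply: iZ.
under eq_Rintegral do rewrite cImM.
by rewrite RintegralD ?RintegralZl //; apply: iZ.
Qed.

Lemma cintegrable0 : cintegrable (fun=> 0).
Proof. by split; exact: integrable0. Qed.

Lemma cint0 : cint (fun=> 0) = 0.
Proof. by apply: complex_eqP; rewrite /= Rintegral_cst // mul0r. Qed.

Lemma cintegrable_sum I (s : seq I) (F : I -> T -> R[i]) :
  (forall i, cintegrable (F i)) -> cintegrable (fun x => \sum_(i <- s) F i x).
Proof.
move=> iF; elim: s => [|i s IH].
  by apply: eq_cintegrable cintegrable0 => x _; rewrite big_nil.
apply: eq_cintegrable (cintegrableD (iF i) IH) => x _.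
by rewrite big_cons.
Qed.

Lemma cint_sum I (s : seq I) (F : I -> T -> R[i]) :
  (forall i, cintegrable (F i)) ->
  cint (fun x => \sum_(i <- s) F i x) = \sum_(i <- s) cint (F i).
Proof.
move=> iF; elim: s => [|i s IH].
  rewrite big_nil -[RHS]cint0; apply: eq_cint => x _.
  by rewrite big_nil.
rewrite big_cons -IH -cintD //; last exact: cintegrable_sum.
by apply: eq_cint => x _; rewrite big_cons.
Qed.

Lemma cintegrableN f : cintegrable f -> cintegrable (fun x => - f x).
Proof.
by move=> /(cintegrableZ (-1)); apply: eq_cintegrable => x _; rewrite mulN1r.
Qed.

Lemma cintN f : cintegrable f -> cint (fun x => - f x) = - cint f.
Proof.
move=> fi; rewrite -mulN1r -cintZ //.
by apply: eq_cint => x _; rewrite mulN1r.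
Qed.

Lemma cintB f g : cintegrable f -> cintegrable g ->
  cint (fun x => f x - g x) = cint f - cint g.
Proof. by move=> fi gi; rewrite cintD ?cintN //; exact: cintegrableN. Qed.

Lemma cintJ f : cintegrable f -> cint (fun x => (f x)^*) = (cint f)^*.
Proof.
move=> [f1 f2]; apply: complex_eqP; rewrite ?cReJ ?cImJ /=.
  by apply: eq_Rintegral => x _; rewrite cReJ.
by rewrite -mulN1r -RintegralZl //; apply: eq_Rintegral => x _; rewrite cImJ mulN1r.
Qed.

(** Rotating the integral onto the positive half line reduces the bound to the
    monotonicity of the integral of real functions. *)
Lemma normc_cint f : cintegrable f ->
  normc (cint f) <= (\int[mu]_(x in D) normc (f x))%R.
Proof.
move=> fi; set z := cint f.
have I0 : 0 <= (\int[mu]_(x in D) normc (f x))%R.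
  by apply: Rintegral_ge0 => x _; exact: normc_ge0.
have [->|z0] := eqVneq (normc z) 0 => //.
have zp : 0 < normc z by rewrite lt_neqAle eq_sym z0 normc_ge0.
rewrite -(ler_pM2l zp) -expr2 -sqmodE.
have -> : sqmod z = Re (cint (fun x => z^* * f x)).
  by rewrite cintZ // -/z mulrC mulJ_sqmod.
have iz := cintegrableZ z^* fi.
rewrite -RintegralZl //=; last exact: cintegrable_normc.
apply: le_Rintegral => //; first exact: iz.1.
  exact: (integrableZl mD (normc z) (cintegrable_normc fi)).
by move=> x Dx; rewrite (le_trans (le_Re_normc _)) // normc_mul normcJ.
Qed.

Lemma normc_cint_le f : cintegrable f ->
  ((normc (cint f))%:E <= \int[mu]_(x in D) (normc (f x))%:E)%E.
Proof.
move=> fi; apply: (@le_trans _ _ (\int[mu]_(x in D) normc (f x))%R%:E).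
  by rewrite lee_fin normc_cint.
rewrite /Rintegral fineK //; apply: integrable_fin_num => //.
exact: cintegrable_normc.
Qed.

End ComplexIntegral.

(** * Square-integrable functions and orthogonal families *)

Section SquareIntegrable.
Context {R : realType} d (T : measurableType d).
Variables (mu : {measure set T -> \bar R}) (D : set T) (mD : measurable D).
Implicit Types (f g h : T -> R[i]).

Definition sqint f :=
  cmeasurable D f /\ mu.-integrable D (fun x => (sqmod (f x))%:E).

Definition ip f g : R[i] := cint mu D (fun x => f x * (g x)^*).

Definition nsq f : R := (\int[mu]_(x in D) sqmod (f x))%R.

Lemma nsq_ge0 f : 0 <= nsq f.
Proof. by apply: Rintegral_ge0 => x _; exact: sqmod_ge0. Qed.

Lemma sqintP f : cmeasurable D f ->
  (\int[mu]_(x in D) (sqmod (f x))%:E < +oo)%E -> sqint f.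
Proof.
move=> mf fi; split => //; apply/integrableP; split.
  by apply/measurable_EFinP; exact: measurable_sqmod.
under eq_integral do rewrite gee0_abs ?lee_fin ?sqmod_ge0 //.
exact: fi.
Qed.

Lemma nsqE f : sqint f -> (\int[mu]_(x in D) (sqmod (f x))%:E)%E = (nsq f)%:E.
Proof. by move=> [_ fi]; rewrite /nsq /Rintegral fineK //; exact: integrable_fin_num. Qed.

Lemma eq_sqint f g : {in D, f =1 g} -> sqint f -> sqint g.
Proof.
move=> fg [f1 f2]; split; first exact: eq_cmeasurable f1.
by apply: eq_integrable f2 => // x xD; rewrite fg.
Qed.

Lemma eq_nsq f g : {in D, f =1 g} -> nsq f = nsq g.
Proof. by move=> fg; apply: eq_Rintegral => x xD; rewrite fg. Qed.

Lemma eq_ipl f g h : {in D, f =1 g} -> ip f h = ip g h.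
Proof. by move=> fg; apply: eq_cint => x xD; rewrite fg. Qed.

Lemma sqint_mul f g : sqint f -> sqint g ->
  cintegrable mu D (fun x => f x * (g x)^*).
Proof.
move=> [f1 f2] [g1 g2].
apply: (@cintegrableP _ _ _ _ _ _ _ (fun x => 2^-1 * (sqmod (f x) + sqmod (g x)))) => //.
- by apply: cmeasurableM => //; exact: cmeasurableJ.
- under eq_fun do rewrite EFinM EFinD.
  by apply: integrableZl => //; exact: integrableD.
- by move=> x _; rewrite (le_trans (normc_mul_le _ _)) // sqmodJ.
Qed.

Lemma sqintD f g : sqint f -> sqint g -> sqint (fun x => f x + g x).
Proof.
move=> [f1 f2] [g1 g2]; split; first exact: cmeasurableD.
have i12 : mu.-integrable D
    (fun x => 2%:E * (sqmod (f x))%:E + 2%:E * (sqmod (g x))%:E)%E.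
  by apply: integrableD => //; exact: integrableZl.
apply: (le_integrable mD _ _ i12).
  by apply/measurable_EFinP/measurable_sqmod/cmeasurableD.
move=> x _ /=; rewrite lee_fin !ger0_norm ?sqmod_ge0 ?sqmodD_le //.
by rewrite addr_ge0 // mulr_ge0 ?sqmod_ge0.
Qed.

Lemma sqintZ (z : R[i]) f : sqint f -> sqint (fun x => z * f x).
Proof.
move=> [f1 f2]; split; first by apply: cmeasurableM => //; exact: cmeasurable_cst.
under eq_fun do rewrite sqmodM EFinM; exact: integrableZl.
Qed.

Lemma sqint0 : sqint (fun=> 0).
Proof.
split; first exact: cmeasurable_cst.
under eq_fun do rewrite sqmod0; exact: integrable0.
Qed.

Lemma sqintB f g : sqint f -> sqint g -> sqint (fun x => f x - g x).
Proof.
move=> f1 g1; apply: (@eq_sqint (fun x => f x + (-1) * g x)).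
  by move=> x _; rewrite mulN1r.
by apply: sqintD => //; exact: sqintZ.
Qed.

Lemma sqint_sum I (s : seq I) (F : I -> T -> R[i]) :
  (forall i, sqint (F i)) -> sqint (fun x => \sum_(i <- s) F i x).
Proof.
move=> iF; elim: s => [|i s IH].
  by apply: eq_sqint sqint0 => x _; rewrite big_nil.
apply: eq_sqint (sqintD (iF i) IH) => x _.
by rewrite big_cons.
Qed.

Lemma ip_nsq f : sqint f -> ip f f = (nsq f)%:C.
Proof.
move=> _; apply: complex_eqP => /=.
  by apply: eq_Rintegral => x _; rewrite mulJ_sqmod.
transitivity (\int[mu]_(x in D) (0 : R))%R; last by rewrite Rintegral_cst ?mul0r.
by apply: eq_Rintegral => x _; rewrite mulJ_sqmod.
Qed.

Lemma ipC f g : sqint f -> sqint g -> ip g f = (ip f g)^*.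
Proof.
move=> f1 g1; rewrite /ip -cintJ //; last exact: sqint_mul.
by apply: eq_cint => x _; rewrite rmorphM /= conjCK mulrC.
Qed.

Lemma ipZl (z : R[i]) f h : sqint f -> sqint h ->
  ip (fun x => z * f x) h = z * ip f h.
Proof.
move=> f1 h1; rewrite /ip -cintZ //; try exact: sqint_mul.
by apply: eq_cint => x _; rewrite mulrA.
Qed.

Lemma ipBl f g h : sqint f -> sqint g -> sqint h ->
  ip (fun x => f x - g x) h = ip f h - ip g h.
Proof.
move=> f1 g1 h1; rewrite /ip -cintB //; try exact: sqint_mul.
by apply: eq_cint => x _; rewrite mulrBl.
Qed.

Lemma ip_suml I (s : seq I) (F : I -> T -> R[i]) h :
  (forall i, sqint (F i)) -> sqint h ->
  ip (fun x => \sum_(i <- s) F i x) h = \sum_(i <- s) ip (F i) h.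
Proof.
move=> iF ih; rewrite /ip -cint_sum //; last by move=> i; exact: sqint_mul.
by apply: eq_cint => x _; rewrite mulr_suml.
Qed.

Lemma nsqB f g : sqint f -> sqint g ->
  nsq (fun x => f x - g x) = nsq f - 2 * Re (ip f g) + nsq g.
Proof.
move=> f1 g1; have fg := sqint_mul f1 g1.
have i1 : mu.-integrable D (EFin \o (fun x => 2 * Re (f x * (g x)^*))).
  rewrite (_ : _ \o _ = (fun x => 2%:E * (Re (f x * (g x)^*))%:E)%E) //.
  by apply: integrableZl => //; exact: fg.1.
have [_ if1] := f1; have [_ ig1] := g1.
rewrite /nsq /= -RintegralZl //; last exact: fg.1.
rewrite -RintegralB // -RintegralD //.
  by apply: eq_Rintegral => x _; rewrite sqmodB [_^* * _]mulrC.
under [_ \o _]eq_fun do rewrite /= EFinB.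
exact: integrableB.
Qed.

Lemma nsqZ (z : R[i]) f : sqint f -> nsq (fun x => z * f x) = sqmod z * nsq f.
Proof.
move=> [_ f1]; rewrite /nsq -RintegralZl //.
by apply: eq_Rintegral => x _; rewrite sqmodM.
Qed.

Lemma nsqD_le f g : sqint f -> sqint g ->
  nsq (fun x => f x + g x) <= 2 * nsq f + 2 * nsq g.
Proof.
move=> f1 g1; have [_ if1] := f1; have [_ ig1] := g1; have [_ h1] := sqintD f1 g1.
have i2 (h : T -> R) : mu.-integrable D (EFin \o h) ->
    mu.-integrable D (EFin \o (fun x => 2 * h x)).
  move=> ih; rewrite (_ : _ \o _ = (fun x => 2%:E * (h x)%:E)%E) //.
  exact: integrableZl.
rewrite /nsq -!RintegralZl // -RintegralD //; try exact: i2.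
apply: le_Rintegral => //.
- under [_ \o _]eq_fun do rewrite /= EFinD.
  by apply: integrableD => //; exact: i2.
- by move=> x _; exact: sqmodD_le.
Qed.

(** The discriminant argument, with the optimal scalar when [g] is not null;
    when [g] is null a large multiple of it contradicts positivity. *)
Lemma cauchy_schwarz f g : sqint f -> sqint g ->
  sqmod (ip f g) <= nsq f * nsq g.
Proof.
move=> f1 g1; set z := ip f g.
have key (c : R) : 0 <= nsq f - 2 * c * sqmod z + c ^+ 2 * sqmod z * nsq g.
  have := nsq_ge0 (fun x => f x - (c%:C * z) * g x).
  rewrite nsqB //; last exact: sqintZ.
  have -> : ip f (fun x => c%:C * z * g x) = c%:C * (sqmod z)%:C.
    rewrite ipC //; last exact: sqintZ.
    rewrite ipZl // [ip g f]ipC // -/z -mulrA mulJ_sqmod.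
    by apply: complex_eqP; rewrite ?cReJ ?cImJ ?cReM ?cImM /=; ring.
  rewrite nsqZ // sqmodM sqmod_real cReM /=; lra.
have [g0|gn0] := eqVneq (nsq g) 0.
  rewrite g0 mulr0; have := key; rewrite g0.
  have [z0|] := leP (sqmod z) 0 => // zp H.
  have := H ((nsq f + 1) / (2 * sqmod z)).
  have -> : 2 * ((nsq f + 1) / (2 * sqmod z)) * sqmod z = nsq f + 1.
    by field; rewrite gt_eqF.
  lra.
have gp : 0 < nsq g by rewrite lt_neqAle eq_sym gn0 nsq_ge0.
have := key (nsq g)^-1.
have -> : nsq f - 2 * (nsq g)^-1 * sqmod z + (nsq g)^-1 ^+ 2 * sqmod z * nsq g
   = nsq f - sqmod z / nsq g by field.
by rewrite subr_ge0 ler_pdivrMr.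
Qed.

Lemma normc_ip_le f g : sqint f -> sqint g ->
  normc (ip f g) <= Num.sqrt (nsq f) * Num.sqrt (nsq g).
Proof.
move=> f1 g1; rewrite normcE -sqrtrM ?nsq_ge0 // ler_wsqrtr //.
exact: cauchy_schwarz.
Qed.

Section Orthogonal.
Variables (K : eqType) (e : K -> T -> R[i]) (m : R).
Hypotheses (m0 : 0 < m) (eL2 : forall k, sqint (e k))
  (eO : forall k l, ip (e k) (e l) = if k == l then m%:C else 0).

Let nsqe k : nsq (e k) = m.
Proof. by have := ip_nsq (eL2 k); rewrite eO eqxx => -[]. Qed.

Lemma sqint_comb (s : seq K) (a : K -> R[i]) :
  sqint (fun x => \sum_(k <- s) a k * e k x).
Proof. by apply: sqint_sum => k; exact: sqintZ. Qed.

Lemma ip_comb (s : seq K) (a : K -> R[i]) l : uniq s ->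
  ip (fun x => \sum_(k <- s) a k * e k x) (e l) =
  if l \in s then a l * m%:C else 0.
Proof.
move=> us; rewrite ip_suml //; last by move=> k; exact: sqintZ.
under eq_bigr => k _ do rewrite ipZl // eO.
case: ifPn => [ls|ls].
  rewrite (bigD1_seq l) //= eqxx big1 ?addr0 // => k kl.
  by rewrite (negbTE kl) mulr0.
rewrite big_seq big1 // => k ks.
have /negbTE -> : k != l by apply: contraNneq ls => <-.
by rewrite mulr0.
Qed.

(** Subtracting a single mode from [f] leaves the inner products of [f] with the
    other modes unchanged, which makes the induction on [s] work. *)
Lemma nsq_sub_comb (s : seq K) (a : K -> R[i]) f : uniq s -> sqint f ->
  nsq (fun x => f x - \sum_(k <- s) a k * e k x) =
  nsq f - 2 * \sum_(k <- s) Re ((a k)^* * ip f (e k)) + m * \sum_(k <- s) sqmod (a k).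
Proof.
elim: s f => [|k s IH] f.
  move=> _ _; rewrite !big_nil !mulr0 subr0 addr0.
  by apply: eq_nsq => x _; rewrite big_nil subr0.
move=> /= /andP[ks us] f1.
have ak1 : sqint (fun x => a k * e k x) by exact: sqintZ.
transitivity (nsq (fun x => (f x - a k * e k x) - \sum_(k <- s) a k * e k x)).
  by apply: eq_nsq => x _; rewrite big_cons opprD addrA.
rewrite IH //; last exact: sqintB.
rewrite nsqB // nsqZ // nsqe !big_cons.
have -> : ip f (fun x => a k * e k x) = (a k)^* * ip f (e k).
  rewrite ipC // ipZl // [ip (e k) f]ipC //.
  by rewrite rmorphM; congr (_ * _); exact: conjCK.
have -> : \sum_(l <- s) Re ((a l)^* * ip (fun x => f x - a k * e k x) (e l)) =
    \sum_(l <- s) Re ((a l)^* * ip f (e l)).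
  apply: eq_big_seq => l ls; rewrite ipBl // ipZl // eO.
  have /negbTE -> : k != l by apply: contraNneq ks => ->.
  by rewrite mulr0 subr0.
ring.
Qed.

Definition proj (s : seq K) f (x : T) : R[i] :=
  \sum_(k <- s) (m^-1%:C * ip f (e k)) * e k x.

Lemma nsq_sub_proj (s : seq K) f : uniq s -> sqint f ->
  nsq (fun x => f x - proj s f x) = nsq f - m^-1 * \sum_(k <- s) sqmod (ip f (e k)).
Proof.
move=> us f1; rewrite /proj nsq_sub_comb //.
have -> : \sum_(k <- s) Re ((m^-1%:C * ip f (e k))^* * ip f (e k)) =
    m^-1 * \sum_(k <- s) sqmod (ip f (e k)).
  rewrite mulr_sumr; apply: eq_bigr => k _.
  by rewrite /sqmod !(cReM,cImM,cReJ,cImJ) /=; ring.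
have -> : \sum_(k <- s) sqmod (m^-1%:C * ip f (e k)) =
    m^-1 ^+ 2 * \sum_(k <- s) sqmod (ip f (e k)).
  rewrite mulr_sumr; apply: eq_bigr => k _.
  by rewrite sqmodM sqmod_real.
by field; rewrite gt_eqF.
Qed.

End Orthogonal.

End SquareIntegrable.

(** * Linear changes of variables in the plane *)

Section AffineChangeOfVariable.
Context {R : realType}.
Local Notation leb := (@lebesgue_measure R).

Lemma measurable_affine (a b : R) :
  measurable_fun setT (fun y : timeR R => (a * y + b : timeR R)).
Proof.
apply: measurable_funD; last exact: measurable_cst.
by apply: measurable_funM => //; exact: measurable_cst.
Qed.

Let affine_image (a b : R) : {measure set (timeR R) -> \bar R} :=
  measure_function_pushforward__canonical__measure_function_Measure leb
    (measurable_affine a b).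

Let lebesgue_measure_oc (a b : R) (b0 b1 : bool) : a <= b ->
  leb [set` Interval (BSide b0 a) (BSide b1 b)] = (b - a)%:E.
Proof.
move=> ab; rewrite lebesgue_measure_itv /= lte_fin.
case: ltP => // ba; have -> : a = b by apply/eqP; rewrite eq_le ab ba.
by rewrite subrr.
Qed.

(** Lebesgue measure is the only measure with the right value on half-open
    intervals, and the rescaled pushforward has that value; the preimage of such
    an interval changes its closed end when [a] is negative. *)
Lemma lebesgue_measure_affine (a b : R) (a0 : a != 0) (X : set R) : measurable X ->
  (leb X = `|a|%:E * leb ((fun y => (a * y + b)%R) @^-1` X))%E.
Proof.
move=> mX; pose r : {nonneg R} := NngNum (normr_ge0 a).
transitivity (mscale r (affine_image a b) X); last by [].
apply: lebesgue_measure_unique => //= _ [[p q]] _ <-.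
rewrite /mscale /= /pushforward /=.
have [pq|qp] := leP p q; last first.
  by rewrite set_itv_ge ?preimage_set0 ?measure0 ?mule0 // -leNgt bnd_simp ltW.
rewrite [LHS]lebesgue_measure_oc //.
have [ap|an] := ltP 0 a.
  have -> : (fun y => a * y + b) @^-1` `]p, q]%classic =
      `](p - b) / a, (q - b) / a]%classic.
    apply/seteqP; split => y /=; rewrite !in_itv /= ltr_pdivrMr // ler_pdivlMr //;
      rewrite ltrBlDr lerBrDr [y * a]mulrC //.
  rewrite [X in (_ * X)%E]lebesgue_measure_oc; last first.
    by rewrite ler_pM2r ?invr_gt0 // lerB.
  by rewrite -EFinM gtr0_norm //; congr EFin; field.
have {}an : a < 0 by rewrite lt_neqAle a0.
have -> : (fun y => a * y + b) @^-1` `]p, q]%classic =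
    `[(q - b) / a, (p - b) / a[%classic.
  apply/seteqP; split => y /=; rewrite !in_itv /= ltr_ndivlMr // ler_ndivrMr //;
    by rewrite ltrBlDr lerBrDr [y * a]mulrC andbC.
rewrite [X in (_ * X)%E]lebesgue_measure_oc; last first.
  by rewrite ler_nM2r ?invr_lt0 // lerB.
by rewrite -EFinM ltr0_norm //; congr EFin; field.
Qed.

Lemma integral_affine (a b : R) (f : R -> \bar R) : a != 0 ->
  measurable_fun setT (f : timeR R -> \bar R) -> (forall y, 0 <= f y)%E ->
  (\int[leb]_y f (a * y + b)%R = `|a|^-1%:E * \int[leb]_y f y)%E.
Proof.
move=> a0 mf f0; pose r : {nonneg R} := NngNum (normr_ge0 a).
have -> : (\int[leb]_y f y = \int[mscale r (affine_image a b)]_y f y)%E.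
  apply: eq_measure_integral => X mX _.
  exact: (@lebesgue_measure_affine a b a0).
rewrite ge0_integral_mscale //= ge0_integral_pushforward //; last first.
  exact: measurable_affine.
by rewrite muleA -EFinM mulVf ?normr_eq0 // mul1e preimage_setT.
Qed.

End AffineChangeOfVariable.

Section LinearChangeOfVariable.
Context {R : realType}.
Local Notation leb := (@lebesgue_measure R).
Implicit Types A B : 'M[R]_2.

Lemma det2E A :
  \det A = A ord0 ord0 * A ord_max ord_max - A ord0 ord_max * A ord_max ord0.
Proof.
rewrite (expand_det_row _ ord0) !big_ord_recl big_ord0 addr0 /cofactor !det_mx11 !mxE /=.
have -> : lift ord0 (0 : 'I_1) = ord_max :> 'I_2 by apply/val_inj.
have -> : lift (ord_max : 'I_2) (0 : 'I_1) = ord0 by apply/val_inj.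
by rewrite /= addn0 expr0 expr1; ring.
Qed.

Lemma mulmxpM A B x : mulmxp (A *m B) x = mulmxp A (mulmxp B x).
Proof.
rewrite /mulmxp !mxE /= !big_ord_recl !big_ord0 !addr0.
have -> : lift ord0 (ord0 : 'I_1) = ord_max :> 'I_2 by apply/val_inj.
by congr (_, _); ring.
Qed.

Lemma mulmxp1 x : mulmxp (1%:M : 'M[R]_2) x = x.
Proof. by case: x => a b; rewrite /mulmxp !mxE /=; congr (_, _); ring. Qed.

Lemma dotp_tr A x y : dotp (mulmxp A^T x) y = dotp x (mulmxp A y).
Proof. by rewrite /dotp /mulmxp !mxE /=; ring. Qed.

Lemma measurable_mulmxp A :
  measurable_fun setT (mulmxp A : planeR R -> planeR R).
Proof.
by apply: measurable_fun_pair; apply: measurable_funD;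
  apply: measurable_funM; by [exact: measurable_cst|exact: measurable_fst|exact: measurable_snd].
Qed.

(** Two one-dimensional affine substitutions, in an order that avoids a
    vanishing pivot. *)
Lemma integral_linear A (f : R * R -> \bar R) : A \in unitmx ->
  measurable_fun setT (f : planeR R -> \bar R) -> (forall y, 0 <= f y)%E ->
  (\int[leb2 R]_y f (mulmxp A y) = `|\det A|^-1%:E * \int[leb2 R]_y f y)%E.
Proof.
move=> uA mf f0.
have dA : \det A != 0 by move: uA; rewrite unitmxE unitfE.
have mfA : measurable_fun setT ((fun y => f (mulmxp A y)) : planeR R -> \bar R).
  exact: (@measurableT_comp _ _ _ _ _ _ (f : planeR R -> _) setT
    (mulmxp A : planeR R -> planeR R) mf (measurable_mulmxp A)).
have mfg (g : R * R -> R * R) : measurable_fun setT (g : planeR R -> planeR R) ->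
    measurable_fun setT ((fun y => f (g y)) : planeR R -> \bar R).
  move=> mg; exact: (@measurableT_comp _ _ _ _ _ _ (f : planeR R -> _) setT
    (g : planeR R -> planeR R) mf mg).
have mf1 y : measurable_fun setT (fun x : timeR R => f (x, y)).
  exact: measurable_fun_pair1.
have mf2 x : measurable_fun setT (fun y : timeR R => f (x, y)).
  exact: measurable_fun_pair2.
move: dA mfA; rewrite det2E /mulmxp.
set a := A ord0 ord0; set b := A ord0 ord_max.
set c := A ord_max ord0; set d := A ord_max ord_max => dA mfA.
rewrite fubini_tonelli2 // [X in (_ * X)%E]fubini_tonelli2 // /fubini_G /=.
have I0 : (0 <= \int[leb]_y \int[leb]_x f (x, y))%E.
  by apply: integral_ge0 => y _; apply: integral_ge0.
have FT : (\int[leb]_x \int[leb]_y f (x, y) = \int[leb]_y \int[leb]_x f (x, y))%E.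
  exact: (@fubini_tonelli _ _ _ _ _ leb leb f).
have [a0|a0] := eqVneq a 0.
  have c0 : c != 0 by apply: contra_neq dA => ->; rewrite a0; ring.
  have b0 : b != 0 by apply: contra_neq dA => ->; rewrite a0; ring.
  transitivity (\int[leb]_y (`|c|^-1%:E * \int[leb]_x f (b * y + 0, x)%R))%E.
    apply: eq_integral => y _.
    rewrite -(@integral_affine _ c (d * y) (fun x => f (b * y + 0, x))) //.
    by apply: eq_integral => x _; rewrite a0 mul0r add0r addr0.
  rewrite ge0_integralZl_EFin ?invr_ge0 //; last 2 first.
  - by move=> y _; apply: integral_ge0.
  - apply: (@measurable_fun_fubini_tonelli_F _ _ _ _ _ _
      (fun z : planeR R => f (b * z.1 + 0, z.2))) => //.
    apply: (mfg (fun z => (b * z.1 + 0, z.2))); apply: measurable_fun_pair => //.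
    apply: (@measurableT_comp _ _ _ _ _ _ (fun y : timeR R => b * y + 0 : timeR R)) => //.
    exact: measurable_affine.
  rewrite (@integral_affine _ b 0 (fun y => \int[leb]_x f (y, x))%E) //; last 2 first.
  - exact: (@measurable_fun_fubini_tonelli_F _ _ _ _ _ leb f mf f0).
  - by move=> y; apply: integral_ge0.
  rewrite FT muleA -EFinM; congr (_%:E * _)%E.
  by rewrite a0 mul0r sub0r normrN normrM invfM mulrC.
transitivity (\int[leb]_y (`|a|^-1%:E *
    \int[leb]_x f (x, c / a * x + (d - b * c / a) * y)%R))%E.
  apply: eq_integral => y _.
  rewrite -(@integral_affine _ a (b * y)
    (fun x => f (x, c / a * x + (d - b * c / a) * y))) //.
    by apply: eq_integral => x _; congr (f (_, _)); field.
  apply: (@measurableT_comp _ _ _ _ _ _ (f : planeR R -> _) setT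
    (fun x : timeR R => (x, c / a * x + (d - b * c / a) * y) : planeR R)) => //.
  by apply: measurable_fun_pair => //; exact: measurable_affine.
have mg : measurable_fun setT ((fun z => f (z.1, c / a * z.1 + (d - b * c / a) * z.2))
    : planeR R -> \bar R).
  apply: (mfg (fun z => (z.1, c / a * z.1 + (d - b * c / a) * z.2))).
  apply: measurable_fun_pair => //.
  by apply: measurable_funD; apply: measurable_funM => //; exact: measurable_cst.
have e0 : d - b * c / a != 0.
  apply: contra_neq dA => H.
  have -> : a * d - b * c = (d - b * c / a) * a by field.
  by rewrite H mul0r.
rewrite ge0_integralZl_EFin ?invr_ge0 //; last 2 first.
- by move=> y _; apply: integral_ge0.
- exact: (@measurable_fun_fubini_tonelli_G _ _ _ _ _ _
    (fun z : planeR R => f (z.1, c / a * z.1 + (d - b * c / a) * z.2))).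
rewrite -(@fubini_tonelli _ _ _ _ _ leb leb (fun z : planeR R =>
   f (z.1, c / a * z.1 + (d - b * c / a) * z.2))) //=.
transitivity (`|a|^-1%:E * (\int[leb]_x
    (`|d - b * c / a|^-1%:E * \int[leb]_y f (x, y))))%E.
  congr (_ * _)%E; apply: eq_integral => x _.
  rewrite -(@integral_affine _ (d - b * c / a) (c / a * x) (fun y => f (x, y))) //.
  by apply: eq_integral => y _; rewrite [X in f (_, X)]addrC.
rewrite ge0_integralZl_EFin ?invr_ge0 //; last 2 first.
- by move=> y _; apply: integral_ge0.
- exact: (@measurable_fun_fubini_tonelli_F _ _ _ _ _ leb f mf f0).
rewrite FT muleA -EFinM; congr (_%:E * _)%E.
rewrite -invfM -normrM; congr (`|_|^-1); field.
by [].
Qed.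

End LinearChangeOfVariable.

(** * Trigonometric integrals and the fundamental cell *)

Section TrigonometricIntegrals.
Context {R : realType}.
Local Notation leb := (@lebesgue_measure R).

Lemma expi_2pi_nat (n : nat) : expi (2 * pi * n%:R) = 1 :> R[i].
Proof.
elim: n => [|n IH]; first by rewrite mulr0 expi0.
rewrite -[n.+1%:R]natr1 mulrDr expiD IH mul1r mulr1 mulr_natl.
by rewrite /expi cos2pi sin2pi.
Qed.

Lemma expi_2pi_int (n : int) : expi (2 * pi * n%:~R) = 1 :> R[i].
Proof.
case: (intP n) => [|k|k]; first by rewrite mulr0 expi0.
  by rewrite -[_%:~R]/(_%:R) expi_2pi_nat.
by rewrite rmorphN /= mulrN expiN -[_%:~R]/(_%:R) expi_2pi_nat rmorph1.
Qed.

Let is_derive_prim (th c x : R) : c != 0 ->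
  is_derive x 1 (fun y => c^-1 * sin (th + c * y)) (cos (th + c * x)).
Proof.
move=> c0.
have H1 : is_derive x 1 (fun y : R => th + c * y) c.
  rewrite (_ : (fun y => th + c * y) = cst th + c *: id); last first.
    by apply/funext => y.
  have H0 := @is_deriveD R R^o R^o (cst th) (c *: id) x 1 0 (c *: 1)
    (is_derive_cst _ _ _) (is_deriveZ c (is_derive_id _ _)).
  by apply: (is_derive_eq H0); rewrite add0r /GRing.scale /= mulr1.
have H2 := @is_derive1_comp R sin (fun y => th + c * y) x (cos (th + c * x)) c _ H1.
rewrite (_ : (fun y => c^-1 * sin (th + c * y)) =
  c^-1 *: (sin \o (fun y => th + c * y))); last by apply/funext.
apply: is_derive_eq.
by rewrite /GRing.scale /= mulrCA mulVf // mulr1.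
Qed.

Lemma continuous_cos_affine (th c : R) : continuous (fun y : R => cos (th + c * y)).
Proof.
move=> x; apply: (@continuous_comp _ _ _ (fun y => th + c * y) cos).
  by apply: continuousD; [exact: cvg_cst|apply: continuousM; [exact: cvg_cst|exact: cvg_id]].
exact: continuous_cos.
Qed.

Lemma integral_cos_period (th c L : R) (n : int) : 0 < L -> c != 0 ->
  c * L = 2 * pi * n%:~R -> (\int[leb]_(y in `[0%R, L]) (cos (th + c * y))%:E = 0)%E.
Proof.
move=> L0 c0 cL; pose F (y : R) : R := c^-1 * sin (th + c * y).
have dF x : is_derive x (1 : R) F (cos (th + c * x)) by exact: is_derive_prim.
have cF : continuous F.
  move=> x; apply: differentiable_continuous; apply/derivable1_diffP.
  by have [] := dF x.
rewrite (@continuous_FTC2 _ _ F) //.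
- rewrite -EFinB; congr EFin; rewrite /F mulr0 addr0 -mulrBr cL.
  have -> : sin (th + 2 * pi * n%:~R) = sin th.
    have : expi (th + 2 * pi * n%:~R) = expi th by rewrite expiD expi_2pi_int mulr1.
    by case.
  by rewrite subrr mulr0.
- by apply: continuous_subspaceT => x; exact: continuous_cos_affine.
- split => [x _|  |]; first by have [] := dF x.
  + by apply: cvg_at_right_filter; exact: cF.
  + by apply: cvg_at_left_filter; exact: cF.
- by move=> x _; rewrite derive1E; have [_ ->] := dF x.
Qed.

Lemma measurable_cos_affine (th c : R) (D : set R) :
  measurable_fun (D : set (timeR R)) (fun y : timeR R => cos (th + c * y)).
Proof.
apply: measurable_funTS; apply: continuous_measurable_fun.
exact: continuous_cos_affine.
Qed.

Lemma integrable_bounded d (T : measurableType d) (mu : {measure set T -> \bar R})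
    (D : set T) (f : T -> R) (M : R) : measurable D -> (mu D < +oo)%E ->
  measurable_fun D f -> (forall x, `|f x| <= M) ->
  mu.-integrable D (fun x => (f x)%:E).
Proof.
move=> mD fD mf fM; apply: (@measurable_bounded_integrable _ _ _ mu f D) => //.
exists M; split; first exact: num_real.
by move=> y My x _; exact: le_trans (fM x) (ltW My).
Qed.

Lemma cint_expi_period (c : R) (th L : R) (n : int) : 0 < L -> c != 0 ->
  c * L = 2 * pi * n%:~R ->
  cint leb `]0, L[ (fun y => expi (th + c * y)) = 0.
Proof.
move=> L0 c0 cL.
have H th' : (\int[leb]_(y in `]0%R, L[) cos (th' + c * y))%R = 0.
  rewrite /Rintegral -(@integral_itv_bndoo _ _ _ _ true false); last first.
    by apply/measurable_EFinP; exact: measurable_cos_affine.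
  by rewrite (integral_cos_period _ L0 c0 cL).
apply: complex_eqP => /=; first exact: H.
(* The sine is the cosine delayed by a quarter of a turn. *)
rewrite -[RHS](H (th - pi / 2)).
apply: eq_Rintegral => y _; rewrite -cosBpihalf; congr cos; ring.
Qed.

End TrigonometricIntegrals.

Section FourierBasis.
Context {R : realType}.
Variables (A : 'M[R]_2) (uA : A \in unitmx).
Local Notation leb := (@lebesgue_measure R).
Local Notation m := (`|\det A|).

Lemma detA_gt0 : 0 < m.
Proof. by rewrite normr_gt0; move: uA; rewrite unitmxE unitfE. Qed.

Lemma mulmxpK x : mulmxp (invmx A) (mulmxp A x) = x.
Proof. by rewrite -mulmxpM mulVmx // mulmxp1. Qed.

Lemma mulmxpVK x : mulmxp A (mulmxp (invmx A) x) = x.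
Proof. by rewrite -mulmxpM mulmxV // mulmxp1. Qed.

Lemma dotp_dual k x : dotp (dual_pt A k) x = dotp (intp k) (mulmxp (invmx A) x).
Proof. exact: dotp_tr. Qed.

Definition unit_square : set (R * R) := `[0, 1[%classic `*` `[0, 1[%classic.

Lemma measurable_unit_square : measurable (unit_square : set (planeR R)).
Proof. by apply: measurableX; exact: measurable_itv. Qed.

Lemma cellE : cell A = mulmxp (invmx A) @^-1` unit_square.
Proof.
apply/seteqP; split => [x [y [y1 y2] <-]|x].
  suff: unit_square (mulmxp (invmx A) (mulmxp A y)) by [].
  by rewrite mulmxpK; split => /=; rewrite in_itv.
rewrite -{2}[x]mulmxpVK; change (unit_square (mulmxp (invmx A) x) ->
  cell A (mulmxp A (mulmxp (invmx A) x))).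
move: (mulmxp (invmx A) x) => y [/=]; rewrite !in_itv => y1 y2.
by exists y.
Qed.

Lemma cell_mulmxp y : cell A (mulmxp A y) = unit_square y.
Proof. by rewrite cellE -[in RHS](mulmxpK y). Qed.

Lemma measurable_cell : measurable (cell A : set (planeR R)).
Proof.
rewrite cellE -[X in measurable X]setTI.
by apply: (@measurable_mulmxp R (invmx A)) => //; exact: measurable_unit_square.
Qed.

Lemma integral_cell (f : R * R -> \bar R) :
  measurable_fun setT (f : planeR R -> \bar R) -> (forall y, 0 <= f y)%E ->
  (\int[leb2 R]_(x in cell A) f x =
   m%:E * \int[leb2 R]_(y in unit_square) f (mulmxp A y))%E.
Proof.
move=> mf f0.
pose g := (f \_ (cell A)) : R * R -> \bar R.
have g0 y : (0 <= g y)%E by rewrite /g patchE; case: ifP.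
have mg : measurable_fun setT (g : planeR R -> \bar R).
  apply/(measurable_restrictT (f : planeR R -> \bar R)) => //; first exact: measurable_cell.
  exact: measurable_funTS.
have := @integral_linear R A g uA mg g0.
rewrite [X in (_ = _ * X)%E -> _](_ : _ = (\int[leb2 R]_(x in cell A) f x)%E); last first.
  by rewrite [RHS]integral_mkcond.
move=> H; rewrite [X in (m%:E * X)%E](_ : _ = (\int[leb2 R]_y g (mulmxp A y))%E); last first.
  rewrite integral_mkcond; apply: eq_integral => y _.
  rewrite /g !patchE; congr (if _ then _ else _).
  by apply/idP/idP => /set_mem yS; apply/mem_set; move: yS; rewrite cell_mulmxp.
by rewrite H muleA -EFinM mulfV ?mul1e // gt_eqF // detA_gt0.
Qed.

Lemma integral_plane (f : R * R -> \bar R) :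
  measurable_fun setT (f : planeR R -> \bar R) -> (forall y, 0 <= f y)%E ->
  (\int[leb2 R]_z f z = \int[leb]_x \int[leb]_y f (x, y))%E.
Proof. exact: (@fubini_tonelli1 _ _ _ _ _ leb leb f). Qed.

(** Adding [1] makes the integrand nonnegative, which is what Tonelli and the
    change of variables ask for; the free phase [th] gives cosine and sine
    together. *)
Lemma integral_unit_square_cos (k : int * int) (th : R) :
  (\int[leb2 R]_(y in unit_square) (1 + cos (th + 2 * pi * dotp (intp k) y))%:E =
   (1 + (k == (0, 0))%:R * cos th)%:E)%E.
Proof.
have L1 : leb `[0, 1[%classic = 1%E.
  by rewrite lebesgue_measure_itv /= lte_fin ltr01 oppr0 adde0.
have key th' (n : int) : (\int[leb]_(y in `[0%R, 1%R[) (1 + cos (th' + 2 * pi * n%:~R * y))%:E =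
    (1 + (n == 0)%:R * cos th')%:E)%E.
  have [->|n0] := eqVneq n 0.
    under eq_integral do rewrite mulr0 mul0r addr0.
    by rewrite integral_cst //= L1 mule1 mul1r.
  have c0 : 2 * pi * n%:~R != 0 :> R.
    by rewrite !mulf_neq0 // ?intr_eq0 // gt_eqF // pi_gt0.
  under eq_integral do rewrite EFinD.
  rewrite integralD //=; last 2 first.
  - by apply: (@integrable_bounded _ _ _ _ _ _ 1) => //= [|_]; rewrite ?L1 ?ltry ?normr1.
  - apply: (@integrable_bounded _ _ _ _ _ _ 1) => //=; rewrite ?L1 ?ltry //.
      exact: measurable_cos_affine.
    by move=> x; exact: cos_max.
  rewrite integral_cst //= L1 mule1 mul0r addr0 -[RHS]adde0; congr (_ + _)%E.
  rewrite integral_itv_bndo_bndc; last first.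
    by apply/measurable_EFinP; exact: measurable_cos_affine.
  by apply: (@integral_cos_period _ th' _ 1 n) => //; rewrite mulr1.
pose h : R * R -> \bar R := fun y => (1 + cos (th + 2 * pi * dotp (intp k) y))%:E.
have h0 y : (0 <= h y)%E by rewrite lee_fin -lerBlDl sub0r cos_geN1.
have mh : measurable_fun setT (h : planeR R -> \bar R).
  apply/measurable_EFinP; apply: measurable_funD; first exact: measurable_cst.
  apply: (@measurableT_comp _ _ _ _ _ _ cos).
    by apply: continuous_measurable_fun; exact: continuous_cos.
  apply: measurable_funD; first exact: measurable_cst.
  apply: measurable_funM; first exact: measurable_cst.
  by apply: measurable_funD; apply: measurable_funM => //; exact: measurable_cst.
rewrite integral_mkcond integral_plane; last 2 first.
- apply/(measurable_restrictT (h : planeR R -> \bar R)) => //; first exact: measurable_unit_square.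
  exact: measurable_funTS.
- by move=> y; rewrite patchE; case: ifP => // _; exact: h0.
transitivity (\int[leb]_(x in `[0%R, 1%R[)
   (1 + (k.2 == 0)%:R * cos (th + 2 * pi * k.1%:~R * x))%:E)%E.
  rewrite [RHS]integral_mkcond. apply: eq_integral => x _.
  rewrite patchE; case: ifPn => xI; last first.
    rewrite integral0_eq // => y _; rewrite patchE ifF //; apply/negP => /set_mem[/= x1 _].
    by move: xI; rewrite notin_setE; apply.
  rewrite -key [RHS]integral_mkcond; apply: eq_integral => y _.
  rewrite !patchE.
  have -> : ((x, y) \in unit_square) = (y \in `[0%R, 1%R[%classic).
    apply/idP/idP => /set_mem yS; apply/mem_set; first by case: yS.
    by split => //; exact/set_mem.
  by case: ifP => // _; rewrite /dotp /=; congr (1 + cos _)%:E; ring.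
have [k2|k2] := eqVneq k.2 0; last first.
  under eq_integral do rewrite mul0r addr0.
  rewrite integral_cst //= L1 mule1; case: k k2 {h h0 mh} => k1 k2 /= k20.
  by rewrite xpair_eqE (negbTE k20) andbF mul0r addr0.
under eq_integral do rewrite mul1r.
rewrite key; case: k k2 {h h0 mh} => k1 k2 /= ->.
by rewrite xpair_eqE eqxx andbT.
Qed.

End FourierBasis.

(** * Orthogonality of the modes, lattice points on circles *)

Section FourierOrthogonality.
Context {R : realType}.
Variables (A : 'M[R]_2) (uA : A \in unitmx).
Local Notation leb := (@lebesgue_measure R).
Local Notation m := (`|\det A|).
Local Notation Q := (cell A).

Let mQ := measurable_cell uA.

Lemma measure_cell : leb2 R Q = m%:E.
Proof.
have L1 : leb `[0, 1[%classic = 1%E.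
  by rewrite lebesgue_measure_itv /= lte_fin ltr01 oppr0 adde0.
have := @integral_cell R A uA (cst 1%E) (measurable_cst _) (fun=> lee01).
rewrite !integral_cst //=; last exact: measurable_unit_square.
rewrite !mul1e => ->.
rewrite [X in (_ * X)%E](_ : _ = 1%E) ?mule1 //.
by rewrite /unit_square product_measure1E //= L1 mule1.
Qed.

Lemma cell_lty : (leb2 R Q < +oo)%E.
Proof. by rewrite measure_cell ltry. Qed.

Lemma measurable_phase k (th : R) :
  measurable_fun setT ((fun x => th + 2 * pi * dotp (dual_pt A k) x) : planeR R -> R).
Proof.
apply: measurable_funD; first exact: measurable_cst.
apply: measurable_funM; first exact: measurable_cst.
by apply: measurable_funD; apply: measurable_funM => //; exact: measurable_cst.
Qed.

Lemma cmeasurable_fmode k : cmeasurable setT (fmode A k : planeR R -> R[i]).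
Proof.
apply: cmeasurable_expi.
have := @measurable_phase k 0; apply: eq_measurable_fun => x _.
by rewrite add0r.
Qed.

Lemma sqmod_fmode k x : sqmod (fmode A k x) = 1.
Proof. exact: sqmod_expi. Qed.

Lemma sqint_fmode k : sqint (leb2 R) Q (fmode A k).
Proof.
apply: sqintP.
  by apply: cmeasurableS (cmeasurable_fmode k) => //; exact: subsetT.
under eq_integral do rewrite sqmod_fmode.
by rewrite integral_cst //= mul1e cell_lty.
Qed.

Lemma Rintegral_cell_cos k (th : R) :
  (\int[leb2 R]_(x in Q) cos (th + 2 * pi * dotp (dual_pt A k) x))%R =
  m * ((k == (0, 0))%:R * cos th).
Proof.
pose h (x : R * R) := cos (th + 2 * pi * dotp (dual_pt A k) x).
have mh : measurable_fun setT (h : planeR R -> R).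
  apply: (@measurableT_comp _ _ _ _ _ _ (cos : R -> R)).
    by apply: continuous_measurable_fun; exact: continuous_cos.
  exact: measurable_phase.
have ih : (leb2 R).-integrable Q (fun x => (h x)%:E).
  apply: (@integrable_bounded R _ _ (leb2 R) _ h 1) => //; first exact: cell_lty.
    exact: measurable_funTS.
  by move=> x; exact: cos_max.
have i1 : (leb2 R).-integrable Q (fun x => 1%:E).
  apply: (@integrable_bounded R _ _ (leb2 R) _ (cst 1) 1) => //; first exact: cell_lty.
  by move=> x; rewrite normr1.
have m1h : measurable_fun setT ((fun x => (1 + h x)%:E) : planeR R -> \bar R).
  by apply/measurable_EFinP/measurable_funD => //; exact: measurable_cst.
have h0 x : (0 <= (1 + h x)%:E)%E by rewrite lee_fin -lerBlDl sub0r cos_geN1.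
have := integral_cell uA m1h h0.
rewrite [X in (_ = _ * X)%E -> _](_ : _ = (1 + (k == (0, 0))%:R * cos th)%:E); last first.
  rewrite -integral_unit_square_cos; apply: eq_integral => y _.
  by rewrite /h dotp_dual mulmxpK.
rewrite [X in X = _ -> _](_ : _ = (m%:E + \int[leb2 R]_(x in Q) (h x)%:E)%E); last first.
  under eq_integral do rewrite EFinD.
  rewrite integralD //; congr (_ + _)%E.
  by rewrite integral_cst // mul1e; exact: measure_cell.
move=> H; apply: (@addrI _ m); rewrite -[X in _ = X + _](mulr1 m) -mulrDr.
have /= <- := congr1 fine H.
by rewrite fineD //; exact: integrable_fin_num.
Qed.

Lemma cint_fmode k :
  cint (leb2 R) Q (fmode A k) = if k == (0, 0) then m%:C else 0.
Proof.
have := Rintegral_cell_cos k 0; have := Rintegral_cell_cos k (- (pi / 2)).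
rewrite cosN cos_pihalf cos0 !mulr0 mulr1 => H1 H2.
have -> : cint (leb2 R) Q (fmode A k) = (m * (k == (0, 0))%:R)%:C.
  rewrite -H2; apply: complex_eqP => /=.
    by apply: eq_Rintegral => x _; rewrite add0r.
  rewrite -[RHS]H1; apply: eq_Rintegral => x _.
  by rewrite [in RHS]addrC cosBpihalf.
by case: eqP; rewrite ?mulr1 ?mulr0.
Qed.

Lemma dual_ptB k l : dual_pt A (k - l) = dual_pt A k - dual_pt A l.
Proof.
case: k => k1 k2; case: l => l1 l2.
rewrite /dual_pt /mulmxp /= !rmorphB /=; congr (_, _); rewrite /=; ring.
Qed.

Lemma fmodeB k l x : fmode A (k - l) x = fmode A k x * (fmode A l x)^*.
Proof.
rewrite /fmode -expiN -expiD dual_ptB; congr expi.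
by rewrite /dotp /=; ring.
Qed.

Lemma ip_fmode k l :
  ip (leb2 R) Q (fmode A k) (fmode A l) = if k == l then m%:C else 0.
Proof.
rewrite -(subr_eq0 k l) -cint_fmode.
by apply: eq_cint => x _; rewrite fmodeB.
Qed.

Lemma dual_pt_inj : injective (dual_pt A).
Proof.
move=> k l kl.
have : dual_pt A (k - l) = 0 by rewrite dual_ptB kl subrr.
case: (k - l) (subr_eq0 k l) => a b kl0.
rewrite /dual_pt => H0.
have : mulmxp A^T (mulmxp (invmx A)^T (intp (a, b))) = 0.
  by rewrite H0 /mulmxp /= !mulr0 addr0.
rewrite -mulmxpM -trmx_mul mulVmx // trmx1 mulmxp1 => -[/eqP a0 /eqP b0].
move: a0 b0; rewrite !intr_eq0 => /eqP a0 /eqP b0.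
by apply/eqP; rewrite -kl0 a0 b0.
Qed.

End FourierOrthogonality.

Section CircleCount.
Context {R : realType}.

(** A line perpendicular to [e] meets the circle through [m] centred at the
    origin in at most one further point, the mirror image of [m] in the line
    spanned by [e]; both [p] and [q] are the displacement to that point. *)
Lemma circle_chord_unique (m p q e : R * R) : e != 0 -> p != 0 -> q != 0 ->
  dotp p e = 0 -> dotp q e = 0 ->
  2 * dotp m p + dotp p p = 0 -> 2 * dotp m q + dotp q q = 0 -> p = q.
Proof.
case: m p q e => [m1 m2] [p1 p2] [q1 q2] [e1 e2]; rewrite /dotp /= => e0 p0 q0 pe qe mp mq.
have E0 : e1 ^+ 2 + e2 ^+ 2 != 0.
  apply: contra_neq e0 => /eqP; rewrite paddr_eq0 ?sqr_ge0 // !sqrf_eq0.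
  by move=> /andP[/eqP -> /eqP ->].
pose b x1 x2 := (x2 * e1 - x1 * e2) / (e1 ^+ 2 + e2 ^+ 2).
have rep x1 x2 : x1 * e1 + x2 * e2 = 0 -> x1 = - b x1 x2 * e2 /\ x2 = b x1 x2 * e1.
  move=> xe; have E1 : x1 = (x1 * (e1 ^+ 2 + e2 ^+ 2) - e1 * (x1 * e1 + x2 * e2))
      / (e1 ^+ 2 + e2 ^+ 2) by rewrite xe; field.
  have E2 : x2 = (x2 * (e1 ^+ 2 + e2 ^+ 2) - e2 * (x1 * e1 + x2 * e2))
      / (e1 ^+ 2 + e2 ^+ 2) by rewrite xe; field.
  by split; [rewrite [LHS]E1|rewrite [LHS]E2]; rewrite /b; field.
have bval x1 x2 : (x1, x2) != 0 -> x1 * e1 + x2 * e2 = 0 ->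
    2 * (m1 * x1 + m2 * x2) + (x1 * x1 + x2 * x2) = 0 ->
    b x1 x2 = - 2 * (m2 * e1 - m1 * e2) / (e1 ^+ 2 + e2 ^+ 2).
  move=> x0 xe mx; have := rep _ _ xe; move: (b x1 x2) => t [r1 r2].
  rewrite {x1}r1 {x2}r2 in x0 xe mx *.
  have t0 : t != 0 by apply: contra_neq x0 => ->; rewrite oppr0 !mul0r.
  apply: (mulfI t0); apply: (mulIf E0).
  rewrite -[X in _ = X]mulrA divfK //.
  apply/eqP; rewrite -subr_eq0; apply/eqP; rewrite -[RHS]mx; ring.
have [r1 r2] := rep _ _ pe; have [s1 s2] := rep _ _ qe.
rewrite (bval _ _ p0 pe mp) in r1 r2; rewrite (bval _ _ q0 qe mq) in s1 s2.
by congr (_, _); [rewrite r1 s1|rewrite r2 s2].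
Qed.

Lemma count_le2 (T : eqType) (s : seq T) (P : pred T) (k : T) : uniq s ->
  (forall x y, P x -> P y -> x != k -> y != k -> x = y) -> (count P s <= 2)%N.
Proof.
move=> us H; rewrite -size_filter.
case: (boolP (has (predC1 k) [seq x <- s | P x])) => [/hasP[x]|/hasPn Hk]; last first.
  apply: (@leq_trans (size [:: k])) => //.
  apply: uniq_leq_size; first exact: filter_uniq.
  by move=> y /Hk /=; rewrite negbK inE.
rewrite mem_filter => /andP[Px xs] /= xk.
apply: (@leq_trans (size [:: k; x])) => //.
apply: uniq_leq_size; first exact: filter_uniq.
move=> y; rewrite mem_filter !inE => /andP[Py ys].
by case: (eqVneq y k) => //= yk; rewrite (H _ _ Py Px).
Qed.

Variables (A : 'M[R]_2) (uA : A \in unitmx).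
Local Notation lam := (eigval A).

Lemma eigvalE k : lam k = (2 * pi) ^+ 2 * dotp (dual_pt A k) (dual_pt A k).
Proof. by rewrite /eigval /dotp; ring. Qed.

Lemma dual_ptD k l : dual_pt A (k + l) = dual_pt A k + dual_pt A l.
Proof.
by apply/eqP; rewrite -subr_eq -dual_ptB addrK.
Qed.

(** With [e] the dual point of [k3 - k1], subtracting the two conditions leaves a
    linear one: the dual point of [k] lies on the circle of that of [k1] and on
    the line through the latter perpendicular to [e].  Only [k1] and one mirror
    image are possible. *)
Lemma count_parallelograms (s : seq (int * int)) (k1 k3 : int * int) :
  uniq s -> k1 != k3 ->
  (count (fun k => (lam k1 == lam k) && (lam k3 == lam (k + (k3 - k1)%R)%R)) s <= 2)%N.
Proof.
move=> us k13; apply: (count_le2 (k := k1)) => // x y.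
have P2 : (2 * pi) ^+ 2 != 0 :> R by rewrite expf_neq0 // mulf_neq0 // gt_eqF // pi_gt0.
pose e := dual_pt A (k3 - k1).
have key z : (lam k1 == lam z) && (lam k3 == lam (z + (k3 - k1))) ->
  dotp (dual_pt A z - dual_pt A k1) e = 0 /\
  2 * dotp (dual_pt A k1) (dual_pt A z - dual_pt A k1) +
    dotp (dual_pt A z - dual_pt A k1) (dual_pt A z - dual_pt A k1) = 0.
  rewrite !eigvalE => /andP[/eqP/(mulfI P2) h1 /eqP/(mulfI P2)].
  rewrite dual_ptD -/e; have -> : dual_pt A k3 = dual_pt A k1 + e.
    by rewrite /e dual_ptB addrC subrK.
  move: h1; rewrite /dotp /=; move: (dual_pt A k1) (dual_pt A z) e => [a b] [c d] [f g] /=.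
  by move=> h1 h2; split; lra.
move=> /key[x1 x2] /key[y1 y2] xk yk; apply: (dual_pt_inj uA).
apply: (addIr (- dual_pt A k1)).
have ne z : z != k1 -> dual_pt A z - dual_pt A k1 != 0.
  by rewrite subr_eq0 (inj_eq (dual_pt_inj uA)).
apply: (circle_chord_unique (m := dual_pt A k1) (e := e)) => //; try exact: ne.
by rewrite /e dual_ptB subr_eq0 (inj_eq (dual_pt_inj uA)) eq_sym.
Qed.

Lemma sum_count (T : eqType) (s : seq T) (P : pred T) :
  \sum_(k <- s) (P k)%:R = (count P s)%:R :> R.
Proof. by rewrite -sum1_count natr_sum [RHS]big_mkcond; apply: eq_bigr => k _; case: (P k). Qed.

Lemma sum_eq_le1 (T : eqType) (s : seq T) (k : T) : uniq s ->
  \sum_(l <- s) (k == l)%:R <= 1 :> R.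
Proof.
move=> us; rewrite sum_count lern1.
by rewrite (eq_count (a2 := pred1 k)) ?count_uniq_mem ?leq_b1.
Qed.

(** The quadruples whose product of modes survives integration over a time
    period and over the cell. *)
Definition resonant (k1 k2 k3 k4 : int * int) : bool :=
  [&& lam k1 == lam k2, lam k3 == lam k4 & k1 - k2 == k3 - k4].

(** [k4] is determined by the other three, so that quadruples are counted by
    [k2]. *)
Lemma sum_resonant_le2 (s : seq (int * int)) (k1 k3 : int * int) : uniq s -> k1 != k3 ->
  \sum_(k2 <- s) \sum_(k4 <- s) (resonant k1 k2 k3 k4)%:R <= 2 :> R.
Proof.
move=> us k13.
apply: (@le_trans _ _ (\sum_(k2 <- s)
   ((lam k1 == lam k2) && (lam k3 == lam (k2 + (k3 - k1))))%:R)); last first.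
  by rewrite sum_count ler_nat count_parallelograms.
apply: ler_sum => k2 _; rewrite /resonant.
have E k4 : (k1 - k2 == k3 - k4) = (k2 + (k3 - k1) == k4).
  rewrite -subr_eq0 -[in RHS]subr_eq0 -[in LHS]oppr_eq0; congr (_ == 0); ring.
have [l12|] /= := eqVneq (lam k1) (lam k2); last by rewrite big1.
under eq_bigr => k4 _ do rewrite E.
case: (eqVneq (lam k3) (lam (k2 + (k3 - k1)))) => [l34|l34].
  apply: le_trans (sum_eq_le1 (k2 + (k3 - k1)) us).
  by apply: ler_sum => k4 _; rewrite ler_nat; case: (lam k3 == _).
rewrite big1 // => k4 _; case: eqP => //= l34'; case: eqP => //= k24.
by move: l34; rewrite l34' k24 eqxx.
Qed.

(** If [k1 = k3], then [k2 = k4], and these quadruples contribute at most the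
    square of the sum.  For the others, the inequality between the arithmetic
    and geometric means separates the pairs [(k1, k3)] and [(k2, k4)]; each pair
    occurs in at most two resonances, so each half contributes at most twice the
    square, with weight [1/2]. *)
Lemma sum4_bound (s : seq (int * int)) (c : int * int -> R[i]) : uniq s ->
  \sum_(k1 <- s) \sum_(k2 <- s) \sum_(k3 <- s) \sum_(k4 <- s)
    (resonant k1 k2 k3 k4)%:R * Re (c k1 * (c k2)^* * (c k3 * (c k4)^*)^*)
  <= 3 * (\sum_(k <- s) sqmod (c k)) ^+ 2.
Proof.
move=> us; set S := \sum_(k <- s) sqmod (c k); pose a k := sqmod (c k).
have a0 k : 0 <= a k by exact: sqmod_ge0.
have S2 : \sum_(k <- s) \sum_(l <- s) a k * a l = S ^+ 2.
  by rewrite expr2 /S big_distrlr.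
pose off k1 k2 k3 k4 : R := ((k1 != k3) && resonant k1 k2 k3 k4)%:R.
have term k1 k2 k3 k4 :
    (resonant k1 k2 k3 k4)%:R * Re (c k1 * (c k2)^* * (c k3 * (c k4)^*)^*) <=
    a k1 * a k2 * ((k1 == k3)%:R * (k2 == k4)%:R) +
    2^-1 * (a k1 * a k3 * off k1 k2 k3 k4 + a k2 * a k4 * off k1 k2 k3 k4).
  rewrite /off; case: (boolP (resonant _ _ _ _)) => [Hr|_]; last first.
    by rewrite mul0r andbF !mulr0 addr0 mulr0 addr0 !mulr_ge0.
  have [k13|k13] /= := eqVneq k1 k3.
    have k24 : k2 = k4.
      move: Hr => /and3P[_ _ /eqP]; rewrite k13 => /addrI/oppr_inj //.
    rewrite -k13 -k24 eqxx !mul1r !mulr0 addr0 mulr0 addr0 mulr1.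
    by rewrite mulJ_sqmod sqmodM sqmodJ.
  rewrite mul1r mul0r mulr0 add0r !mulr1.
  have -> : c k1 * (c k2)^* * (c k3 * (c k4)^*)^* = (c k1 * (c k3)^*) * ((c k2)^* * c k4).
    by rewrite rmorphM /= conjCK; ring.
  by rewrite (le_trans (Re_mul_le _ _)) // !sqmodM !sqmodJ.
have step1 : \sum_(k1 <- s) \sum_(k2 <- s) \sum_(k3 <- s) \sum_(k4 <- s)
    a k1 * a k2 * ((k1 == k3)%:R * (k2 == k4)%:R) <= S ^+ 2.
  rewrite -S2; apply: ler_sum => k1 _; apply: ler_sum => k2 _.
  under eq_bigr => k3 _ do rewrite -mulr_sumr -mulr_sumr.
  rewrite -mulr_sumr -mulr_suml -[leRHS]mulr1; apply: ler_wpM2l; first exact: mulr_ge0.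
  rewrite -[leRHS]mulr1; apply: ler_pM; rewrite ?sum_eq_le1 ?sumr_ge0 //.
have off_le k1 k3 : \sum_(k2 <- s) \sum_(k4 <- s) off k1 k2 k3 k4 <= 2.
  rewrite /off; have [k13|k13] /= := eqVneq k1 k3.
    by rewrite big1 // => k2 _; rewrite big1.
  exact: sum_resonant_le2.
have offC k1 k2 k3 k4 : off k1 k2 k3 k4 = off k2 k1 k4 k3.
  rewrite /off; congr (_%:R); congr nat_of_bool; rewrite /resonant.
  rewrite [lam k2 == _]eq_sym [lam k4 == _]eq_sym.
  have -> : (k2 - k1 == k4 - k3) = (k1 - k2 == k3 - k4).
    by rewrite -eqr_opp !opprB.
  case: (k1 - k2 =P k3 - k4) => [H|]; last by rewrite !andbF.
  congr (~~ _ && _); apply/eqP/eqP => [k13|k24].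
    by move: H; rewrite k13 => /addrI/oppr_inj.
  by move: H; rewrite k24 => /addIr.
have step2 : \sum_(k1 <- s) \sum_(k2 <- s) \sum_(k3 <- s) \sum_(k4 <- s)
    a k1 * a k3 * off k1 k2 k3 k4 <= 2 * S ^+ 2.
  rewrite -S2 mulr_sumr; apply: ler_sum => k1 _.
  rewrite exchange_big /= mulr_sumr; apply: ler_sum => k3 _.
  under eq_bigr => k2 _ do rewrite -mulr_sumr.
  rewrite -mulr_sumr mulrC; apply: ler_wpM2r; first exact: mulr_ge0.
  exact: off_le.
have step3 : \sum_(k1 <- s) \sum_(k2 <- s) \sum_(k3 <- s) \sum_(k4 <- s)
    a k2 * a k4 * off k1 k2 k3 k4 <= 2 * S ^+ 2.
  apply: le_trans step2; rewrite exchange_big /=; apply: ler_sum => k2 _.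
  apply: ler_sum => k1 _; rewrite exchange_big /=; apply: ler_sum => k4 _.
  by apply: ler_sum => k3 _; rewrite offC.
apply: (@le_trans _ _ (S ^+ 2 + 2^-1 * (2 * S ^+ 2 + 2 * S ^+ 2))); last by lra.
apply: (@le_trans _ _ (\sum_(k1 <- s) \sum_(k2 <- s) \sum_(k3 <- s) \sum_(k4 <- s)
    (a k1 * a k2 * ((k1 == k3)%:R * (k2 == k4)%:R) +
    2^-1 * (a k1 * a k3 * off k1 k2 k3 k4 + a k2 * a k4 * off k1 k2 k3 k4)))).
  do 4 (apply: ler_sum => ? _); exact: term.
pose S4 (F : int * int -> int * int -> int * int -> int * int -> R) :=
  \sum_(k1 <- s) \sum_(k2 <- s) \sum_(k3 <- s) \sum_(k4 <- s) F k1 k2 k3 k4.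
have S4D F G : S4 (fun k1 k2 k3 k4 => F k1 k2 k3 k4 + G k1 k2 k3 k4) = S4 F + S4 G.
  rewrite /S4; do 3 (rewrite -big_split /=; apply: eq_bigr => ? _).
  by rewrite -big_split.
have S4Z (r : R) F : S4 (fun k1 k2 k3 k4 => r * F k1 k2 k3 k4) = r * S4 F.
  rewrite /S4; do 3 (rewrite mulr_sumr; apply: eq_bigr => ? _).
  by rewrite mulr_sumr.
rewrite -/(S4 (fun k1 k2 k3 k4 => a k1 * a k2 * ((k1 == k3)%:R * (k2 == k4)%:R) +
    2^-1 * (a k1 * a k3 * off k1 k2 k3 k4 + a k2 * a k4 * off k1 k2 k3 k4))).
rewrite (S4D (fun k1 k2 k3 k4 => a k1 * a k2 * ((k1 == k3)%:R * (k2 == k4)%:R))).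
rewrite S4Z (S4D (fun k1 k2 k3 k4 => a k1 * a k3 * off k1 k2 k3 k4)).
by apply: lerD => //; apply: ler_wpM2l => //; exact: lerD.
Qed.

End CircleCount.

(** * Free waves with finitely many modes *)

Section InnerProductOfCombinations.
Context {R : realType} d (T : measurableType d).
Variables (mu : {measure set T -> \bar R}) (D : set T) (mD : measurable D).

Lemma ip_sumr (K : Type) (s : seq K) (b : K -> R[i]) (e : K -> T -> R[i]) h :
  (forall k, sqint mu D (e k)) -> sqint mu D h ->
  ip mu D h (fun x => \sum_(k <- s) b k * e k x) =
  \sum_(k <- s) (b k)^* * ip mu D h (e k).
Proof.
move=> eL hL; have bL k : sqint mu D (fun x => b k * e k x) by exact: (sqintZ mD).
rewrite ipC //; last exact: (sqint_sum mD).
rewrite ip_suml // rmorph_sum; apply: eq_bigr => k _.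
by rewrite ipZl // rmorphM; congr (_ * _); rewrite [ip _ _ h _]ipC.
Qed.

Lemma ip_comb2 (K L : Type) (s : seq K) (r : seq L) (a : K -> R[i]) (b : L -> R[i])
    (e : K -> T -> R[i]) (f : L -> T -> R[i]) :
  (forall k, sqint mu D (e k)) -> (forall l, sqint mu D (f l)) ->
  ip mu D (fun x => \sum_(k <- s) a k * e k x) (fun x => \sum_(l <- r) b l * f l x) =
  \sum_(k <- s) \sum_(l <- r) a k * (b l)^* * ip mu D (e k) (f l).
Proof.
move=> eL fL; rewrite ip_suml //; last 2 first.
- by move=> k; exact: (sqintZ mD).
- by apply: (sqint_sum mD) => l; exact: (sqintZ mD).
apply: eq_bigr => k _; rewrite ipZl //; last by apply: (sqint_sum mD) => l; exact: (sqintZ mD).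
by rewrite ip_sumr // mulr_sumr; apply: eq_bigr => l _; rewrite mulrA.
Qed.

End InnerProductOfCombinations.

Section HomogeneousEstimate.
Context {R : realType}.
Variables (A : 'M[R]_2) (uA : A \in unitmx) (gamma : R) (g0 : 0 < gamma).
Hypothesis hspec : forall k : int * int, exists n : nat, eigval A k = gamma * n%:R.
Local Notation leb := (@lebesgue_measure R).
Local Notation m := (`|\det A|).
Local Notation Q := (cell A).
Local Notation tau := (2 * pi / gamma).
Local Notation lam := (eigval A).
Local Notation I := (`]0, tau[%classic : set (timeR R)).
Implicit Types (s : seq (int * int)) (c : int * int -> R[i]).

Let mQ := measurable_cell uA.

Lemma tau_gt0 : 0 < tau.
Proof. by rewrite divr_gt0 // mulr_gt0 // pi_gt0. Qed.

Lemma leb_I : leb `]0, tau[%classic = tau%:E.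
Proof. by rewrite lebesgue_measure_itv /= lte_fin tau_gt0 oppr0 adde0. Qed.

Lemma measurable_time : measurable I.
Proof. exact: measurable_itv. Qed.

Let mI := measurable_time.

Definition phase k (t : R) : R[i] := expi (- (t * lam k)).

Lemma sqmod_phase k t : sqmod (phase k t) = 1.
Proof. exact: sqmod_expi. Qed.

Lemma cmeasurable_phase k : cmeasurable setT (phase k : timeR R -> R[i]).
Proof.
by apply: cmeasurable_expi; apply: measurable_funN; apply: measurable_funM.
Qed.

Lemma sqint_phase k : sqint leb I (phase k).
Proof.
apply: sqintP.
  by apply: cmeasurableS (cmeasurable_phase k) => //; exact: subsetT.
under eq_integral do rewrite sqmod_phase.
by rewrite integral_cst ?mul1e ?[X in (X < _)%E]leb_I ?ltry //; exact: measurable_time.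
Qed.

(** The time frequencies are multiples of [gamma], so distinct ones are
    orthogonal over a full period. *)
Lemma ip_phase k l : ip leb I (phase k) (phase l) = if lam k == lam l then tau%:C else 0.
Proof.
have E : ip leb I (phase k) (phase l) =
    cint leb I (fun t => expi (0 + (lam l - lam k) * t)).
  by apply: eq_cint => t _; rewrite /phase -expiN -expiD; congr expi; ring.
rewrite E; have [kl|kl] := eqVneq (lam k) (lam l).
  rewrite kl; apply: complex_eqP => /=.
    transitivity (\int[leb]_(t in I) 1)%R; last first.
      rewrite Rintegral_cst ?mul1r; last exact: measurable_time.
      by rewrite [X in fine X]leb_I.
    by apply: eq_Rintegral => t _; rewrite subrr mul0r addr0 cos0.
  transitivity (\int[leb]_(t in I) 0)%R; last first.
    by rewrite Rintegral_cst ?mul0r //; exact: measurable_time.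
  by apply: eq_Rintegral => t _; rewrite subrr mul0r addr0 sin0.
have [a ka] := hspec k; have [b lb] := hspec l.
apply: (@cint_expi_period R _ 0 _ (b%:Z - a%:Z)); first exact: tau_gt0.
  by rewrite subr_eq0 eq_sym.
rewrite ka lb rmorphB /= -!pmulrn; field.
by rewrite gt_eqF.
Qed.

Definition wave s c (t : R) (x : R * R) : R[i] :=
  \sum_(k <- s) c k * phase k t * fmode A k x.

(** [tau * density s c x] is the time integral of [|wave s c t x|^2]. *)
Definition density s c (x : R * R) : R[i] :=
  \sum_(k <- s) \sum_(l <- s)
    (((lam k == lam l)%:R)%:C * (c k * (c l)^*)) * fmode A (k - l) x.

Lemma integral_wave_time s c x :
  (\int[leb]_(t in I) (sqmod (wave s c t x))%:E = (tau * Re (density s c x))%:E)%E.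
Proof.
pose a k := c k * fmode A k x.
have wE t : wave s c t x = \sum_(k <- s) a k * phase k t.
  by apply: eq_bigr => k _; rewrite mulrAC.
have wL : sqint leb I (fun t => \sum_(k <- s) a k * phase k t).
  by apply: (sqint_sum mI) => k; apply: (sqintZ mI); exact: sqint_phase.
under eq_integral do rewrite wE.
rewrite (nsqE mI) //.
congr EFin.
suff /(congr1 (@complex.Re R)) : (nsq leb I (fun t => \sum_(k <- s) a k * phase k t))%:C =
  tau%:C * density s c x by rewrite cReM /= mul0r subr0.
rewrite -(ip_nsq mI) // (ip_comb2 mI) //; try exact: sqint_phase.
rewrite /density mulr_sumr; apply: eq_bigr => k _; rewrite mulr_sumr.
apply: eq_bigr => l _; rewrite ip_phase fmodeB // /a rmorphM.
case: ifP => _; last by rewrite mulr0 !mul0r mulr0.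
by rewrite mul1r mulrC; congr (_ * _); ring.
Qed.

(** By orthogonality of the modes in space, the square of the density integrates
    to the sum over resonant quadruples. *)
Lemma nsq_density_le s c : uniq s ->
  nsq (leb2 R) Q (density s c) <= 3 * m * (\sum_(k <- s) sqmod (c k)) ^+ 2.
Proof.
move=> us; pose b (p : (int * int) * (int * int)) : R[i] :=
  ((lam p.1 == lam p.2)%:R)%:C * (c p.1 * (c p.2)^*).
pose e (p : (int * int) * (int * int)) := fmode A (p.1 - p.2).
pose r := [seq (k, l) | k <- s, l <- s].
have eL p : sqint (leb2 R) Q (e p) by exact: sqint_fmode.
have dE : density s c = fun x => \sum_(p <- r) b p * e p x.
  by apply/funext => x; rewrite big_allpairs.
have dL : sqint (leb2 R) Q (density s c).
  by rewrite dE; apply: (sqint_sum mQ) => p; exact: (sqintZ mQ).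
have -> : nsq (leb2 R) Q (density s c) = Re (ip (leb2 R) Q (density s c) (density s c)).
  by rewrite (ip_nsq mQ).
rewrite dE (ip_comb2 mQ) // cRe_sum [3 * m]mulrC -mulrA.
apply: (@le_trans _ _ (m * \sum_(k1 <- s) \sum_(k2 <- s) \sum_(k3 <- s) \sum_(k4 <- s)
    (resonant A k1 k2 k3 k4)%:R * Re (c k1 * (c k2)^* * (c k3 * (c k4)^*)^*))); last first.
  by apply: ler_wpM2l => //; exact: sum4_bound.
rewrite big_allpairs mulr_sumr; apply: ler_sum => k1 _.
rewrite mulr_sumr; apply: ler_sum => k2 _.
rewrite cRe_sum big_allpairs mulr_sumr; apply: ler_sum => k3 _.
rewrite mulr_sumr; apply: ler_sum => k4 _.
rewrite ip_fmode // /resonant /b /=.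
case: eqP => _ /=; last by rewrite !mul0r mulr0.
case: eqP => _ /=; last by rewrite mul0r rmorph0 !mulr0 !mul0r mulr0.
case: eqP => _ /=; last by rewrite !mul0r mulr0 mulr0.
by rewrite !mul1r [X in X <= _]cReM /= !mulr0 subr0 mulrC.
Qed.

Lemma homogeneous_estimate s c : uniq s ->
  (\int[leb2 R]_(x in Q) ((tau * Re (density s c x)) ^+ 2)%:E <=
   (3 * tau ^+ 2 * m * (\sum_(k <- s) sqmod (c k)) ^+ 2)%:E)%E.
Proof.
move=> us; have dL : sqint (leb2 R) Q (density s c).
  apply: (sqint_sum mQ) => k; apply: (sqint_sum mQ) => l; apply: (sqintZ mQ).
  exact: sqint_fmode.
have -> : 3 * tau ^+ 2 * m * (\sum_(k <- s) sqmod (c k)) ^+ 2 =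
  tau ^+ 2 * (3 * m * (\sum_(k <- s) sqmod (c k)) ^+ 2) by ring.
apply: (@le_trans _ _ (\int[leb2 R]_(x in Q) ((tau ^+ 2)%:E * (sqmod (density s c x))%:E))%E).
  have [mR _] := dL.1.
  apply: ge0_le_integral => //.
  - by move=> x _; rewrite lee_fin sqr_ge0.
  - apply/measurable_EFinP; apply: measurable_funX.
    by apply: measurable_funM; [exact: measurable_cst|exact: mR].
  - by apply: measurable_funeM; apply/measurable_EFinP; apply: measurable_sqmod; exact: dL.1.
  - move=> x _; rewrite -EFinM lee_fin exprMn ler_wpM2l ?sqr_ge0 //.
    by rewrite lerDl sqr_ge0.
rewrite ge0_integralZl_EFin ?sqr_ge0 //.
- rewrite (nsqE mQ) // -EFinM lee_fin ler_wpM2l ?sqr_ge0 //; exact: nsq_density_le.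
- by move=> x _; rewrite lee_fin sqmod_ge0.
- by apply/measurable_EFinP; apply: measurable_sqmod; exact: dL.1.
Qed.

End HomogeneousEstimate.

(** * Minkowski's integral inequality for square functions *)

Section MinkowskiIntegralInequality.
Context {R : realType}.
Local Open Scope ereal_scope.

Lemma le_poweR (r : R) (a b : \bar R) : (0 <= r)%R -> 0 <= a -> a <= b -> a `^ r <= b `^ r.
Proof.
move=> r0 a0 ab; apply: gt0_ler_poweR => //; rewrite in_itv /= leey andbT //.
exact: le_trans ab.
Qed.

Lemma cauchy_schwarz_ereal d (X : measurableType d) (mu : {measure set X -> \bar R})
    (g h : X -> R) :
  measurable_fun setT g -> measurable_fun setT h ->
  (forall x, 0 <= g x)%R -> (forall x, 0 <= h x)%R ->
  \int[mu]_x (g x * h x)%:E <=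
  (\int[mu]_x (g x ^+ 2)%:E) `^ 2^-1 * (\int[mu]_x (h x ^+ 2)%:E) `^ 2^-1.
Proof.
move=> mg mh g0 h0.
have N2 (f : X -> R) : (forall x, 0 <= f x)%R ->
    Lnorm mu 2%:E (EFin \o f) = (\int[mu]_x (f x ^+ 2)%:E) `^ 2^-1.
  move=> f0; rewrite unlock; congr (_ `^ _); apply: eq_integral => x _.
  by rewrite /= ger0_norm // powR_mulrn.
have := @hoelder _ _ _ mu g h 2 2 mg mh (ltr0Sn _ _) (ltr0Sn _ _).
rewrite !N2 // Lnorm1 => H; rewrite [leLHS](_ : _ =
    \int[mu]_x `|(EFin \o (g \* h)%R) x|); first by apply: H; field.
by apply: eq_integral => x _; rewrite /= ger0_norm // mulr_ge0.
Qed.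

Variables (d1 d2 : measure_display) (S : measurableType d1) (X : measurableType d2).
Variables (m1 : {sigma_finite_measure set S -> \bar R}).
Variables (m2 : {sigma_finite_measure set X -> \bar R}).

(** Expanding the square turns the left side into a triple integral; after
    exchanging the order, the inner integral is an inner product. *)
Lemma minkowski_L2 (f : S * X -> R) :
  measurable_fun setT f -> (forall z, 0 <= f z)%R ->
  \int[m2]_x (\int[m1]_s (f (s, x))%:E) ^+ 2 <=
  (\int[m1]_s (\int[m2]_x (f (s, x) ^+ 2)%:E) `^ 2^-1) ^+ 2.
Proof.
move=> mf f0; pose F z := (f z)%:E; pose J x := \int[m1]_s F (s, x).
pose N s := (\int[m2]_x (f (s, x) ^+ 2)%:E) `^ 2^-1.
have mF : measurable_fun setT F by exact/measurable_EFinP.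
have F0 z : 0 <= F z by rewrite lee_fin.
have mJ : measurable_fun setT J by exact: (measurable_fun_fubini_tonelli_G F).
have J0 x : 0 <= J x by apply: integral_ge0.
have N0 s : 0 <= N s by exact: poweR_ge0.
have mF1 x : measurable_fun setT (fun s => F (s, x)) by exact: measurable_fun_pair1.
have mF2 s : measurable_fun setT (fun x => F (s, x)) by exact: measurable_fun_pair2.
have mN : measurable_fun setT N.
  apply: (@measurableT_comp _ _ _ _ _ _ (fun y : \bar R => y `^ 2^-1)).
    exact: measurable_poweR.
  apply: (measurable_fun_fubini_tonelli_F (fun z => (f z ^+ 2)%:E)).
    by apply/measurable_EFinP; exact: measurable_funX.
  by move=> z; rewrite lee_fin sqr_ge0.
have mFJ : measurable_fun setT (fun z : S * X => F z * J z.2).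
  by apply: emeasurable_funM => //; exact: (measurableT_comp mJ).
have E1 : \int[m2]_x (J x) ^+ 2 = \int[m2]_x \int[m1]_s (F (s, x) * J x).
  by apply: eq_integral => x _; rewrite ge0_integralZr.
rewrite -[leLHS]/(\int[m2]_x (J x) ^+ 2) {}E1.
rewrite -(fubini_tonelli (fun z : S * X => F z * J z.2)) //; last first.
  by move=> z; rewrite mule_ge0.
rewrite -[leRHS]/((\int[m1]_s N s) ^+ 2) expe2 -ge0_integralZr //; last first.
  exact: integral_ge0.
apply: ge0_le_integral => //.
- by move=> s _; apply: integral_ge0 => x _; rewrite mule_ge0.
- apply: (measurable_fun_fubini_tonelli_F (fun z : S * X => F z * J z.2)) => // z.
  by rewrite mule_ge0.
- by apply: emeasurable_funM => //; exact: measurable_cst.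
move=> s _ /=.
pose G (z : S * X) := F (s, z.2) * F z.
have mG : measurable_fun setT G.
  by apply: emeasurable_funM => //; exact: (measurableT_comp (mF2 s)).
have G0 z : 0 <= G z by rewrite mule_ge0.
have E2 : \int[m2]_x (F (s, x) * J x) = \int[m2]_x \int[m1]_s' G (s', x).
  by apply: eq_integral => x _; rewrite /G /= ge0_integralZl.
rewrite E2 -(fubini_tonelli G) // -ge0_integralZl //.
apply: ge0_le_integral => //.
- by move=> s' _; exact: integral_ge0.
- exact: (measurable_fun_fubini_tonelli_F G).
- by apply: emeasurable_funM => //; exact: measurable_cst.
move=> s' _; rewrite /G /F /=.
under eq_integral do rewrite -EFinM.
apply: cauchy_schwarz_ereal => //.
- exact: (measurable_fun_pair2 s mf).
- exact: (measurable_fun_pair2 s' mf).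
Qed.

End MinkowskiIntegralInequality.

(** * Superpositions of free waves over the past *)

Section PlaneMeasure.
Variable R : realType.

Lemma sigma_finite_plane : sigma_finite setT (leb2 R).
Proof.
exists (fun n : nat => `]- n%:R, n%:R[%classic `*` `]- n%:R, n%:R[%classic).
  apply/esym; rewrite -subTset => -[x y] _.
  have H := @archi_boundP R (`|x| + `|y|) (addr_ge0 (normr_ge0 _) (normr_ge0 _)).
  exists (Num.bound (`|x| + `|y|)) => //; split;
    rewrite /= in_itv /= -ltr_norml; apply: le_lt_trans H.
    by rewrite lerDl.
  by rewrite lerDr.
move=> n; split; first by apply: measurableX.
rewrite [X in (X < _)%E]product_measure1E //=.
by rewrite !lebesgue_measure_itv /=; case: ifP => _; rewrite ?mule0 ?ltry // -EFinD -EFinM ltry.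
Qed.

(** The product measure packed with its sigma-finiteness, so that it can take
    part in further products. *)
Definition plane_measure : {sigma_finite_measure set (planeR R) -> \bar R} :=
  HB.pack (leb2 R) (Measure_isSigmaFinite.Build _ _ _ (leb2 R) sigma_finite_plane).

End PlaneMeasure.

Section PastIntegral.
Context {R : realType}.
Local Notation leb := (@lebesgue_measure R).

Lemma measurable_past_ge0 (g : R -> R) : (forall r, 0 <= g r) ->
  leb.-integrable setT (fun r => (g r)%:E) ->
  measurable_fun setT ((fun t => \int[leb]_(r in `]-oo, t[) g r)%R : timeR R -> R).
Proof.
move=> g0 ig; apply: nondecreasing_measurable => // t1 t2 t12.
have ige t : leb.-integrable `]-oo, t[ (fun r => (g r)%:E).
  exact: integrableS ig.
rewrite /Rintegral fine_le //; try by apply: integrable_fin_num.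
apply: ge0_subset_integral => //.
- exact: (measurable_int leb (ige t2)).
- by move=> r _; rewrite lee_fin.
- by apply: subset_itvl; rewrite bnd_simp.
Qed.

(** The primitive of an integrable function is a difference of two nondecreasing
    functions of the endpoint. *)
Lemma measurable_past (f : R -> R) : leb.-integrable setT (fun r => (f r)%:E) ->
  measurable_fun setT ((fun t => \int[leb]_(r in `]-oo, t[) f r)%R : timeR R -> R).
Proof.
move=> fi; have fa : leb.-integrable setT (fun r => (`|f r|)%:E).
  exact: (integrable_abse fi).
have fp : leb.-integrable setT (fun r => (`|f r| + f r)%:E).
  by under eq_fun do rewrite EFinD; exact: integrableD.
have iS (g : R -> R) t : leb.-integrable setT (fun r => (g r)%:E) ->
    leb.-integrable `]-oo, t[ (EFin \o g).
  by move=> ig; exact: integrableS ig.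
rewrite (_ : (fun t => _) = (fun t =>
    \int[leb]_(r in `]-oo, t[) (`|f r| + f r) - \int[leb]_(r in `]-oo, t[) `|f r|)%R).
  apply: measurable_funB; apply: measurable_past_ge0 => // r.
  by rewrite -lerBlDr sub0r -normrN ler_norm.
apply/funext => t; rewrite -RintegralB //; try exact: iS.
by apply: eq_Rintegral => r _; rewrite addrAC subrr add0r.
Qed.

End PastIntegral.

Section DuhamelEstimate.
Context {R : realType}.
Variables (A : 'M[R]_2) (uA : A \in unitmx) (gamma : R) (g0 : 0 < gamma).
Hypothesis hspec : forall k : int * int, exists n : nat, eigval A k = gamma * n%:R.
Local Notation leb := (@lebesgue_measure R).
Local Notation m := (`|\det A|).
Local Notation Q := (cell A).
Local Notation tau := (2 * pi / gamma).
Local Notation I := (`]0, tau[%classic : set (timeR R)).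
Variables (s : seq (int * int)) (us : uniq s) (psi : int * int -> R -> R[i]).
Hypothesis ipsi : forall k, cintegrable leb setT (psi k).

Let mQ := measurable_cell uA.
Let mI := measurable_time gamma.

Definition past_integral (k : int * int) (t : R) : R[i] := cint leb `]-oo, t[ (psi k).

Let mpsi k : cmeasurable setT (psi k : timeR R -> R[i]).
Proof. exact: cintegrable_measurable. Qed.

Lemma cmeasurable_past_integral k : cmeasurable setT (past_integral k : timeR R -> R[i]).
Proof. by have [i1 i2] := ipsi k; split; exact: measurable_past. Qed.

Lemma cmeasurable_duhamel : cmeasurable setT
  ((fun z => wave A s (past_integral^~ z.1) z.1 z.2) : timeR R * planeR R -> R[i]).
Proof.
apply: cmeasurable_sum => k; apply: cmeasurableM.
  apply: cmeasurableM.
    apply: (@cmeasurable_comp _ _ _ (timeR R * planeR R)%type (timeR R) (past_integral k) fst) => //.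
    exact: cmeasurable_past_integral.
  apply: (@cmeasurable_comp _ _ _ (timeR R * planeR R)%type (timeR R) (phase A k) fst) => //.
  exact: cmeasurable_phase.
apply: (@cmeasurable_comp _ _ _ (timeR R * planeR R)%type (planeR R) (fmode A k) snd) => //.
exact: cmeasurable_fmode.
Qed.

Let rho (r : R) := \sum_(k <- s) sqmod (psi k r).
Let w (r t : R) (x : R * R) := normc (wave A s (psi^~ r) t x).
Let Y (r : R) (x : R * R) := Num.sqrt (tau * Re (density A s (psi^~ r) x)).

Let rho0 r : 0 <= rho r.
Proof. by apply: sumr_ge0 => k _; exact: sqmod_ge0. Qed.

Let density_ge0 c x : 0 <= tau * Re (density A s c x).
Proof.
rewrite -lee_fin -integral_wave_time //; apply: integral_ge0 => t _.
by rewrite lee_fin sqmod_ge0.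
Qed.

(** Dropping the constraint [r < t] in the bound for the superposition leaves
    free waves that live on the whole period, to which the homogeneous estimate
    applies. *)
Let normc_wave_le t x :
  ((normc (wave A s (past_integral^~ t) t x))%:E <= \int[leb]_r (w r t x)%:E)%E.
Proof.
have mt : measurable (`]-oo, t[%classic : set (timeR R)) by exact: measurable_itv.
have ip k : cintegrable leb `]-oo, t[ (psi k).
  have [i1 i2] := ipsi k.
  by split; [apply: integrableS i1|apply: integrableS i2].
have iF k : cintegrable leb `]-oo, t[ (fun r => phase A k t * fmode A k x * psi k r).
  exact: (cintegrableZ mt).
have iS : cintegrable leb `]-oo, t[
    (fun r => \sum_(k <- s) phase A k t * fmode A k x * psi k r).
  exact: (cintegrable_sum mt).
have -> : wave A s (past_integral^~ t) t x =
    cint leb `]-oo, t[ (fun r => \sum_(k <- s) phase A k t * fmode A k x * psi k r).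
  rewrite (cint_sum mt) //; apply: eq_bigr => k _.
  by rewrite (cintZ mt) // /past_integral -mulrA mulrC.
apply: (le_trans (normc_cint_le mt iS)).
under eq_integral => r _.
  rewrite (_ : \sum_(k <- s) _ = wave A s (psi^~ r) t x); last first.
    by apply: eq_bigr => k _; rewrite -[RHS]mulrA mulrC.
  over.
apply: ge0_subset_integral => //.
apply/measurable_EFinP; apply: measurable_normc; apply: cmeasurable_sum => k.
rewrite (_ : (fun r => _) = (fun r => psi k r * (phase A k t * fmode A k x))); last first.
  by apply/funext => r; rewrite mulrA.
by apply: cmeasurableM => //; exact: cmeasurable_cst.
by move=> r _; rewrite lee_fin normc_ge0.
Qed.

Let mw x : measurable_fun setT ((fun z => w z.1 z.2 x) : timeR R * timeR R -> R).
Proof.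
apply: measurable_normc; apply: cmeasurable_sum => k.
apply: cmeasurableM; last exact: cmeasurable_cst.
apply: cmeasurableM.
  exact: (@cmeasurable_comp _ _ _ (timeR R * timeR R)%type (timeR R) (psi k) fst).
apply: (@cmeasurable_comp _ _ _ (timeR R * timeR R)%type (timeR R) (phase A k) snd) => //.
exact: cmeasurable_phase.
Qed.

Let mY : measurable_fun setT ((fun z => Y z.1 z.2) : timeR R * planeR R -> R).
Proof.
apply: measurable_sqrt; apply: measurable_funM; first exact: measurable_cst.
suff [] : cmeasurable setT
    ((fun z => density A s (psi^~ z.1) z.2) : timeR R * planeR R -> R[i]) by [].
apply: cmeasurable_sum => k; apply: cmeasurable_sum => l.
have mp j : cmeasurable setT ((fun z => psi j z.1) : timeR R * planeR R -> R[i]).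
  exact: (@cmeasurable_comp _ _ _ (timeR R * planeR R)%type (timeR R) (psi j) fst).
apply: cmeasurableM.
  apply: cmeasurableM; first exact: cmeasurable_cst.
  by apply: cmeasurableM => //; exact: cmeasurableJ.
apply: (@cmeasurable_comp _ _ _ (timeR R * planeR R)%type (planeR R) (fmode A (k - l)) snd) => //.
exact: cmeasurable_fmode.
Qed.

(** Minkowski in the time variable: [Y r x] is the norm over one period of the
    free wave with data [psi^~ r] at the point [x]. *)
Let time_step x :
  (\int[leb]_(t in I) (sqmod (wave A s (past_integral^~ t) t x))%:E <=
   (\int[leb]_r (Y r x)%:E) ^+ 2)%E.
Proof.
pose f (z : timeR R * timeR R) := w z.1 z.2 x * \1_I z.2.
have f0 z : 0 <= f z by rewrite mulr_ge0 // normc_ge0.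
have mf : measurable_fun setT f.
  apply: measurable_funM; first exact: (mw x).
  apply: (@measurableT_comp _ _ _ _ _ _ (\1_I : timeR R -> R)); last exact: measurable_snd.
  by apply/measurable_indicP.
have := minkowski_L2 leb leb mf f0.
have -> : (\int[leb]_r (\int[leb]_t (f (r, t) ^+ 2)%:E) `^ 2^-1 =
    \int[leb]_r (Y r x)%:E)%E.
  apply: eq_integral => r _; rewrite /Y -powR12_sqrt // -poweR_EFin -integral_wave_time //.
  congr (_ `^ _)%E; rewrite [RHS]integral_mkcond; apply: eq_integral => t _.
  rewrite /f /= patchE indicE; case: (t \in I).
    by rewrite mulr1 /w -sqmodE.
  by rewrite mulr0 expr0n.
apply: le_trans; rewrite integral_mkcond.
apply: ge0_le_integral => //.
- by move=> t _; rewrite patchE; case: ifP => // _; rewrite lee_fin sqmod_ge0.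
- apply/(measurable_restrictT (fun t : timeR R =>
    (sqmod (wave A s (past_integral^~ t) t x))%:E)) => //.
  apply: measurable_funTS; apply/measurable_EFinP; apply: measurable_sqmod.
  apply: (@cmeasurable_comp _ _ _ (timeR R) (timeR R * planeR R)%type
    (fun z => wave A s (past_integral^~ z.1) z.1 z.2) (fun t => (t, x))) => //.
  exact: cmeasurable_duhamel.
- have mJ : measurable_fun setT (fun t => \int[leb]_r (f (r, t))%:E)%E.
    apply: (measurable_fun_fubini_tonelli_G (m1 := leb) (fun z => (f z)%:E)) => //.
    by apply/measurable_EFinP.
  by apply: emeasurable_funM.
- move=> t _; rewrite patchE /f /= indicE; case: (t \in I).
    rewrite sqmodE EFin_expe !expe2 lee_pmul ?lee_fin ?normc_ge0 //;
      under eq_integral do rewrite mulr1; exact: normc_wave_le.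
  have J0 : (0 <= \int[leb]_r (w r t x * 0)%:E)%E.
    by apply: integral_ge0 => r _; rewrite mulr0.
  exact: mule_ge0.
Qed.

Let mP : measurable_fun setT ((fun x =>
  \int[leb]_(t in I) (sqmod (wave A s (past_integral^~ t) t x))%:E)%E : planeR R -> \bar R).
Proof.
pose G := (fun z : timeR R * planeR R =>
  (sqmod (wave A s (past_integral^~ z.1) z.1 z.2))%:E) \_ (I `*` setT).
have -> : (fun x => \int[leb]_(t in I) (sqmod (wave A s (past_integral^~ t) t x))%:E)%E =
    (fun x : planeR R => \int[leb]_t G (t, x))%E.
  apply/funext => x; rewrite integral_mkcond; apply: eq_integral => t _.
  rewrite /G !patchE; congr (if _ then _ else _).
  apply/idP/idP => /set_mem tI; apply/mem_set; first by split.
  by case: tI.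
apply: (measurable_fun_fubini_tonelli_G (m1 := leb) G).
  apply/(measurable_restrictT (fun z : timeR R * planeR R =>
    (sqmod (wave A s (past_integral^~ z.1) z.1 z.2))%:E)).
    exact: measurableX.
  apply: measurable_funTS; apply/measurable_EFinP; apply: measurable_sqmod.
  exact: cmeasurable_duhamel.
by move=> z; rewrite /G patchE; case: ifP => // _; rewrite lee_fin sqmod_ge0.
Qed.

(** Minkowski once more in the space variable, for the kernel [Y r x * Y r' x]
    on pairs of times. *)
Lemma duhamel_estimate :
  (\int[leb2 R]_(x in Q)
     (\int[leb]_(t in I) (sqmod (wave A s (past_integral^~ t) t x))%:E) ^+ 2 <=
   (3 * tau ^+ 2 * m)%:E *
     (\int[leb]_r (Num.sqrt (\sum_(k <- s) sqmod (psi k r)))%:E) ^+ 4)%E.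
Proof.
set C := 3 * tau ^+ 2 * m.
have C0 : 0 <= C.
  by apply: mulr_ge0 => //; apply: mulr_ge0 => //; exact: sqr_ge0.
have Y0 r x : 0 <= Y r x by exact: sqrtr_ge0.
have mYx x : measurable_fun setT (Y^~ x : timeR R -> R).
  exact: (measurable_fun_pair1 (f := fun z => Y z.1 z.2) x mY).
have mYr r : measurable_fun setT (Y r : planeR R -> R).
  exact: (measurable_fun_pair2 (f := fun z => Y z.1 z.2) r mY).
pose J x := (\int[leb]_r (Y r x)%:E)%E.
have J0 x : (0 <= J x)%E by apply: integral_ge0 => r _; rewrite lee_fin.
have mJ : measurable_fun setT (J : planeR R -> \bar R).
  apply: (measurable_fun_fubini_tonelli_G (m1 := leb) (fun z => (Y z.1 z.2)%:E)).
    by apply/measurable_EFinP.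
  by move=> z; rewrite lee_fin.
pose f (z : (timeR R * timeR R) * planeR R) := Y z.1.1 z.2 * Y z.1.2 z.2 * \1_Q z.2.
have f0 z : 0 <= f z by rewrite !mulr_ge0.
have mf : measurable_fun setT f.
  apply: measurable_funM.
    apply: measurable_funM.
      apply: (@measurableT_comp _ _ _ _ _ _ (fun z : timeR R * planeR R => Y z.1 z.2) setT
        (fun z : (timeR R * timeR R) * planeR R => (z.1.1, z.2))) => //.
      apply: measurable_fun_pair => //; exact: measurableT_comp.
    apply: (@measurableT_comp _ _ _ _ _ _ (fun z : timeR R * planeR R => Y z.1 z.2) setT
      (fun z : (timeR R * timeR R) * planeR R => (z.1.2, z.2))) => //.
    apply: measurable_fun_pair => //; exact: measurableT_comp.
  apply: (@measurableT_comp _ _ _ _ _ _ (\1_Q : planeR R -> R)); last exact: measurable_snd.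
  by apply/measurable_indicP.
pose srho r := Num.sqrt (rho r).
have msrho : measurable_fun setT (srho : timeR R -> R).
  apply: measurable_sqrt; apply: measurable_sum => k.
  exact: measurable_sqmod.
pose K := (\int[leb]_r (srho r)%:E)%E.
have K0 : (0 <= K)%E by apply: integral_ge0 => r _; rewrite lee_fin sqrtr_ge0.
have Y4 r : (\int[leb2 R]_(x in Q) ((Y r x ^+ 2) ^+ 2)%:E <= (C * rho r ^+ 2)%:E)%E.
  apply: le_trans (homogeneous_estimate uA gamma (psi^~ r) us).
  rewrite le_eqVlt; apply/orP; left; apply/eqP; apply: eq_integral => x _.
  by rewrite /Y sqr_sqrtr.
clearbody C.
have inner r r' : (\int[leb2 R]_x (f ((r, r'), x) ^+ 2)%:E <= (C * rho r * rho r')%:E)%E.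
  pose h r x := Y r x ^+ 2 * \1_Q x.
  have h0 q x : 0 <= h q x by rewrite mulr_ge0 // sqr_ge0.
  have mh q : measurable_fun setT (h q : planeR R -> R).
    by apply: measurable_funM; [exact: measurable_funX|apply/measurable_indicP].
  have hE q : (\int[leb2 R]_x (h q x ^+ 2)%:E = \int[leb2 R]_(x in Q) ((Y q x ^+ 2) ^+ 2)%:E)%E.
    rewrite [RHS]integral_mkcond; apply: eq_integral => x _; rewrite patchE /h indicE.
    by case: (x \in Q); rewrite ?mulr1 // mulr0 expr0n.
  have hC q : ((\int[leb2 R]_x (h q x ^+ 2)%:E) `^ 2^-1 <= (Num.sqrt C * rho q)%:E)%E.
    have Cr0 : 0 <= C * rho q ^+ 2 by apply: mulr_ge0 => //; exact: sqr_ge0.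
    rewrite hE; have -> : (Num.sqrt C * rho q)%:E = ((C * rho q ^+ 2)%:E `^ 2^-1)%E.
      by rewrite poweR_EFin powR12_sqrt // sqrtrM // sqrtr_sqr ger0_norm.
    apply: le_poweR; [by rewrite invr_ge0| |exact: Y4].
    by apply: integral_ge0 => x _; rewrite lee_fin sqr_ge0.
  apply: (@le_trans _ _ (\int[leb2 R]_x (h r x * h r' x)%:E)%E).
    rewrite le_eqVlt; apply/orP; left; apply/eqP; apply: eq_integral => x _.
    rewrite /f /h /= indicE; case: (x \in Q); first by congr EFin; ring.
    by rewrite !mulr0 expr0n.
  apply: (le_trans (cauchy_schwarz_ereal (leb2 R) (mh r) (mh r') (h0 r) (h0 r'))).
  have -> : (C * rho r * rho r')%:E = ((Num.sqrt C * rho r)%:E * (Num.sqrt C * rho r')%:E)%E.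
    by rewrite -EFinM -[in LHS](sqr_sqrtr C0); congr EFin; ring.
  by apply: lee_pmul => //; exact: poweR_ge0.
have JJ x : (J x ^+ 2 = \int[leb2 R]_z (Y z.1 x * Y z.2 x)%:E)%E.
  rewrite integral_plane.
  - transitivity (\int[leb]_r ((Y r x)%:E * J x))%E.
      by rewrite ge0_integralZr //; first [exact/measurable_EFinP|by move=> ? _; rewrite lee_fin ?mulr_ge0|by rewrite lee_fin].
    by apply: eq_integral => r _ /=; rewrite -ge0_integralZl //;
      first [exact/measurable_EFinP|by move=> ? _; rewrite lee_fin ?mulr_ge0|by rewrite lee_fin].
  - apply/measurable_EFinP; apply: measurable_funM.
      exact: (@measurableT_comp _ _ _ _ _ _ (Y^~ x : timeR R -> R)).
    exact: (@measurableT_comp _ _ _ _ _ _ (Y^~ x : timeR R -> R)).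
  - by move=> z; rewrite lee_fin mulr_ge0.
apply: (@le_trans _ _ (\int[leb2 R]_x (\int[leb2 R]_z (f (z, x))%:E) ^+ 2)%E).
  rewrite integral_mkcond; apply: ge0_le_integral => //.
  - by move=> x _; rewrite patchE; case: ifP => // _; rewrite expe_ge0 // integral_ge0 // => t _;
      rewrite lee_fin sqmod_ge0.
  - have mP2 := emeasurable_funM mP mP.
    apply/(measurable_restrictT (fun x : planeR R =>
      (\int[leb]_(t in I) (sqmod (wave A s (past_integral^~ t) t x))%:E) ^+ 2)%E) => //.
    exact: measurable_funTS.
  - have mF : measurable_fun setT (fun x : planeR R => \int[leb2 R]_z (f (z, x))%:E)%E.
      have mfE : measurable_fun setT (fun z => (f z)%:E) by exact/measurable_EFinP.
      have fE0 z : (0 <= (f z)%:E)%E by rewrite lee_fin.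
      exact: (@measurable_fun_fubini_tonelli_G _ _ _ _ _ (plane_measure R) _ mfE fE0).
    exact: emeasurable_funM.
  - move=> x _; rewrite patchE; case: ifPn => xQ; last first.
      by apply: expe_ge0; apply: integral_ge0 => z _; rewrite lee_fin.
    have E : (\int[leb2 R]_z (f (z, x))%:E = J x ^+ 2)%E.
      rewrite JJ; apply: eq_integral => z _.
      by rewrite /f /= indicE xQ mulr1.
    rewrite E !expe2; apply: lee_pmul; rewrite -?expe2 ?time_step //;
      by apply: integral_ge0 => t _; rewrite lee_fin sqmod_ge0.
apply: (le_trans (minkowski_L2 (plane_measure R) (plane_measure R) mf f0)).
have msr : measurable_fun setT (fun z : timeR R * timeR R => srho z.1 * srho z.2).
  by apply: measurable_funM; exact: (measurableT_comp msrho).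
have srho0 r : 0 <= srho r by exact: sqrtr_ge0.
have KK : (\int[leb2 R]_z (Num.sqrt C * (srho z.1 * srho z.2))%:E =
    (Num.sqrt C)%:E * K ^+ 2)%E.
  under eq_integral do rewrite EFinM.
  rewrite ge0_integralZl_EFin ?sqrtr_ge0 //;
    try first [exact/measurable_EFinP|by move=> ? _; rewrite lee_fin ?mulr_ge0|by rewrite lee_fin].
  congr (_ * _)%E; rewrite integral_plane.
  - transitivity (\int[leb]_r ((srho r)%:E * K))%E.
      by apply: eq_integral => r _ /=; rewrite -ge0_integralZl //;
        first [exact/measurable_EFinP|by move=> ? _; rewrite lee_fin ?mulr_ge0|by rewrite lee_fin].
    by rewrite ge0_integralZr //; first [exact/measurable_EFinP|by move=> ? _; rewrite lee_fin ?mulr_ge0|by rewrite lee_fin].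
  - exact/measurable_EFinP.
  - by move=> z; rewrite lee_fin mulr_ge0.
apply: (@le_trans _ _ (((Num.sqrt C)%:E * K ^+ 2) ^+ 2)%E); last first.
  by rewrite -[in leRHS](sqr_sqrtr C0) EFin_expe !expeS !expe0 !mule1 muleACA !muleA.
rewrite -KK !expe2; apply: lee_pmul; try (by apply: integral_ge0 => z _; exact: poweR_ge0).
all: apply: ge0_le_integral => //.
all: try (by move=> z _; exact: poweR_ge0).
all: try (by apply/measurable_EFinP; apply: measurable_funM => //; exact: measurable_cst).
all: try (by apply: (@measurableT_comp _ _ _ _ _ _ (fun y : \bar R => (y `^ 2^-1)%E));
  [exact: measurable_poweR|
   apply: (measurable_fun_fubini_tonelli_F (m2 := (plane_measure R)) (fun z => (f z ^+ 2)%:E));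
   [by apply/measurable_EFinP; exact: measurable_funX|
    by move=> z; rewrite lee_fin sqr_ge0]]).
all: move=> [r r'] _.
all: have -> : (Num.sqrt C * (srho r * srho r'))%:E = ((C * rho r * rho r')%:E `^ 2^-1)%E
  by rewrite poweR_EFin powR12_sqrt ?mulr_ge0 // -mulrA !sqrtrM.
all: apply: le_poweR; [by rewrite invr_ge0| |exact: inner].
all: by apply: integral_ge0 => x _; rewrite lee_fin sqr_ge0.
Qed.

End DuhamelEstimate.

(** * Monotonicity and domination without measurability *)

Section LowerIntegral.
Context {R : realType} d (T : measurableType d).
Variable mu : {measure set T -> \bar R}.
Local Open Scope ereal_scope.

(** The integral of a nonnegative function is a supremum over the simple
    functions below it, hence monotone whether or not the functions are
    measurable. *)
Lemma le_integral_lower (D E : set T) (f g : T -> \bar R) : D `<=` E ->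
  (forall x, D x -> 0 <= f x) -> (forall x, E x -> 0 <= g x) ->
  (forall x, D x -> f x <= g x) ->
  \int[mu]_(x in D) f x <= \int[mu]_(x in E) g x.
Proof.
move=> DE f0 g0 fg; rewrite !ge0_integralE //.
apply: le_ereal_sup => _ [h hf <-]; exists h => // x.
apply: le_trans (hf x) _; rewrite !patchE.
case: ifPn => [/set_mem Dx|_]; last by case: ifPn => // /set_mem /g0.
by rewrite mem_set ?fg //; exact: DE.
Qed.

(** The factor [k] is moved to the measurable side, where the integral is
    homogeneous. *)
Lemma le_integral_lowerZ (D E : set T) (k : R) (f : T -> R) (g : T -> \bar R) :
  measurable D -> D `<=` E -> (0 < k)%R ->
  measurable_fun D f -> (forall x, D x -> 0 <= f x)%R ->
  (forall x, E x -> 0 <= g x) -> (forall x, D x -> (f x)%:E <= k%:E * g x) ->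
  \int[mu]_(x in D) (f x)%:E <= k%:E * \int[mu]_(x in E) g x.
Proof.
move=> mD DE k0 mf f0 g0 fg.
have -> : \int[mu]_(x in D) (f x)%:E = k%:E * \int[mu]_(x in D) (k^-1 * f x)%:E.
  under [in RHS]eq_integral do rewrite EFinM.
  rewrite ge0_integralZl_EFin ?invr_ge0 ?ltW //; last exact/measurable_EFinP.
  by rewrite muleA -EFinM mulfV ?gt_eqF // mul1e.
apply: lee_wpmul2l; first by rewrite lee_fin ltW.
apply: le_integral_lower => // x Dx.
  by rewrite lee_fin mulr_ge0 ?invr_ge0 ?f0 // ltW.
by rewrite EFinM muleC lee_pdivrMr // muleC fg.
Qed.

(** The supremum of the sequence is a measurable majorant below [h]. *)
Lemma dominated_lower_cvg0 (D E : set T) (f : nat -> T -> R) (h : T -> \bar R) :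
  measurable D -> D `<=` E -> (forall n, measurable_fun D (f n)) ->
  (forall n x, D x -> 0 <= f n x)%R ->
  (forall x, E x -> 0 <= h x) -> \int[mu]_(x in E) h x < +oo ->
  (forall n x, D x -> (f n x)%:E <= h x) ->
  (forall x, D x -> f ^~ x @ \oo --> (0 : R)%R) ->
  (fun n => \int[mu]_(x in D) (f n x)%:E) @ \oo --> 0.
Proof.
move=> mD DE mf f0 h0 ih fh cf.
pose g x := esups (fun n => (f n x)%:E) 0%N.
have fg n x : (f n x)%:E <= g x by apply: ereal_sup_ubound; exists n.
have g0 x : D x -> 0 <= g x by move=> Dx; apply: le_trans (fg 0%N x); rewrite lee_fin f0.
have gh x : D x -> g x <= h x.
  by move=> Dx; apply: ge_ereal_sup => _ [n _ <-]; exact: fh.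
have mfE n : measurable_fun D (fun x => (f n x)%:E) by exact/measurable_EFinP.
have ig : mu.-integrable D g.
  apply/integrableP; split.
    exact: (measurable_fun_esups (f := fun n x => (f n x)%:E)).
  apply: le_lt_trans ih; apply: le_integral_lower => // x Dx.
  by rewrite gee0_abs ?gh // g0.
have fc : {ae mu, forall x, D x -> (fun n => (f n x)%:E) @ \oo --> cst 0 x}.
  apply: aeW => x Dx; apply: cvg_EFin; first exact: nearW.
  exact: cf.
have fd : {ae mu, forall x n, D x -> `|(f n x)%:E| <= g x}.
  by apply: aeW => x n Dx; rewrite gee0_abs // lee_fin f0.
have [_ _] := dominated_convergence mD mfE (measurable_cst _) fc ig fd.
by rewrite integral0.
Qed.

End LowerIntegral.

(** * Truncation to finitely many modes *)

Definition box (N : nat) : seq (int * int) :=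
  [seq ((nat_of_ord i)%:Z - N%:Z, (nat_of_ord j)%:Z - N%:Z) |
    i <- index_enum 'I_(N.*2.+1), j <- index_enum 'I_(N.*2.+1)].

Lemma box_uniq N : uniq (box N).
Proof.
apply: allpairs_uniq; try exact: index_enum_uniq.
move=> [i j] [i' j'] _ _ /= [/addIr [ii'] /addIr [jj']].
by congr (_, _); exact/val_inj.
Qed.

Lemma mem_box N (k : int * int) : (absz k.1 <= N)%N -> (absz k.2 <= N)%N -> k \in box N.
Proof.
case: k => a b /= aN bN; apply/allpairsP.
have ai : (absz (a + N%:Z)%R < N.*2.+1)%N by lia.
have bi : (absz (b + N%:Z)%R < N.*2.+1)%N by lia.
exists (Ordinal ai, Ordinal bi); split; rewrite ?mem_index_enum //=.
by congr (_, _); lia.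
Qed.

Section SquareIntegrableOnTorus.
Context {R : realType}.
Variables (A : 'M[R]_2) (uA : A \in unitmx).
Local Notation leb := (@lebesgue_measure R).
Local Notation m := (`|\det A|).
Local Notation Q := (cell A).
Local Notation sqint := (sqint (leb2 R) Q).
Local Notation ip := (ip (leb2 R) Q).
Local Notation nsq := (nsq (leb2 R) Q).

Let mQ := measurable_cell uA.

Lemma in_L2_sqint f : in_L2 A f -> sqint f.
Proof.
move=> [_ m1 m2 nf]; apply: sqintP.
  by split; exact: measurable_funTS.
apply: lty_poweRy nf; by rewrite invr_neq0.
Qed.

Lemma norm2_sqint f : sqint f -> norm2 A f = (Num.sqrt (nsq f))%:E.
Proof.
move=> fL; rewrite /norm2 (nsqE mQ) // poweR_EFin powR12_sqrt //.
exact: nsq_ge0.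
Qed.

Lemma norm2_ge0 f : (0 <= norm2 A f)%E.
Proof. exact: poweR_ge0. Qed.

Lemma norm2_small (f : nat -> R * R -> R[i]) : (forall n, sqint (f n)) ->
  (fun n => norm2 A (f n)) @ \oo --> 0%E ->
  forall e : R, 0 < e -> \forall n \near \oo, Num.sqrt (nsq (f n)) < e.
Proof.
move=> fL cf e e0.
have /fine_cvgP[_ /cvgrPdist_lt /(_ e e0)] := cf.
apply: filterS => n /=; rewrite norm2_sqint //= sub0r normrN.
exact: le_lt_trans (ler_norm _).
Qed.

Lemma fcoefE f k : fcoef A f k = (m^-1)%:C * ip f (fmode A k).
Proof. by []. Qed.

Lemma fcoef_ip f k : ip f (fmode A k) = m%:C * fcoef A f k.
Proof.
rewrite fcoefE mulrA -rmorphM /= mulfV ?mul1r //.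
by rewrite gt_eqF // detA_gt0.
Qed.

Lemma flow_partialE t f N x :
  flow_partial A t f N x = wave A (box N) (fcoef A f) t x.
Proof.
rewrite /flow_partial /wave /box big_allpairs_dep; apply: eq_bigr => i _.
by apply: eq_bigr => j _ /=; rewrite [X in X * _ = _]mulrC.
Qed.

Definition trunc N f (x : R * R) : R[i] := \sum_(k <- box N) fcoef A f k * fmode A k x.

Lemma sqint_trunc N f : sqint (trunc N f).
Proof. by apply: (sqint_comb mQ) => k; exact: sqint_fmode. Qed.

Lemma sqint_wave s c t : sqint (wave A s c t).
Proof. by apply: (sqint_sum mQ) => k; apply: (sqintZ mQ); exact: sqint_fmode. Qed.

Lemma nsq_sub_trunc N f : sqint f ->
  nsq (fun x => f x - trunc N f x) = nsq f - m * \sum_(k <- box N) sqmod (fcoef A f k).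
Proof.
move=> fL; have m0 := detA_gt0 uA.
rewrite (nsq_sub_proj mQ m0 (sqint_fmode uA) (ip_fmode uA) (box_uniq N) fL).
congr (_ - _); rewrite !mulr_sumr; apply: eq_bigr => k _.
by rewrite fcoef_ip sqmodM sqmod_real; field; rewrite gt_eqF.
Qed.

Lemma bessel_trunc N f : sqint f -> m * \sum_(k <- box N) sqmod (fcoef A f k) <= nsq f.
Proof. by move=> fL; rewrite -subr_ge0 -nsq_sub_trunc // nsq_ge0. Qed.

Lemma nsq_sub_trunc_le N f : sqint f -> nsq (fun x => f x - trunc N f x) <= nsq f.
Proof.
move=> fL; rewrite nsq_sub_trunc // lerBlDr lerDl mulr_ge0 // sumr_ge0 // => k _.
exact: sqmod_ge0.
Qed.

Lemma le_eps (x K : R) : 0 <= K -> (forall e, 0 < e -> x <= K * e) -> x <= 0.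
Proof.
move=> K0 H; rewrite leNgt; apply/negP => x0.
have K1 : 0 < K + 1 by lra.
have := H (x / (K + 1) / 2) _; rewrite !divr_gt0 // => /(_ isT).
apply/negP; rewrite -ltNge.
have -> : K * (x / (K + 1) / 2) = x * (K / (K + 1) / 2) by field; rewrite gt_eqF.
rewrite gtr_pMr // ltr_pdivrMr // ltr_pdivrMr //; lra.
Qed.

(** The Fourier coefficients of the flow are read off the partial sums, by
    continuity of the inner product. *)
Lemma flow_fcoef t f g k : in_L2 A f -> is_flow A t f g ->
  fcoef A g k = phase A k t * fcoef A f k.
Proof.
move=> /in_L2_sqint fL [/in_L2_sqint gL cg].
have kN : \forall N \near \oo, k \in box N.
  exists (maxn (absz k.1) (absz k.2)) => // N /=; rewrite geq_max => /andP[? ?].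
  exact: mem_box.
have dL N : sqint (fun x => flow_partial A t f N x - g x).
  apply: (sqintB mQ) => //; apply: (eq_sqint mQ) (sqint_wave (box N) (fcoef A f) t) => x _.
  by rewrite flow_partialE.
have eL := sqint_fmode uA k.
have ipw N : k \in box N ->
    ip (flow_partial A t f N) (fmode A k) = m%:C * (phase A k t * fcoef A f k).
  move=> kb; rewrite -[RHS]mulrC.
  transitivity (ip (fun x => \sum_(l <- box N) (fcoef A f l * phase A l t) * fmode A l x) (fmode A k)).
    by apply: eq_ipl => x _; rewrite flow_partialE.
  rewrite (ip_comb mQ (sqint_fmode uA) (ip_fmode uA)) ?box_uniq // kb.
  by rewrite [_ * phase A k t]mulrC.
suff H : ip g (fmode A k) = m%:C * (phase A k t * fcoef A f k).
  by rewrite fcoefE H mulrA -rmorphM /= mulVf ?mul1r // gt_eqF // detA_gt0.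
apply/eqP; rewrite -subr_eq0 -oppr_eq0 opprB; apply/eqP/normc_eq0/eqP.
rewrite eq_le normc_ge0 andbT.
apply: (@le_eps _ (Num.sqrt (nsq (fmode A k)))) => [|e e0]; first exact: sqrtr_ge0.
near \oo => N.
have wL : sqint (flow_partial A t f N).
  apply: (eq_sqint mQ) (sqint_wave (box N) (fcoef A f) t) => x _.
  by rewrite flow_partialE.
rewrite -(ipw N); last by near: N; exact: kN.
rewrite -(ipBl mQ) //; apply: (le_trans (normc_ip_le mQ (dL N) eL)).
rewrite mulrC; apply: ler_wpM2l; first exact: sqrtr_ge0.
by apply/ltW; near: N; exact: norm2_small.
Unshelve. all: by end_near. Qed.

Lemma flow_trunc t f g N x : in_L2 A f -> is_flow A t f g ->
  trunc N g x = flow_partial A t f N x.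
Proof.
move=> fL fg; rewrite flow_partialE; apply: eq_bigr => k _.
by rewrite (flow_fcoef k fL fg) [phase _ _ _ * _]mulrC.
Qed.

Lemma nsqN f : nsq (fun x => - f x) = nsq f.
Proof. by apply: eq_Rintegral => x _; rewrite sqmodN. Qed.

Lemma flow_trunc_small t f g : in_L2 A f -> is_flow A t f g ->
  forall e : R, 0 < e -> \forall N \near \oo, Num.sqrt (nsq (fun x => g x - trunc N g x)) < e.
Proof.
move=> fL fg e e0; have [/in_L2_sqint gL cg] := fg.
have dL N : sqint (fun x => flow_partial A t f N x - g x).
  apply: (sqintB mQ) => //; apply: (eq_sqint mQ) (sqint_wave (box N) (fcoef A f) t) => x _.
  by rewrite flow_partialE.
apply: filterS (norm2_small dL cg e0) => N; apply: le_lt_trans.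
rewrite -nsqN; apply: ler_wsqrtr; rewrite le_eqVlt; apply/orP; left; apply/eqP.
by apply: eq_nsq => x _; rewrite opprB (flow_trunc N x fL fg).
Qed.

(** The coefficients of [g] and [f] have equal moduli, so Bessel for [f] bounds
    every truncation of [g]. *)
Lemma flow_nsq_le t f g : in_L2 A f -> is_flow A t f g -> nsq g <= nsq f.
Proof.
move=> fL fg; have [/in_L2_sqint gL _] := fg; have fL' := in_L2_sqint fL.
rewrite -subr_le0; apply: (@le_eps _ 1) => // e e0; rewrite mul1r.
have se : 0 < Num.sqrt e by rewrite sqrtr_gt0.
near \oo => N.
have H : nsq (fun x => g x - trunc N g x) < e.
  have : Num.sqrt (nsq (fun x => g x - trunc N g x)) < Num.sqrt e.
    by near: N; exact: (flow_trunc_small fL fg se).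
  by rewrite ltr_sqrt.
move: H; rewrite nsq_sub_trunc // => H.
have B := bessel_trunc N fL'.
have E : \sum_(k <- box N) sqmod (fcoef A g k) = \sum_(k <- box N) sqmod (fcoef A f k).
  by apply: eq_bigr => k _; rewrite (flow_fcoef k fL fg) sqmodM sqmod_phase mul1r.
by rewrite E in H; lra.
Unshelve. all: by end_near. Qed.

End SquareIntegrableOnTorus.

(** * Scalar integrals of a Bochner integral *)

Section ComplexLimits.
Context {R : realType} d (T : measurableType d).

Lemma cmeasurable_cvg (f_ : nat -> T -> R[i]) (f : T -> R[i]) :
  (forall n, cmeasurable setT (f_ n)) ->
  (forall x e, 0 < e -> \forall n \near \oo, normc (f_ n x - f x) < e) ->
  cmeasurable setT f.
Proof.
move=> mf cf; split.
  apply: (measurable_fun_cvg (h := fun n x => Re (f_ n x))) => [n|x _].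
    exact: (mf n).1.
  apply/cvgrPdist_lt => e e0; apply: filterS (cf x e e0) => n; apply: le_lt_trans.
  by rewrite distrC -cReN -cReD normRe.
apply: (measurable_fun_cvg (h := fun n x => Im (f_ n x))) => [n|x _].
  exact: (mf n).2.
apply/cvgrPdist_lt => e e0; apply: filterS (cf x e e0) => n; apply: le_lt_trans.
by rewrite distrC -cImN -cImD normIm.
Qed.

End ComplexLimits.

Section WeakBochner.
Context {R : realType}.
Variables (A : 'M[R]_2) (uA : A \in unitmx).
Local Notation leb := (@lebesgue_measure R).
Local Notation Q := (cell A).
Local Notation sqint := (sqint (leb2 R) Q).
Local Notation ip := (ip (leb2 R) Q).
Local Notation nsq := (nsq (leb2 R) Q).
Variables (I : set R) (mI : measurable (I : set (timeR R))).
Variables (G : R -> R * R -> R[i]) (GL2 : forall s, I s -> in_L2 A (G s)).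

Let mQ := measurable_cell uA.

Lemma sqint_val (S : step_fun A I) j : sqint (@sf_val _ _ _ S j).
Proof. by apply: in_L2_sqint; exact: sf_L2. Qed.

Lemma sqint_step_eval (S : step_fun A I) s : sqint (step_eval S s).
Proof. by apply: (sqint_sum mQ) => j; apply: (sqintZ mQ); exact: sqint_val. Qed.

Lemma sqint_step_integral (S : step_fun A I) : sqint (step_integral S).
Proof. by apply: (sqint_sum mQ) => j; apply: (sqintZ mQ); exact: sqint_val. Qed.

Lemma ip_step_eval (S : step_fun A I) s h : sqint h ->
  ip (step_eval S s) h =
  \sum_(j < sf_size S) (\1_(@sf_set _ _ _ S j) s)%:C * ip (@sf_val _ _ _ S j) h.
Proof.
move=> hL; rewrite (ip_suml mQ) //.
  by apply: eq_bigr => j _; rewrite (ipZl mQ) //; exact: sqint_val.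
by move=> j; apply: (sqintZ mQ); exact: sqint_val.
Qed.

Lemma ip_step_integral (S : step_fun A I) h : sqint h ->
  ip (step_integral S) h =
  \sum_(j < sf_size S) (fine (leb (@sf_set _ _ _ S j)))%:C * ip (@sf_val _ _ _ S j) h.
Proof.
move=> hL; rewrite (ip_suml mQ) //.
  by apply: eq_bigr => j _; rewrite (ipZl mQ) //; exact: sqint_val.
by move=> j; apply: (sqintZ mQ); exact: sqint_val.
Qed.

(** The function [s |-> ip (G s) h] is a limit of simple functions only off a
    null set; setting it to [0] there makes it measurable. *)
Definition pairing (J : set R) (h : R * R -> R[i]) (s : R) : R[i] :=
  (\1_J s)%:C * ip (G s) h.

Lemma pairing_in J h s : J s -> pairing J h s = ip (G s) h.
Proof. by move=> Js; rewrite /pairing indicE mem_set // mul1r. Qed.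

Lemma pairing_out J h s : ~ J s -> pairing J h s = 0.
Proof. by move=> Js; rewrite /pairing indicE memNset // mul0r. Qed.

Variable (S : nat -> step_fun A I).

(** [N] is a null set off which the step functions converge. *)
Definition cvg_off (N : set R) :=
  [/\ measurable (N : set (timeR R)), leb N = 0%E &
    forall s, (I `\` N) s ->
      (fun n => norm2 A (fun x => G s x - step_eval (S n) s x)) @ \oo --> 0%E].

Lemma ae_approx_cvg_off : ae_approx G S -> exists N, cvg_off N.
Proof.
move=> [N [mN N0 sub]]; exists N; split => // s [Is Ns].
apply: contrapT => H; apply: Ns; apply: sub => /= K; apply: H; exact: K.
Qed.

Let step_pairing N n h s : R[i] := (\1_(I `\` N) s)%:C * ip (step_eval (S n) s) h.

Let cmeasurable_step_pairing N n h : measurable (N : set (timeR R)) -> sqint h ->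
  cmeasurable setT (step_pairing N n h : timeR R -> R[i]).
Proof.
move=> mN hL; apply: cmeasurableM.
  by apply: cmeasurable_real; apply/measurable_indicP; exact: measurableD.
rewrite (_ : (fun s => _) = (fun s => \sum_(j < sf_size (S n))
  (\1_(@sf_set _ _ _ (S n) j) s)%:C * ip (@sf_val _ _ _ (S n) j) h)); last first.
  by apply/funext => s; rewrite ip_step_eval.
apply: cmeasurable_sum => j; apply: cmeasurableM; last exact: cmeasurable_cst.
by apply: cmeasurable_real; apply/measurable_indicP; exact: sf_measurable.
Qed.

Lemma cmeasurable_pairing N h : cvg_off N -> sqint h ->
  cmeasurable setT (pairing (I `\` N) h : timeR R -> R[i]).
Proof.
move=> [mN N0 cN] hL.
apply: (@cmeasurable_cvg R _ (timeR R) (fun n => step_pairing N n h)) => [n|s e e0].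
  exact: cmeasurable_step_pairing.
have [sJ|sJ] := pselect ((I `\` N) s); last first.
  apply: nearW => n; rewrite pairing_out // /step_pairing indicE memNset // mul0r.
  by rewrite subrr normc00.
have GL : sqint (G s) by apply: in_L2_sqint; apply: GL2; case: sJ.
have dL n : sqint (fun x => G s x - step_eval (S n) s x).
  by apply: (sqintB mQ) => //; exact: sqint_step_eval.
have K0 : 0 < Num.sqrt (nsq h) + 1 by rewrite ltr_wpDl // sqrtr_ge0.
apply: filterS (norm2_small uA dL (cN s sJ) (divr_gt0 e0 K0)) => n H.
rewrite pairing_in // /step_pairing indicE mem_set // mul1r.
rewrite -normc_opp opprB -(ipBl mQ) //; last exact: sqint_step_eval.
apply: (le_lt_trans (normc_ip_le mQ (dL n) hL)).
move: H; rewrite ltr_pdivlMr // => H; apply: le_lt_trans H.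
by apply: ler_wpM2l; rewrite ?sqrtr_ge0 // lerDl.
Qed.

(** A strongly convergent sequence of step functions converges weakly, so the
    Bochner integral is determined by scalar integrals. *)
Lemma pettis (v : R * R -> R[i]) (N : set R) h : (leb I < +oo)%E -> cvg_off N ->
  in_L2 A v -> sqint h ->
  (fun n => normL1L2 A I (fun s x => G s x - step_eval (S n) s x)) @ \oo --> 0%E ->
  (fun n => norm2 A (fun x => step_integral (S n) x - v x)) @ \oo --> 0%E ->
  cintegrable leb I (pairing (I `\` N) h) /\ cint leb I (pairing (I `\` N) h) = ip v h.
Proof.
move=> Ifin cN /in_L2_sqint vL hL cG cv; have [mN N0 _] := cN.
have mJ : measurable ((I `\` N) : set (timeR R)) by exact: measurableD.
pose K := Num.sqrt (nsq h) + 1.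
have K0 : 0 < K by rewrite ltr_wpDl // sqrtr_ge0.
pose g := pairing (I `\` N) h.
have mg : cmeasurable setT (g : timeR R -> R[i]) by exact: cmeasurable_pairing.
have mE n j : measurable (@sf_set _ _ _ (S n) j : set (timeR R)) by exact: sf_measurable.
have lE n j : leb (@sf_set _ _ _ (S n) j `&` (I `\` N)) = leb (@sf_set _ _ _ (S n) j).
  rewrite setIDA (setIidl (@sf_sub _ _ _ (S n) j)).
  rewrite [RHS](measureDI leb (mE n j) mN).
  rewrite [X in _ = (_ + X)%E](_ : _ = 0%E) ?adde0 //.
  by apply: (subset_measure0 _ mN _ N0) => //; exact: measurableI.
have indI (B : set R) : measurable (B : set (timeR R)) -> cintegrable leb I (fun s => (\1_B s)%:C).
  move=> mB; split; last by under eq_fun do rewrite /=; exact: integrable0.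
  apply: (@integrable_bounded R _ _ leb I (\1_B) 1) => // s.
  by rewrite indicE; case: (s \in B); rewrite ?normr1 ?normr0.
have indE (B : set R) : measurable (B : set (timeR R)) -> B `<=` I ->
    cint leb I (fun s => (\1_B s)%:C) = (fine (leb B))%:C.
  move=> mB BI; apply: complex_eqP => /=; last by rewrite Rintegral_cst // mul0r.
  by rewrite /Rintegral integral_indic // setIidl.
have stepE n s : step_pairing N n h s = \sum_(j < sf_size (S n))
    ip (@sf_val _ _ _ (S n) j) h * (\1_(@sf_set _ _ _ (S n) j `&` (I `\` N)) s)%:C.
  rewrite /step_pairing ip_step_eval // mulr_sumr; apply: eq_bigr => j _.
  by rewrite indicI /= rmorphM mulrA [RHS]mulrC [X in X * _]mulrC.
have mEJ n j : measurable ((@sf_set _ _ _ (S n) j `&` (I `\` N)) : set (timeR R)).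
  exact: measurableI.
have istep n : cintegrable leb I (step_pairing N n h).
  apply: (eq_cintegrable mI (f := fun s => \sum_(j < sf_size (S n))
    ip (@sf_val _ _ _ (S n) j) h * (\1_(@sf_set _ _ _ (S n) j `&` (I `\` N)) s)%:C)).
    by move=> s _; rewrite stepE.
  by apply: (cintegrable_sum mI) => j; apply: (cintegrableZ mI); exact: indI.
have cstep n : cint leb I (step_pairing N n h) = ip (step_integral (S n)) h.
  rewrite ip_step_integral //; transitivity (cint leb I (fun s => \sum_(j < sf_size (S n))
    ip (@sf_val _ _ _ (S n) j) h * (\1_(@sf_set _ _ _ (S n) j `&` (I `\` N)) s)%:C)).
    by apply: eq_cint => s _; rewrite stepE.
  rewrite (cint_sum mI); last by move=> j; apply: (cintegrableZ mI); exact: indI.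
  apply: eq_bigr => j _; rewrite (cintZ mI); last exact: indI.
  rewrite mulrC indE //; last by move=> s [_ []].
  by congr ((fine _)%:C * _); rewrite lE.
have dL n s : I s -> sqint (fun x => G s x - step_eval (S n) s x).
  move=> Is; apply: (sqintB mQ); last exact: sqint_step_eval.
  by apply: in_L2_sqint; exact: GL2.
pose err n := normL1L2 A I (fun s x => G s x - step_eval (S n) s x).
have diff_le n : (\int[leb]_(s in I) (normc (g s - step_pairing N n h s)%R)%:E <=
    K%:E * err n)%E.
  apply: le_integral_lowerZ => //.
  - apply: measurable_normc; apply: cmeasurableB.
      exact: cmeasurableS mg.
    by apply: (@cmeasurableS _ _ _ _ setT) => //; exact: cmeasurable_step_pairing.
  - by move=> s _; exact: normc_ge0.
  - by move=> s _; exact: norm2_ge0.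
  move=> s Is; rewrite norm2_sqint //; last exact: dL.
  rewrite -EFinM lee_fin /step_pairing /g.
  have [sJ|sJ] := pselect ((I `\` N) s); last first.
    rewrite pairing_out // indicE memNset // mul0r subrr normc00.
    by rewrite mulr_ge0 ?sqrtr_ge0 // ltW.
  rewrite pairing_in // indicE mem_set // mul1r.
  have GsL : sqint (G s) by apply: in_L2_sqint; exact: GL2.
  rewrite -(ipBl mQ) //; last exact: sqint_step_eval.
  apply: (le_trans (normc_ip_le mQ (dL n s Is) hL)); rewrite mulrC.
  by apply: ler_wpM2r; rewrite ?sqrtr_ge0 // lerDl.
have small e : 0 < e -> \forall n \near \oo,
    (err n < e%:E)%E.
  move=> e0; have /fine_cvgP[cf /cvgrPdist_lt /(_ e e0)] := cG.
  move=> H; near=> n; have fn : (err n) \is a fin_num.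
    by near: n.
  rewrite -(fineK fn) lte_fin; apply: le_lt_trans (ler_norm _) _.
  by rewrite -normrN -sub0r; near: n.
have idiff n : (err n < +oo)%E ->
    cintegrable leb I (fun s => g s - step_pairing N n h s).
  move=> fn; have md : cmeasurable I (fun s : timeR R => g s - step_pairing N n h s).
    by apply: cmeasurableB; apply: (@cmeasurableS _ _ _ _ setT) => //;
      exact: cmeasurable_step_pairing.
  apply: (cintegrableP mI md (h := fun s => normc (g s - step_pairing N n h s))) => //.
  apply/integrableP; split; first by apply/measurable_EFinP; exact: measurable_normc.
  under eq_integral do rewrite gee0_abs ?lee_fin ?normc_ge0 //.
  apply: (le_lt_trans (diff_le n)).
  by rewrite lte_mul_pinfty // ?lee_fin ?ltW // ltNge.
have ig : cintegrable leb I g.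
  near \oo => n.
  apply: (eq_cintegrable mI (f := fun s => (g s - step_pairing N n h s) + step_pairing N n h s)).
    by move=> s _; rewrite subrK.
  apply: (cintegrableD mI) => //; apply: idiff.
  by apply: (@lt_trans _ _ 1%:E); [near: n; exact: small|rewrite ltry].
have wL k : sqint (fun x => step_integral (S k) x - v x).
  by apply: (sqintB mQ) => //; exact: sqint_step_integral.
split => //; apply/eqP; rewrite -subr_eq0; apply/eqP/normc_eq0/eqP.
rewrite eq_le normc_ge0 andbT.
apply: (@le_eps _ _ (K + K)) => [|e e0]; first by rewrite addr_ge0 // ltW.
near \oo => n.
have n1 : (err n < e%:E)%E.
  by near: n; exact: small.
have n2 : Num.sqrt (nsq (fun x => step_integral (S n) x - v x)) < e.
  by near: n; exact: (norm2_small uA wL cv e0).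
have -> : cint leb I g - ip v h = cint leb I (fun s => g s - step_pairing N n h s) +
    ip (fun x => step_integral (S n) x - v x) h.
  rewrite (cintB mI) // cstep (ipBl mQ) //; last exact: sqint_step_integral.
  by rewrite addrA subrK.
apply: (le_trans (normc_add _ _)); rewrite mulrDl; apply: lerD.
  rewrite -lee_fin; apply: le_trans (normc_cint_le mI (idiff n _)) _.
    by apply: lt_trans n1 _; rewrite ltry.
  apply: (le_trans (diff_le n)); rewrite EFinM; apply: lee_wpmul2l.
    by rewrite lee_fin ltW.
  exact: ltW.
apply: (le_trans (normc_ip_le mQ (wL n) hL)); rewrite mulrC.
apply: ler_pM; rewrite ?sqrtr_ge0 //; first by rewrite lerDl.
exact: ltW.
Unshelve. all: by end_near. Qed.

End WeakBochner.

(** * The Duhamel integral at a fixed time *)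

Section FixedTime.
Context {R : realType}.
Variables (A : 'M[R]_2) (uA : A \in unitmx) (tau : R).
Local Notation leb := (@lebesgue_measure R).
Local Notation m := (`|\det A|).
Local Notation Q := (cell A).
Local Notation sqint := (sqint (leb2 R) Q).
Local Notation ip := (ip (leb2 R) Q).
Local Notation nsq := (nsq (leb2 R) Q).
Local Notation I := `]0, tau[%classic.
Local Notation It t := `]0, t[%classic.
Variables (u0 : R * R -> R[i]) (F : R -> R * R -> R[i]).
Hypotheses (u0L2 : in_L2 A u0) (FL : in_L1L2 A I F).

Let mQ := measurable_cell uA.
Let mI : measurable (I : set (timeR R)).
Proof. exact: measurable_itv. Qed.

Lemma cint_ae_eq (D N : set R) (f g : R -> R[i]) :
  measurable (D : set (timeR R)) -> measurable (N : set (timeR R)) -> leb N = 0%E ->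
  cmeasurable D (f : timeR R -> R[i]) -> cmeasurable D (g : timeR R -> R[i]) ->
  (forall s, D s -> ~ N s -> f s = g s) -> cint leb D f = cint leb D g.
Proof.
move=> mD mN N0 [f1 f2] [g1 g2] fg.
have ae (p : R[i] -> R) : {ae leb, forall s, D s -> (p (f s))%:E = (p (g s))%:E}.
  exists N; split => // s /= H; apply: contrapT => Ns; apply: H => Ds.
  by rewrite fg.
rewrite /cint; congr (_ +i* _); rewrite /Rintegral; congr fine.
  by apply: ae_eq_integral => //; [exact/measurable_EFinP|exact/measurable_EFinP|exact: ae].
by apply: ae_eq_integral => //; [exact/measurable_EFinP|exact/measurable_EFinP|exact: ae].
Qed.

Let FL2 s : I s -> in_L2 A (F s).
Proof. by have [H _ _] := FL; exact: H. Qed.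

Definition massF : R := fine (normL1L2 A I F).

Lemma massFE : normL1L2 A I F = massF%:E.
Proof.
have [_ _ Ffin] := FL; rewrite /massF fineK // ge0_fin_numE //.
by apply: integral_ge0 => s _; exact: norm2_ge0.
Qed.

Lemma massF_ge0 : 0 <= massF.
Proof. by rewrite -lee_fin -massFE; apply: integral_ge0 => s _; exact: norm2_ge0. Qed.

Section Duhamel.
Variables (t : R) (t0 : 0 < t) (ttau : t < tau).
Variables (G : R -> R * R -> R[i]) (v : R * R -> R[i]).
Hypothesis FG : forall s, 0 < s < t -> is_flow A (t - s) (F s) (G s).
Hypothesis Gv : is_bochner_integral A (It t) G v.

Let mIt : measurable (It t : set (timeR R)).
Proof. exact: measurable_itv. Qed.

Let ItI : It t `<=` I.
Proof. by move=> s /=; rewrite !in_itv /= => /andP[-> st]; exact: lt_trans ttau. Qed.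

Let It_lty : (leb (It t) < +oo)%E.
Proof. by rewrite lebesgue_measure_itv /= lte_fin t0 oppr0 adde0 ltry. Qed.

Let flowG s : It t s -> is_flow A (t - s) (F s) (G s).
Proof. by move=> /=; rewrite in_itv /=; exact: FG. Qed.

Let GL2 s : It t s -> in_L2 A (G s).
Proof. by move=> st; have [] := flowG st. Qed.

Let vL2 : in_L2 A v.
Proof. by have [] := Gv. Qed.

Let vL := in_L2_sqint vL2.

Let sqnG s : It t s -> ((Num.sqrt (nsq (G s)))%:E <= norm2 A (F s))%E.
Proof.
move=> st; have FsL2 := FL2 (ItI st).
rewrite (norm2_sqint uA (in_L2_sqint FsL2)) lee_fin ler_wsqrtr //.
exact: (flow_nsq_le uA FsL2 (flowG st)).
Qed.

Let pettisG : exists N, [/\ measurable (N : set (timeR R)), leb N = 0%E &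
  forall h, sqint h ->
  [/\ cmeasurable setT (pairing A G (It t `\` N) h : timeR R -> R[i]),
      cintegrable leb (It t) (pairing A G (It t `\` N) h) &
      cint leb (It t) (pairing A G (It t `\` N) h) = ip v h]].
Proof.
have [_ _ [S [aS cS cv]]] := Gv.
have [N cN] := ae_approx_cvg_off aS; have [mN N0 _] := cN.
exists N; split => // h hL.
have [i1 i2] := pettis uA mIt GL2 It_lty cN vL2 hL cS cv.
by split => //; exact: (cmeasurable_pairing uA mIt GL2 cN).
Qed.

Let pairing_bound N h s : sqint h -> It t s ->
  ((normc (pairing A G (It t `\` N) h s))%:E <=
   (Num.sqrt (nsq h) + 1)%:E * norm2 A (F s))%E.
Proof.
move=> hL st; have [sJ|sJ] := pselect ((It t `\` N) s); last first.
  rewrite pairing_out // normc00; apply: mule_ge0; last exact: norm2_ge0.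
  by rewrite lee_fin addr_ge0 // sqrtr_ge0.
rewrite pairing_in //; apply: (@le_trans _ _
  ((Num.sqrt (nsq h) + 1)%:E * (Num.sqrt (nsq (G s)))%:E)%E).
  rewrite -EFinM lee_fin; apply: (le_trans (normc_ip_le mQ (in_L2_sqint (GL2 st)) hL)).
  by rewrite mulrC; apply: ler_wpM2r; rewrite ?sqrtr_ge0 // lerDl.
apply: lee_wpmul2l; last exact: sqnG.
by rewrite lee_fin addr_ge0 // sqrtr_ge0.
Qed.

(** Testing [v] against itself gives [x ^+ 2 <= (x + 1) * massF] for the norm [x]
    of [v].  The summand [1] keeps the factor in front of the lower integral
    positive; the resulting bound only has to be uniform in time. *)
Lemma nsq_duhamel_le : nsq v <= (massF + 1) ^+ 2.
Proof.
have [N [mN N0 /(_ v vL) [mg ig cg]]] := pettisG.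
pose x := Num.sqrt (nsq v).
have x0 : 0 <= x by exact: sqrtr_ge0.
have xE : nsq v = x ^+ 2 by rewrite /x sqr_sqrtr // nsq_ge0.
have H : x ^+ 2 <= (x + 1) * massF.
  rewrite -xE -lee_fin; have -> : nsq v = Re (cint leb (It t) (pairing A G (It t `\` N) v)).
    by rewrite cg (ip_nsq mQ).
  apply: (@le_trans _ _ (normc (cint leb (It t) (pairing A G (It t `\` N) v)))%:E).
    by rewrite lee_fin le_Re_normc.
  apply: (le_trans (normc_cint_le mIt ig)).
  rewrite EFinM -massFE; apply: le_integral_lowerZ => //.
  - by rewrite ltr_wpDl.
  - apply: measurable_normc; exact: cmeasurableS mg.
  - by move=> s _; exact: normc_ge0.
  - by move=> s _; exact: norm2_ge0.
  - by move=> s st; exact: pairing_bound.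
rewrite xE; have B0 := massF_ge0.
have xB : x <= massF + 1.
  rewrite leNgt; apply/negP => xB; have := H; apply/negP; rewrite -ltNge.
  have : 0 < (x - massF) * (x - massF - 1) + (x - massF - 1) * massF + x - massF * 1.
    have h1 : 0 < x - massF - 1 by lra.
    have h2 : 0 < x - massF by lra.
    have := mulr_gt0 h2 h1; have := mulr_ge0 (ltW h1) B0; lra.
  lra.
by rewrite ler_sqr ?nnegrE // addr_ge0.
Qed.

(** The Duhamel integral stays in the closed span of the modes: testing it
    against its own remainder [h] after truncation reduces, through the scalar
    integrals, to the remainders of the integrand. *)
Lemma duhamel_trunc_small e : 0 < e ->
  \forall N \near \oo, nsq (fun x => v x - trunc A N v x) < e.
Proof.
move=> e0; have [Z [mZ Z0 HZ]] := pettisG.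
pose h n x := v x - trunc A n v x.
have hL n : sqint (h n) by apply: (sqintB mQ) => //; exact: sqint_trunc.
have hv n : nsq (h n) <= nsq v by exact: nsq_sub_trunc_le.
pose K := Num.sqrt (nsq v) + 1.
have K0 : 0 < K by rewrite ltr_wpDl // sqrtr_ge0.
have hK n : Num.sqrt (nsq (h n)) + 1 <= K by rewrite lerD2r ler_wsqrtr.
pose f n s := K^-1 * normc (pairing A G (It t `\` Z) (h n) s).
have horth n k : k \in box n -> ip (h n) (fmode A k) = 0.
  move=> kn; rewrite (ipBl mQ) //; [|exact: sqint_trunc|exact: sqint_fmode].
  rewrite (ip_comb mQ (sqint_fmode uA) (ip_fmode uA)) ?box_uniq // kn.
  by rewrite fcoef_ip // mulrC subrr.
have ip_trunc n g : ip (trunc A n g) (h n) = 0.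
  rewrite (ipC mQ) //; last exact: sqint_trunc.
  rewrite (ip_sumr mQ) //; last exact: sqint_fmode.
  rewrite big_seq big1 ?rmorph0 // => k kn.
  by rewrite horth // mulr0.
have cf : (fun n => \int[leb]_(s in It t) (f n s)%:E)%E @ \oo --> 0%E.
  apply: (@dominated_lower_cvg0 _ _ _ leb (It t) I f (fun s => norm2 A (F s))) => //.
  - move=> n; apply: measurable_funM; first exact: measurable_cst.
    by apply: measurable_normc; have [mg _ _] := HZ _ (hL n); exact: cmeasurableS mg.
  - by move=> n s _; rewrite mulr_ge0 ?normc_ge0 // invr_ge0 ltW.
  - by move=> s _; exact: norm2_ge0.
  - by have [_ _] := FL.
  - move=> n s st; rewrite /f EFinM.
    apply: (@le_trans _ _ ((K^-1)%:E * (K%:E * norm2 A (F s)))%E).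
      apply: lee_wpmul2l; first by rewrite lee_fin invr_ge0 ltW.
      apply: (le_trans (pairing_bound Z (hL n) st)).
      by apply: lee_wpmul2r; [exact: norm2_ge0|rewrite lee_fin].
    by rewrite muleA -EFinM mulVf ?mul1e // gt_eqF.
  - move=> s st; have [sJ|sJ] := pselect ((It t `\` Z) s); last first.
      rewrite (_ : f ^~ s = fun=> 0); first exact: cvg_cst.
      by apply/funext => n; rewrite /f pairing_out // normc00 mulr0.
    apply/cvgrPdist_lt => d d0.
    have FsL2 := FL2 (ItI st).
    apply: filterS (flow_trunc_small uA FsL2 (flowG st) d0) => n H.
    have GsL := in_L2_sqint (GL2 st).
    rewrite sub0r normrN ger0_norm; last by rewrite mulr_ge0 ?normc_ge0 // invr_ge0 ltW.
    rewrite /f pairing_in //; apply: le_lt_trans H.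
    have dL : sqint (fun x => G s x - trunc A n (G s) x).
      by apply: (sqintB mQ) => //; exact: sqint_trunc.
    have -> : ip (G s) (h n) = ip (fun x => G s x - trunc A n (G s) x) (h n).
      by rewrite (ipBl mQ) // ?ip_trunc ?subr0 //; exact: sqint_trunc.
    rewrite ler_pdivrMl //; apply: (le_trans (normc_ip_le mQ dL (hL n))).
    rewrite mulrC; apply: ler_wpM2r; first exact: sqrtr_ge0.
    by apply: le_trans (hK n); rewrite lerDl.
have eK : 0 < e / K by exact: divr_gt0.
have /fine_cvgP[fcf /cvgrPdist_lt /(_ _ eK) cf'] := cf.
near=> n.
have fn : (\int[leb]_(s in It t) (f n s)%:E)%E \is a fin_num by near: n.
have lt1 : (\int[leb]_(s in It t) (f n s)%:E < (e / K)%:E)%E.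
  rewrite -(fineK fn) lte_fin; apply: le_lt_trans (ler_norm _) _.
  by rewrite -normrN -sub0r; near: n.
have [mg ig cg] := HZ _ (hL n).
have E : nsq (h n) = Re (cint leb (It t) (pairing A G (It t `\` Z) (h n))).
  have -> : nsq (h n) = Re (ip (h n) (h n)) by rewrite (ip_nsq mQ).
  by rewrite cg {1}/h (ipBl mQ) // ?ip_trunc ?subr0 //; exact: sqint_trunc.
rewrite -/(h n) -lte_fin E.
apply: (@le_lt_trans _ _ (normc (cint leb (It t) (pairing A G (It t `\` Z) (h n))))%:E).
  by rewrite lee_fin le_Re_normc.
apply: (le_lt_trans (normc_cint_le mIt ig)).
have -> : (\int[leb]_(s in It t) (normc (pairing A G (It t `\` Z) (h n) s))%:E =
   K%:E * \int[leb]_(s in It t) (f n s)%:E)%E.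
  rewrite -ge0_integralZl_EFin ?ltW //.
  - by apply: eq_integral => s _; rewrite -EFinM /f mulrA mulfV ?mul1r // gt_eqF.
  - by move=> s _; rewrite lee_fin mulr_ge0 ?normc_ge0 // invr_ge0 ltW.
  - apply/measurable_EFinP; apply: measurable_funM; first exact: measurable_cst.
    by apply: measurable_normc; exact: cmeasurableS mg.
have -> : e%:E = (K%:E * (e / K)%:E)%E by rewrite -EFinM mulrC divfK // gt_eqF.
by rewrite lte_pmul2l // lte_fin.
Unshelve. all: by end_near. Qed.

(** The coefficient of [G s] is that of [F s] turned by the phase at time
    [t - s], and the phase splits into a factor in [t] and a factor in [s]. *)
Lemma fcoef_duhamel (NF : set R) (S : nat -> step_fun A I) k :
  cvg_off F S NF ->
  fcoef A v k = phase A k t *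
    cint leb (It t) (fun s => (phase A k s)^* *
       ((m^-1)%:C * pairing A F (I `\` NF) (fmode A k) s)).
Proof.
move=> cNF; have [mNF NF0 _] := cNF; have eL := sqint_fmode uA k.
have [Z [mZ Z0 /(_ _ eL) [mg ig cg]]] := pettisG.
have mpF := cmeasurable_pairing uA mI FL2 cNF eL.
have mph : cmeasurable setT ((fun s => (phase A k s)^*) : timeR R -> R[i]).
  by apply: cmeasurableJ; exact: cmeasurable_phase.
have mr : cmeasurable setT ((fun s => (phase A k s)^* *
       ((m^-1)%:C * pairing A F (I `\` NF) (fmode A k) s)) : timeR R -> R[i]).
  by apply: cmeasurableM => //; apply: cmeasurableM => //; exact: cmeasurable_cst.
have ZN0 : leb (Z `|` NF) = 0%E by exact: null_set_setU.
have m0 : m != 0 by rewrite gt_eqF // detA_gt0.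
have key s : It t s -> ~ (Z `|` NF) s ->
    (m^-1)%:C * pairing A G (It t `\` Z) (fmode A k) s =
    phase A k t * ((phase A k s)^* * ((m^-1)%:C * pairing A F (I `\` NF) (fmode A k) s)).
  move=> st sN; rewrite !pairing_in; last 2 first.
  - by split; [exact: ItI|move=> ?; apply: sN; right].
  - by split => // ?; apply: sN; left.
  rewrite -!fcoefE (flow_fcoef uA k (FL2 (ItI st)) (flowG st)) [RHS]mulrA; congr (_ * _).
  by rewrite /phase -expiN -expiD; congr expi; ring.
have igm : cintegrable leb (It t) (fun s => (m^-1)%:C * pairing A G (It t `\` Z) (fmode A k) s).
  exact: (cintegrableZ mIt).
rewrite fcoefE -cg -(cintZ mIt) //.
have mrI : cmeasurable (It t) ((fun s => (phase A k s)^* *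
       ((m^-1)%:C * pairing A F (I `\` NF) (fmode A k) s)) : timeR R -> R[i]).
  exact: cmeasurableS mr.
have E : cint leb (It t) (fun s => (phase A k s)^* *
       ((m^-1)%:C * pairing A F (I `\` NF) (fmode A k) s)) =
    cint leb (It t) (fun s => (phase A k t)^* *
       ((m^-1)%:C * pairing A G (It t `\` Z) (fmode A k) s)).
  apply: (cint_ae_eq mIt (measurableU _ _ mZ mNF) ZN0) => //.
    apply: cmeasurableM; first exact: cmeasurable_cst.
    exact: (cintegrable_measurable igm).
  move=> s st sN; rewrite key // [RHS]mulrA.
  by rewrite [X in _ = X * _]mulrC mulJ_sqmod sqmod_phase mul1r.
have E2 := cintZ mIt ((phase A k t)^*) igm.
by rewrite E E2 mulrA mulJ_sqmod sqmod_phase mul1r.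
Qed.

End Duhamel.

End FixedTime.

(** * Lower semicontinuity of the mixed norm *)

Section MixedNormLimit.
Context {R : realType}.
Local Open Scope ereal_scope.

(** Young's inequality: the slack is a sum of squares divided by [e]. *)
Lemma sqmod_split (e : R) (a b : R[i]) : (0 < e)%R ->
  (sqmod a <= (1 + e) * sqmod b + (1 + e^-1) * sqmod (a - b)%R)%R.
Proof.
move=> e0; rewrite -subr_ge0.
have -> : ((1 + e) * sqmod b + (1 + e^-1) * sqmod (a - b)%R - sqmod a)%R =
  ((e * Re b - (Re a - Re b)) ^+ 2 / e + (e * Im b - (Im a - Im b)) ^+ 2 / e)%R.
  by rewrite /sqmod !cReD !cImD !cReN !cImN; field; rewrite gt_eqF.
by rewrite addr_ge0 // divr_ge0 ?sqr_ge0 // ltW.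
Qed.

(** Multiplying the hypothesis by [a] and using [a <= M] in the last term keeps
    [d] to the first power; the term [a * p] is split evenly. *)
Lemma square_split (a M e c : R) (p d : \bar R) :
  (0 <= a)%R -> (a <= M)%R -> (0 < e)%R -> (0 < c)%R -> 0 <= p -> 0 <= d ->
  a%:E <= (1 + e)%:E * p + c%:E * d ->
  (a ^+ 2)%:E <= ((1 + e) / 2)%:E * ((a ^+ 2)%:E + p ^+ 2) + (c * M)%:E * d.
Proof.
move=> a0 aM e0 c0; have M0 := le_trans a0 aM.
have e1 : (0 < (1 + e) / 2)%R by rewrite divr_gt0 // addr_gt0.
case: p => [p| |] //; case: d => [d| |] //; rewrite ?lee_fin => p0 d0.
- move=> H; have {}H : (a <= (1 + e) * p + c * d)%R by rewrite -lee_fin.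
  suff : (a ^+ 2 <= (1 + e) / 2 * (a ^+ 2 + p ^+ 2) + c * M * d)%R.
    by rewrite -lee_fin.
  have h1 : (a * a <= a * ((1 + e) * p + c * d))%R by apply: ler_wpM2l.
  have h2 : (a * (c * d) <= M * (c * d))%R.
    by apply: ler_wpM2r => //; rewrite mulr_ge0 // ltW.
  have h3 : (0 <= (1 + e) / 2 * (a - p) ^+ 2)%R by rewrite mulr_ge0 ?sqr_ge0 // ltW.
  by move: h1 h2 h3; rewrite !expr2; lra.
- move=> _; have [M00|Mp] := eqVneq M 0%R.
    have -> : a = 0%R by apply/eqP; rewrite eq_le a0 -M00 aM.
    apply: (@le_trans _ _ 0); first by rewrite lee_fin expr0n.
    rewrite M00 mulr0 mul0e adde0; apply: mule_ge0; first by rewrite lee_fin ltW.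
    by apply: adde_ge0; [rewrite lee_fin sqr_ge0|exact: expe_ge0].
  rewrite [_ * +oo]gt0_muley; last by rewrite lte_fin mulr_gt0 // lt_neqAle eq_sym Mp.
  by rewrite addey ?leey.
- by move=> _; rewrite expe2 mulyy addey // gt0_muley ?lte_fin // -EFinM addye // leey.
- move=> _; rewrite expe2 mulyy addey // gt0_muley ?lte_fin // addye ?leey //.
  by rewrite gt_eqF // (@lt_le_trans _ _ 0) ?ltNye // mule_ge0 // lee_fin mulr_ge0 // ltW.
Qed.

Variables (d1 d2 : measure_display) (S : measurableType d1) (X : measurableType d2).
Variables (m1 : {sigma_finite_measure set S -> \bar R}).
Variables (m2 : {sigma_finite_measure set X -> \bar R}).

Let energy (f : S * X -> R[i]) (x : X) : \bar R := \int[m1]_s (sqmod (f (s, x)))%:E.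

Lemma energy_ge0 f x : 0 <= energy f x.
Proof. by apply: integral_ge0 => s _; rewrite lee_fin sqmod_ge0. Qed.

Lemma measurable_energy f : cmeasurable setT f -> measurable_fun setT (energy f).
Proof.
move=> mf; apply: (measurable_fun_fubini_tonelli_G (m1 := m1) (fun z => (sqmod (f z))%:E)).
  by apply/measurable_EFinP; exact: measurable_sqmod.
by move=> z; rewrite lee_fin sqmod_ge0.
Qed.

Lemma energy_split (e : R) f g x : (0 < e)%R -> cmeasurable setT f -> cmeasurable setT g ->
  energy f x <= (1 + e)%:E * energy g x +
    (1 + e^-1)%:E * energy (fun z => f z - g z)%R x.
Proof.
move=> e0 mf mg; have e1 : (0 <= 1 + e)%R by rewrite addr_ge0 // ltW.
have e2 : (0 <= 1 + e^-1)%R by rewrite addr_ge0 // invr_ge0 ltW.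
have mx (h : S * X -> R[i]) : cmeasurable setT h ->
    measurable_fun setT (fun s => (sqmod (h (s, x)))%:E).
  move=> mh; apply/measurable_EFinP; apply: measurable_sqmod.
  exact: (@cmeasurable_comp _ _ _ S (S * X)%type h (fun s => (s, x))).
have mfg : cmeasurable setT (fun z => f z - g z)%R by exact: cmeasurableB.
rewrite /energy -!ge0_integralZl_EFin //; try exact: mx;
  try (by move=> s _; rewrite lee_fin sqmod_ge0).
have mZ (c : R) (h : S * X -> R[i]) : cmeasurable setT h ->
    measurable_fun setT (fun s => c%:E * (sqmod (h (s, x)))%:E).
  by move=> mh; apply: measurable_funeM; exact: mx.
have M1 := mZ (1 + e)%R _ mg; have M2 := mZ (1 + e^-1)%R _ mfg.
rewrite -ge0_integralD //; try exact: M1; try exact: M2;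
  try (by move=> s _; rewrite -EFinM lee_fin mulr_ge0 // sqmod_ge0).
apply: ge0_le_integral => //.
- by move=> s _; rewrite lee_fin sqmod_ge0.
- exact: mx.
- exact: (emeasurable_funD M1 M2).
- by move=> s _; rewrite -!EFinM -EFinD lee_fin sqmod_split.
exact: (mx _ mfg).
Qed.

(** Lower semicontinuity of the norm in [L^4(L^2)] under convergence in [L^2].
    The truncation at height [M] makes the cross term integrable, so that no
    almost everywhere convergent subsequence has to be extracted. *)
Lemma mixed_norm_limit (f : S * X -> R[i]) (fn : nat -> S * X -> R[i]) (E : set X) (B : R) :
  cmeasurable setT f -> (forall n, cmeasurable setT (fn n)) ->
  measurable E -> m2 E < +oo -> (forall s x, ~ E x -> f (s, x) = 0%R) ->
  (fun n => \int[m2]_x energy (fun z => f z - fn n z)%R x) @ \oo --> 0 ->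
  (forall n, \int[m2]_x (energy (fn n) x) ^+ 2 <= B%:E) ->
  \int[m2]_x (energy f x) ^+ 2 <= B%:E.
Proof.
move=> mf mfn mE Efin fE cd HB.
pose p := energy f; pose pn n := energy (fn n).
pose dn n := energy (fun z => f z - fn n z)%R.
have mp : measurable_fun setT p by exact: measurable_energy.
have mpn n : measurable_fun setT (pn n) by exact: measurable_energy.
have mdn n : measurable_fun setT (dn n) by apply: measurable_energy; exact: cmeasurableB.
have p0 x : 0 <= p x by exact: energy_ge0.
have pn0 n x : 0 <= pn n x by exact: energy_ge0.
have dn0 n x : 0 <= dn n x by exact: energy_ge0.
have B0 : (0 <= B)%R.
  rewrite -lee_fin; apply: le_trans (HB 0%N).
  by apply: integral_ge0 => x _; apply: expe_ge0; exact: pn0.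
pose q (M : nat) x : \bar R := mine (p x) M%:R%:E.
have q0 M x : 0 <= q M x by rewrite le_min p0 lee_fin ler0n.
have qM M x : q M x <= M%:R%:E by rewrite ge_min lexx orbT.
have qp M x : q M x <= p x by rewrite ge_min lexx.
have qfin M x : q M x \is a fin_num.
  by rewrite ge0_fin_numE //; apply: le_lt_trans (qM M x) _; rewrite ltry.
have mq M : measurable_fun setT (q M) by apply: measurable_mine => //; exact: measurable_cst.
have qE M x : ~ E x -> q M x = 0.
  move=> Ex; apply/eqP; rewrite eq_le q0 andbT; apply: le_trans (qp M x) _.
  rewrite /p /energy integral0_eq // => s _.
  by rewrite fE // sqmod0.
have msq (h : X -> \bar R) : measurable_fun setT h -> measurable_fun setT (fun x => h x ^+ 2).
  by move=> mh; exact: emeasurable_funM.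
(* With [a] the integral of the truncated square, letting [n] tend to infinity
   and then [e] to [0] yields [2 * a <= a + B], and [a] is finite. *)
have trunc_le M : \int[m2]_x (q M x) ^+ 2 <= B%:E.
  have afin : \int[m2]_x (q M x) ^+ 2 \is a fin_num.
    rewrite ge0_fin_numE; last by apply: integral_ge0 => x _; exact: expe_ge0.
    apply: (@le_lt_trans _ _ (\int[m2]_(x in E) (M%:R ^+ 2)%:E)).
      rewrite [leRHS]integral_mkcond; apply: ge0_le_integral => //.
      - by move=> x _; exact: expe_ge0.
      - exact: msq.
      - apply/(measurable_restrictT (fun x => (M%:R ^+ 2)%:E)) => //; exact: measurable_cst.
      - move=> x _; rewrite patchE; case: ifPn => [_|/negP xE].
          by rewrite EFin_expe !expe2 lee_pmul.
        by rewrite qE ?expe2 ?mule0 // => Ex; apply: xE; exact: mem_set.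
    by rewrite integral_cst // lte_mul_pinfty // lee_fin sqr_ge0.
  set a := fine (\int[m2]_x (q M x) ^+ 2).
  have aE : \int[m2]_x (q M x) ^+ 2 = a%:E by rewrite /a fineK.
  have a0 : (0 <= a)%R.
    by rewrite -lee_fin -aE; apply: integral_ge0 => x _; exact: expe_ge0.
  rewrite aE lee_fin -subr_le0.
  have M0 : (0 <= M%:R :> R)%R by exact: ler0n.
  apply: (@le_eps R _ (a + B)%R) => [|e e0]; first exact: addr_ge0.
  have e1 : (0 <= 1 + e)%R by rewrite addr_ge0 // ltW.
  have e2 : (0 <= 1 + e^-1)%R by rewrite addr_ge0 // invr_ge0 ltW.
  rewrite -subr_le0.
  apply: (@le_eps R _ (2 * ((1 + e^-1) * M%:R))%R) => [|d d0]; first by rewrite !mulr_ge0.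
  have /fine_cvgP[cf /cvgrPdist_lt /(_ d d0) cd'] := cd.
  near \oo => n.
  have dfin : \int[m2]_x dn n x \is a fin_num by near: n.
  have dlt : \int[m2]_x dn n x <= d%:E.
    rewrite -(fineK dfin) lee_fin; apply: (le_trans (ler_norm _)); apply/ltW.
    by rewrite -normrN -sub0r; near: n.
  have point x : (q M x) ^+ 2 <= ((1 + e) / 2)%:E * ((q M x) ^+ 2 + (pn n x) ^+ 2) +
      ((1 + e^-1) * M%:R)%:E * dn n x.
    have := le_trans (qp M x) (energy_split x e0 mf (mfn n)).
    rewrite -(fineK (qfin M x)) => H; rewrite -EFin_expe.
    apply: square_split => //.
    - by rewrite -lee_fin fineK.
    - by rewrite -lee_fin fineK.
    - by rewrite ltr_wpDr // invr_ge0 ltW.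
  have : a%:E <= ((1 + e) / 2)%:E * (a%:E + B%:E) + ((1 + e^-1) * M%:R)%:E * d%:E.
    have c0 : (0 <= (1 + e^-1) * M%:R)%R by rewrite mulr_ge0.
    have h0 : (0 <= (1 + e) / 2)%R by rewrite divr_ge0.
    have s0 x : 0 <= (q M x) ^+ 2 + (pn n x) ^+ 2.
      by apply: adde_ge0; exact: expe_ge0.
    rewrite -aE; apply: (@le_trans _ _ (\int[m2]_x (((1 + e) / 2)%:E *
        ((q M x) ^+ 2 + (pn n x) ^+ 2) + ((1 + e^-1) * M%:R)%:E * dn n x))).
      apply: ge0_le_integral => //.
      - by move=> x _; exact: expe_ge0.
      - exact: msq.
      - apply: emeasurable_funD; last exact: measurable_funeM.
        apply: measurable_funeM; apply: emeasurable_funD; exact: msq.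
    rewrite ge0_integralD //; last 4 first.
    - by move=> x _; apply: mule_ge0.
    - by apply: measurable_funeM; apply: emeasurable_funD; exact: msq.
    - by move=> x _; apply: mule_ge0.
    - exact: measurable_funeM.
    rewrite !ge0_integralZl_EFin //; last by apply: emeasurable_funD; exact: msq.
    rewrite ge0_integralD //; last 4 first.
    - by move=> x _; exact: expe_ge0.
    - exact: msq.
    - by move=> x _; exact: expe_ge0.
    - exact: msq.
    apply: leeD; apply: lee_wpmul2l; rewrite ?lee_fin //.
    by apply: leeD => //; exact: HB.
  move=> H; have : (a <= (1 + e) / 2 * (a + B) + (1 + e^-1) * M%:R * d)%R.
    by rewrite -lee_fin.
  lra.
pose g M x := (q M x) ^+ 2.
have cq x : q ^~ x @ \oo --> p x.
  have := p0 x; case px : (p x) => [r| |] // _; last first.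
    rewrite (_ : q^~ x = fun M => M%:R%:E); first by apply/cvgenyP; exact: cvg_id.
    by apply/funext => M; rewrite /q px /mine ltNge leey.
  apply: cvg_near_cst; have r0 := archi_boundP (normr_ge0 r).
  exists (Num.bound `|r|) => // M /= rM; apply/esym.
  rewrite /q px /mine ifT // lte_fin; apply: le_lt_trans (ler_norm r) _.
  by apply: (lt_le_trans r0); rewrite ler_nat.
have cg x : g ^~ x @ \oo --> (p x) ^+ 2.
  rewrite expe2; apply: (@cvgeM _ _ _ _ (q^~ x) (q^~ x)) => //.
  by rewrite /mule_def; case: (p x) (p0 x) => [r| |] // _; rewrite ?eqxx //= orbT.
have ng x : {homo g ^~ x : M N / (M <= N)%N >-> M <= N}.
  move=> M N MN; rewrite /g !expe2; have h : q M x <= q N x.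
    by rewrite /q le_min ge_min lexx ge_min lee_fin ler_nat MN orbT.
  exact: lee_pmul.
have mg M : measurable_fun setT (g M) by exact: msq.
have g0 M x : 0 <= g M x by exact: expe_ge0.
have := @cvg_monotone_convergence _ _ _ m2 setT measurableT g mg
  (fun M x _ => g0 M x) (fun x _ => ng x).
under eq_integral => x _ do rewrite (cvg_lim _ (cg x)) //.
by move/cvge_to_le; apply; exact: nearW.
Unshelve. all: by end_near. Qed.

End MixedNormLimit.

(** * The solution as a superposition over the past *)

Lemma cint_vanish {R : realType} (D E : set R) (f : R -> R[i]) :
  D `<=` E -> (forall s, E s -> ~ D s -> f s = 0) ->
  cint (@lebesgue_measure R) E f = cint (@lebesgue_measure R) D f.
Proof.
move=> DE f0; have H (p : R[i] -> R) : p 0 = 0 ->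
    (\int[@lebesgue_measure R]_(s in E) p (f s))%R =
    (\int[@lebesgue_measure R]_(s in D) p (f s))%R.
  move=> p0; rewrite Rintegral_mkcond [RHS]Rintegral_mkcond.
  apply: eq_Rintegral => s _; rewrite !patchE.
  case: ifPn => [/set_mem sE|/negP sE]; case: ifPn => [/set_mem sD|/negP sD] //.
    by rewrite f0 // => ?; apply: sD; exact: mem_set.
  by case: sE; apply: mem_set; exact: DE.
by rewrite /cint !H.
Qed.

Section Source.
Context {R : realType}.
Variables (A : 'M[R]_2) (uA : A \in unitmx) (tau : R).
Local Notation leb := (@lebesgue_measure R).
Local Notation m := (`|\det A|).
Local Notation Q := (cell A).
Local Notation ip := (ip (leb2 R) Q).
Local Notation nsq := (nsq (leb2 R) Q).
Local Notation I := `]0, tau[%classic.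
Local Notation P := `]-1, 0%R]%classic.
Variables (u0 : R * R -> R[i]) (F : R -> R * R -> R[i]).
Hypotheses (u0L2 : in_L2 A u0) (FL : in_L1L2 A I F).
Variables (S : nat -> step_fun A I) (Z : set R).
Hypothesis cZ : cvg_off F S Z.

Let mI : measurable (I : set (timeR R)).
Proof. exact: measurable_itv. Qed.

Let mP : measurable (P : set (timeR R)).
Proof. exact: measurable_itv. Qed.

Let m0 : 0 < m := detA_gt0 uA.

Let FL2 s : I s -> in_L2 A (F s).
Proof. by have [H _ _] := FL; exact: H. Qed.

(** Removing [Z] makes the coefficient measurable in [s]. *)
Definition forcing (k : int * int) (s : R) : R[i] :=
  (m^-1)%:C * pairing A F (I `\` Z) (fmode A k) s.

(** The initial datum enters as a forcing of unit mass spread over [(-1, 0]],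
    which makes the solution a single integral over the past. *)
Definition source (k : int * int) (s : R) : R[i] :=
  (\1_P s)%:C * fcoef A u0 k + - 'i * ((phase A k s)^* * forcing k s).

Lemma forcing_out k s : ~ I s -> forcing k s = 0.
Proof. by move=> Is; rewrite /forcing pairing_out ?mulr0 // => -[]. Qed.

Lemma cmeasurable_forcing k : cmeasurable setT (forcing k : timeR R -> R[i]).
Proof.
apply: cmeasurableM; first exact: cmeasurable_cst.
exact: (cmeasurable_pairing uA mI FL2 cZ (sqint_fmode uA k)).
Qed.

Let l2 (c : int * int -> R[i]) N := Num.sqrt (\sum_(k <- box N) sqmod (c k)).

Let l2_ge0 c N : 0 <= l2 c N.
Proof. exact: sqrtr_ge0. Qed.

Let l2_fcoef f N : sqint (leb2 R) Q f ->
  l2 (fcoef A f) N <= (Num.sqrt m)^-1 * Num.sqrt (nsq f).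
Proof.
move=> fL; rewrite /l2 ler_pdivlMl ?sqrtr_gt0 // -sqrtrM // ler_wsqrtr //.
exact: bessel_trunc.
Qed.

Let l2_forcing N s : I s ->
  ((l2 (forcing^~ s) N)%:E <= ((Num.sqrt m)^-1)%:E * norm2 A (F s))%E.
Proof.
move=> Is; have FsL := in_L2_sqint (FL2 Is).
rewrite (norm2_sqint uA FsL) -EFinM lee_fin.
apply: le_trans (l2_fcoef N FsL); rewrite ler_wsqrtr //; apply: ler_sum => k _.
have [sJ|sJ] := pselect ((I `\` Z) s); first by rewrite /forcing pairing_in.
by rewrite /forcing pairing_out // mulr0 sqmod0 sqmod_ge0.
Qed.

Let measurable_l2 (c : int * int -> R -> R[i]) N :
  (forall k, cmeasurable setT (c k : timeR R -> R[i])) ->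
  measurable_fun setT ((fun s => l2 (c^~ s) N) : timeR R -> R).
Proof.
move=> mc; apply: measurable_sqrt; apply: measurable_sum => k.
exact: measurable_sqmod.
Qed.

Let integral_l2_forcing N : (\int[leb]_s (l2 (forcing^~ s) N)%:E <=
  ((Num.sqrt m)^-1 * massF A tau F)%:E)%E.
Proof.
have -> : (\int[leb]_s (l2 (forcing^~ s) N)%:E =
    \int[leb]_(s in I) (l2 (forcing^~ s) N)%:E)%E.
  rewrite [RHS]integral_mkcond; apply: eq_integral => s _; rewrite patchE.
  case: ifPn => // /negP sI; rewrite /l2 big1 ?sqrtr0 // => k _.
  by rewrite forcing_out ?sqmod0 // => ?; apply: sI; exact: mem_set.
rewrite EFinM -(massFE FL); apply: le_integral_lowerZ => //.
- by rewrite invr_gt0 sqrtr_gt0.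
- by apply: measurable_funTS; apply: measurable_l2; exact: cmeasurable_forcing.
- by move=> s _; exact: norm2_ge0.
- by move=> s; exact: l2_forcing.
Qed.

Let cintegrable_forcing k : cintegrable leb setT (forcing k).
Proof.
pose N := maxn (absz k.1) (absz k.2).
have kN : k \in box N.
  by apply: mem_box; [exact: leq_maxl|exact: leq_maxr].
apply: (@cintegrableP _ _ _ leb setT measurableT (forcing k)
  (fun s => l2 (forcing^~ s) N)).
- exact: cmeasurable_forcing.
- apply/integrableP; split.
    by apply/measurable_EFinP; apply: measurable_l2; exact: cmeasurable_forcing.
  under eq_integral do rewrite gee0_abs ?lee_fin //.
  by apply: le_lt_trans (integral_l2_forcing N) _; rewrite ltry.
- move=> s _; rewrite normcE ler_wsqrtr // (bigD1_seq k) ?box_uniq //= lerDl.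
  by apply: sumr_ge0 => ? _; exact: sqmod_ge0.
Qed.

Let leb_P : leb P = 1%:E.
Proof. by rewrite lebesgue_measure_itv /= lte_fin ltrN10 add0e opprK. Qed.

Let cintegrable_phase_forcing k :
  cintegrable leb setT (fun s => (phase A k s)^* * forcing k s).
Proof.
have fi := cintegrable_normc measurableT (cintegrable_forcing k).
apply: (cintegrableP measurableT _ fi).
  apply: cmeasurableM; last exact: cmeasurable_forcing.
  by apply: cmeasurableJ; exact: cmeasurable_phase.
by move=> s _; rewrite normc_mul normcJ [normc (phase _ _ _)]normcE sqmod_phase sqrtr1 mul1r.
Qed.

Let cintegrable_indic : cintegrable leb setT (fun s => (\1_P s)%:C).
Proof. by split; [exact: integrable_indic_itv|exact: integrable0]. Qed.

Let sourceE k s : source k s =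
  fcoef A u0 k * (\1_P s)%:C + - 'i * ((phase A k s)^* * forcing k s).
Proof. by rewrite /source [_%:C * _]mulrC. Qed.

Lemma cintegrable_source k : cintegrable leb setT (source k).
Proof.
have -> : source k = fun s => fcoef A u0 k * (\1_P s)%:C +
   - 'i * ((phase A k s)^* * forcing k s) by apply/funext => s; rewrite sourceE.
apply: (cintegrableD measurableT).
  exact: (cintegrableZ measurableT _ cintegrable_indic).
exact: (cintegrableZ measurableT _ (cintegrable_phase_forcing k)).
Qed.

Lemma sqmod_i : sqmod ('i : R[i]) = 1.
Proof. by rewrite -complexiE /sqmod /= expr0n add0r expr1n. Qed.

(** The two terms of the source live on disjoint time intervals, so the
    Euclidean norm of the coefficients is the sum of the two norms, each of which
    is bounded by Bessel's inequality. *)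
Lemma integral_source N :
  (\int[leb]_s (Num.sqrt (\sum_(k <- box N) sqmod (source k s)))%:E <=
   ((Num.sqrt m)^-1 * (Num.sqrt (nsq u0) + massF A tau F))%:E)%E.
Proof.
have -> : (\int[leb]_s (Num.sqrt (\sum_(k <- box N) sqmod (source k s)))%:E =
    \int[leb]_s ((l2 (fcoef A u0) N)%:E * (\1_P s)%:E + (l2 (forcing^~ s) N)%:E))%E.
  apply: eq_integral => s _; rewrite -EFinM -EFinD; congr EFin.
  rewrite indicE; have [sP|sP] := boolP (s \in P).
    have sI : ~ I s.
      move: (set_mem sP) => /=; rewrite !in_itv /= => /andP[_ s0] /andP[s1 _].
      by have := lt_le_trans s1 s0; rewrite ltxx.
    rewrite mulr1 [X in _ = _ + X](_ : _ = 0) ?addr0; last first.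
      by rewrite /l2 big1 ?sqrtr0 // => k _; rewrite forcing_out ?sqmod0.
    congr Num.sqrt; apply: eq_bigr => k _.
    by rewrite /source indicE sP mul1r forcing_out // !mulr0 addr0.
  rewrite mulr0 add0r; congr Num.sqrt; apply: eq_bigr => k _.
  rewrite /source indicE (negbTE sP) mul0r add0r mulNr sqmodN !sqmodM sqmod_i.
  by rewrite sqmodJ sqmod_phase !mul1r.
have mi : measurable_fun setT (\1_P : timeR R -> R) by apply/measurable_indicP.
have ml : measurable_fun setT (fun s : timeR R => (l2 (forcing^~ s) N)%:E).
  by apply/measurable_EFinP; apply: measurable_l2; exact: cmeasurable_forcing.
have i0 (s : R) : (0 <= (\1_P s : R)%:E)%E by rewrite lee_fin.
have mZ : measurable_fun setT (fun s : timeR R => ((l2 (fcoef A u0) N)%:E * (\1_P s)%:E)%E).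
  by apply: measurable_funeM; apply/measurable_EFinP.
rewrite ge0_integralD //; last 2 first.
- by move=> s _; apply: mule_ge0 => //; rewrite lee_fin.
- by move=> s _; rewrite lee_fin.
rewrite ge0_integralZl_EFin //; last exact/measurable_EFinP.
rewrite integral_indic // setIT [X in (_ * X + _)%E]leb_P mule1 mulrDr EFinD.
apply: leeD; last exact: integral_l2_forcing.
by rewrite lee_fin; apply: l2_fcoef; exact: in_L2_sqint.
Qed.

Lemma past_source k t : 0 < t -> t < tau ->
  past_integral source k t = fcoef A u0 k -
    'i * cint leb `]0, t[ (fun s => (phase A k s)^* * forcing k s).
Proof.
move=> t0 ttau; have mt : measurable (`]-oo, t[%classic : set (timeR R)) by exact: measurable_itv.
have S1 (f : R -> R[i]) : cintegrable leb setT f -> cintegrable leb `]-oo, t[ f.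
  by move=> [i1 i2]; split; [exact: integrableS i1|exact: integrableS i2].
have i1 := S1 _ (cintegrable_phase_forcing k).
have -> : past_integral source k t = cint leb `]-oo, t[
    (fun s => fcoef A u0 k * (\1_P s)%:C + - 'i * ((phase A k s)^* * forcing k s)).
  by apply: eq_cint => s _; rewrite -sourceE.
rewrite (cintD mt); [|by apply: (cintegrableZ mt); exact: S1|exact: (cintegrableZ mt)].
have iP : cintegrable leb `]-oo, t[ (fun s => (\1_P s)%:C) by exact: S1.
rewrite (cintZ mt (fcoef A u0 k) iP) (cintZ mt (- 'i) i1) mulNr; congr (_ - 'i * _).
  rewrite [cint _ _ _](_ : _ = 1) ?mulr1 //; apply: complex_eqP => /=; last first.
    by rewrite Rintegral_cst // mul0r.
  rewrite /Rintegral integral_indic //.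
  have -> : P `&` `]-oo, t[%classic = P.
    by apply: setIidl => s /=; rewrite !in_itv /= => /andP[_ s0]; exact: le_lt_trans t0.
  by rewrite [X in fine X]leb_P.
apply: cint_vanish => s /=; rewrite !in_itv /=; first by case/andP.
move=> st sn; rewrite forcing_out ?mulr0 //= in_itv /= => /andP[s0 _].
by apply: sn; rewrite s0 st.
Qed.

(** For each mode, the coefficient of the solution at time [t] is the integral of
    the source before [t], turned by the phase at time [t]. *)
Lemma trunc_solution t w G v N x : 0 < t -> t < tau -> is_flow A t u0 w ->
  (forall s, 0 < s < t -> is_flow A (t - s) (F s) (G s)) ->
  is_bochner_integral A `]0, t[ G v ->
  trunc A N w x - 'i * trunc A N v x = wave A (box N) ((past_integral source)^~ t) t x.
Proof.
move=> t0 ttau hw hG hv; rewrite /trunc mulr_sumr -sumrB; apply: eq_bigr => k _.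
rewrite (flow_fcoef uA k u0L2 hw) (fcoef_duhamel uA FL t0 ttau hG hv k cZ).
by rewrite past_source // /forcing; ring.
Qed.

End Source.

(** * Convergence of the truncated solutions *)

Section Cut.
Context {R : realType}.

Lemma indicX (T1 T2 : Type) (I : set T1) (Q : set T2) s x :
  \1_(I `*` Q) (s, x) = \1_I s * \1_Q x :> R.
Proof.
rewrite !indicE [(s, x) \in _](_ : _ = (s \in I) && (x \in Q)) -?mulnb ?natrM //.
apply/idP/andP => [/set_mem[/= sI xQ]|[/set_mem sI /set_mem xQ]].
  by split; exact: mem_set.
exact: mem_set.
Qed.

Lemma cmeasurable_cut d (T : measurableType d) (D : set T) (f : T -> R[i]) :
  measurable D -> cmeasurable D f -> cmeasurable setT (fun z => (\1_D z)%:C * f z).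
Proof.
move=> mD [f1 f2].
have H (p : R[i] -> R) : p 0 = 0 -> measurable_fun D (fun z => p (f z)) ->
    measurable_fun setT (fun z => p ((\1_D z)%:C * f z)).
  move=> p0 mp; rewrite (_ : (fun z => _) = (fun z => p (f z)) \_ D); last first.
    apply/funext => z; rewrite patchE indicE; case: ifP => _; first by rewrite mul1r.
    by rewrite mul0r p0.
  by apply/(measurable_restrictT (fun z => p (f z))).
by split; exact: H.
Qed.

Lemma energy_cut (I : set R) (Q : set (R * R)) (h : R * (R * R) -> R[i]) x :
  (\int[@lebesgue_measure R]_s (sqmod ((\1_(I `*` Q) (s, x))%:C * h (s, x)))%:E =
   ((fun x => \int[@lebesgue_measure R]_(s in I) (sqmod (h (s, x)))%:E) \_ Q) x)%E.
Proof.
rewrite patchE; case: ifPn => xQ.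
  rewrite [RHS]integral_mkcond; apply: eq_integral => s _.
  rewrite indicX patchE [\1_Q x]indicE xQ mulr1 indicE.
  by case: ifP => _; rewrite ?mul1r ?mul0r ?sqmod0.
apply: integral0_eq => s _.
by rewrite indicX [\1_Q x]indicE (negbTE xQ) mulr0 mul0r sqmod0.
Qed.

End Cut.

Section Solution.
Context {R : realType}.
Variables (A : 'M[R]_2) (uA : A \in unitmx) (gamma : R) (g0 : 0 < gamma).
Hypothesis hspec : forall k : int * int, exists n : nat, eigval A k = gamma * n%:R.
Local Notation leb := (@lebesgue_measure R).
Local Notation m := (`|\det A|).
Local Notation Q := (cell A).
Local Notation tau := (2 * pi / gamma).
Local Notation I := `]0%R, tau[%classic.
Local Notation sqint := (sqint (leb2 R) Q).
Local Notation nsq := (nsq (leb2 R) Q).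
Variables (u0 : R * R -> R[i]) (F u : R -> R * R -> R[i]).
Hypotheses (u0L2 : in_L2 A u0) (FL : in_L1L2 A I F).
Hypothesis hu : is_mild_solution A tau u0 F u.
Variables (S : nat -> step_fun A I) (Z : set R).
Hypothesis cZ : cvg_off F S Z.

Let mQ := measurable_cell uA.
Let mI : measurable (I : set (timeR R)).
Proof. exact: measurable_itv. Qed.

Let U N t x := wave A (box N) ((past_integral (source A tau u0 F Z))^~ t) t x.

Let bound := 2 * nsq u0 + 2 * (massF A tau F + 1) ^+ 2.

Let cmeasurable_slice t : I t -> cmeasurable setT (u t : planeR R -> R[i]).
Proof.
move=> tI; have [h1 h2 _ _] := hu.
have mc : cmeasurable setT (fun z : timeR R * planeR R =>
    (\1_(I `*` setT) z)%:C * u z.1 z.2).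
  by apply: cmeasurable_cut => //; exact: measurableX.
rewrite (_ : u t = fun x => (fun z => (\1_(I `*` setT) z)%:C * u z.1 z.2) (t, x)).
  apply: (@cmeasurable_comp _ _ _ (planeR R) (timeR R * planeR R)%type _ (fun x => (t, x)) mc).
  exact: measurable_pair1.
by apply/funext => x; rewrite /= indicX !indicE (mem_set tI) in_setT mul1r mul1r.
Qed.

(** The error at time [t] is the truncation error of the free part plus that of
    the Duhamel part; both are bounded uniformly in [t] and tend to [0]. *)
Lemma slice_error t : 0 < t -> t < tau -> exists e : nat -> R,
  [/\ forall N, (\int[leb2 R]_(x in Q) (sqmod (u t x - U N t x))%:E <= (e N)%:E)%E,
      forall N, e N <= bound &
      forall d, 0 < d -> \forall N \near \oo, e N < d].
Proof.
move=> t0 ttau; have tI : I t by rewrite /= in_itv /= t0.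
have [_ _ _ /(_ t)] := hu; rewrite t0 ttau => /(_ isT) [w [G [v [hw hG hv ae]]]].
have wL : sqint w by apply: in_L2_sqint; case: hw.
have vL : sqint v by apply: in_L2_sqint; case: hv.
have u0L := in_L2_sqint u0L2.
have dwL N : sqint (fun x => w x - trunc A N w x).
  by apply: (sqintB mQ) => //; exact: sqint_trunc.
have dvL N : sqint (fun x => - 'i * (v x - trunc A N v x)).
  by apply: (sqintZ mQ); apply: (sqintB mQ) => //; exact: sqint_trunc.
pose p N := nsq (fun x => w x - trunc A N w x).
pose q N := nsq (fun x => v x - trunc A N v x).
have up N : (\int[leb2 R]_(x in Q) (sqmod (u t x - U N t x))%:E <= (2 * p N + 2 * q N)%:E)%E.
  have -> : (\int[leb2 R]_(x in Q) (sqmod (u t x - U N t x))%:E =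
      \int[leb2 R]_(x in Q) (sqmod ((w x - trunc A N w x) +
         - 'i * (v x - trunc A N v x)))%:E)%E.
    have [_ iD] := sqintD mQ (dwL N) (dvL N).
    apply: ge0_ae_eq_integral => //.
    + apply/measurable_EFinP; apply: measurable_sqmod; apply: cmeasurableB.
        by apply: (@cmeasurableS _ _ _ _ setT) => //; exact: cmeasurable_slice.
      by have [] := sqint_wave uA (box N) ((past_integral (source A tau u0 F Z))^~ t) t.
    + exact: (measurable_int _ iD).
    + by move=> x _; rewrite lee_fin sqmod_ge0.
    + by move=> x _; rewrite lee_fin sqmod_ge0.
    + have [Y [mY Y0 sub]] := ae; exists Y; split => // x /= H; apply: sub => /= ux.
      apply: H => Qx; congr (sqmod _)%:E.
      rewrite ux /U -(trunc_solution uA u0L2 FL cZ N x t0 ttau hw hG hv); ring.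
  rewrite (nsqE mQ); last exact: (sqintD mQ).
  rewrite lee_fin; apply: (le_trans (nsqD_le mQ (dwL N) (dvL N))).
  rewrite (nsqZ mQ); last by apply: (sqintB mQ) => //; exact: sqint_trunc.
  by rewrite sqmodN sqmod_i mul1r.
have p_le N : p N <= nsq u0.
  exact: le_trans (nsq_sub_trunc_le uA N wL) (flow_nsq_le uA u0L2 hw).
have q_le N : q N <= (massF A tau F + 1) ^+ 2.
  apply: le_trans (nsq_sub_trunc_le uA N vL) _.
  exact: (nsq_duhamel_le uA FL t0 ttau hG hv).
have p_small d : 0 < d -> \forall N \near \oo, p N < d.
  move=> d0; have s0 : 0 < Num.sqrt d by rewrite sqrtr_gt0.
  by apply: filterS (flow_trunc_small uA u0L2 hw s0) => N; rewrite ltr_sqrt.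
have q_small d : 0 < d -> \forall N \near \oo, q N < d.
  exact: (duhamel_trunc_small uA FL t0 ttau hG hv).
move: p q up p_le q_le p_small q_small => p q up p_le q_le p_small q_small.
exists (fun N => 2 * p N + 2 * q N); split => [//|N|d d0].
  by apply: lerD; apply: ler_wpM2l.
have d4 : 0 < d / 4 by rewrite divr_gt0.
have -> : d = 2 * (d / 4) + 2 * (d / 4) by field.
near=> N; apply: ltrD; rewrite ltr_pM2l //; near: N; [exact: p_small|exact: q_small].
Unshelve. all: by end_near. Qed.

Let cut (h : R -> R * R -> R[i]) (z : timeR R * planeR R) : R[i] :=
  (\1_(I `*` Q) z)%:C * h z.1 z.2.

Let cmeasurable_cut_u : cmeasurable setT (cut u).
Proof.
have [h1 h2 _ _] := hu.
apply: cmeasurable_cut; first exact: measurableX.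
apply: (@cmeasurableS _ _ _ _ (I `*` setT)) => //; first exact: measurableX.
by move=> z [].
Qed.

Let cmeasurable_cut_U N : cmeasurable setT (cut (U N)).
Proof.
apply: cmeasurable_cut; first exact: measurableX.
apply: (@cmeasurableS _ _ _ _ setT) => //.
apply: cmeasurable_duhamel => k.
exact: (cintegrable_source uA u0 FL cZ).
Qed.

Let err N (t : R) : \bar R :=
  (\int[plane_measure R]_x (sqmod (cut u (t, x) - cut (U N) (t, x)))%:E)%E.

Let cutB N t x : cut u (t, x) - cut (U N) (t, x) =
  (\1_(I `*` Q) (t, x))%:C * (u t x - U N t x).
Proof. by rewrite /cut /= mulrBr. Qed.

Let err_in N t : I t -> err N t =
  (\int[leb2 R]_(x in Q) (sqmod (u t x - U N t x))%:E)%E.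
Proof.
move=> tI; rewrite [RHS]integral_mkcond; apply: eq_integral => x _.
rewrite cutB indicX [\1_I t]indicE (mem_set tI) mul1r indicE patchE.
by case: ifP => _; rewrite ?mul1r ?mul0r ?sqmod0.
Qed.

Let err_out N t : ~ I t -> err N t = 0%E.
Proof.
move=> tI; apply: integral0_eq => x _.
by rewrite cutB indicX [\1_I t]indicE memNset // !mul0r sqmod0.
Qed.

Let err_ge0 N t : (0 <= err N t)%E.
Proof. by apply: integral_ge0 => x _; rewrite lee_fin sqmod_ge0. Qed.

Let measurable_sqdiff N : measurable_fun setT
  (fun z => (sqmod (cut u z - cut (U N) z))%:E).
Proof.
apply/measurable_EFinP; apply: measurable_sqmod.
by apply: cmeasurableB.
Qed.

Let measurable_err N : measurable_fun setT (err N : timeR R -> \bar R).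
Proof.
apply: (measurable_fun_fubini_tonelli_F (m2 := plane_measure R)
  (fun z => (sqmod (cut u z - cut (U N) z))%:E)) => //.
by move=> z; rewrite lee_fin sqmod_ge0.
Qed.

Let in_I t : I t -> 0 < t /\ t < tau.
Proof. by rewrite /= in_itv => /andP. Qed.

Let err_le N t : I t -> (err N t <= bound%:E)%E.
Proof.
move=> tI; have [t0 ttau] := in_I tI.
have [e [e1 e2 _]] := slice_error t0 ttau.
by rewrite err_in //; apply: (le_trans (e1 N)); rewrite lee_fin.
Qed.

Let err_fin N t : I t -> (fine (err N t))%:E = err N t.
Proof.
move=> tI; rewrite fineK // ge0_fin_numE //.
by apply: (le_lt_trans (err_le N tI)); rewrite ltry.
Qed.

(** Dominated convergence in time, with a constant majorant. *)
Let space_time_error :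
  (fun N => \int[plane_measure R]_x \int[leb]_t
     (sqmod (cut u (t, x) - cut (U N) (t, x)))%:E)%E @ \oo --> 0%E.
Proof.
rewrite (_ : (fun N => _) = (fun N => \int[leb]_(t in I) (fine (err N t))%:E)%E); last first.
  apply/funext => N.
  rewrite -(fubini_tonelli (m1 := leb) (m2 := plane_measure R)
    (fun z => (sqmod (cut u z - cut (U N) z))%:E)) //; last first.
    by move=> z; rewrite lee_fin sqmod_ge0.
  rewrite [RHS]integral_mkcond; apply: eq_integral => t _; rewrite patchE.
  case: ifPn => [/set_mem tI|/negP tI]; first by rewrite err_fin.
  by rewrite -/(err N t) err_out // => ?; apply: tI; exact: mem_set.
apply: (@dominated_lower_cvg0 _ _ _ leb I I (fun N t => fine (err N t)) (fun=> bound%:E)) => //.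
- move=> N; apply: (@measurableT_comp _ _ _ _ _ _ (@fine R)) => //.
  exact: measurable_funTS.
- by move=> N t tI; rewrite -lee_fin err_fin.
- by move=> t _; rewrite lee_fin addr_ge0 // mulr_ge0 ?nsq_ge0 // sqr_ge0.
- by rewrite integral_cst // [X in (_ * X)%E](leb_I g0) -EFinM ltry.
- by move=> N t tI; rewrite err_fin // err_le.
- move=> t tI; have [t0 ttau] := in_I tI.
  have [e [e1 _ e3]] := slice_error t0 ttau.
  apply/cvgrPdist_lt => d d0; apply: filterS (e3 d d0) => N; apply: le_lt_trans.
  rewrite sub0r normrN ger0_norm -lee_fin err_fin // err_in //.
Qed.

Let a := Num.sqrt (nsq u0) + massF A tau F.

(** The truncations obey the bound with constant [3 * tau ^+ 2 * m], and the
    source has mass at most [(Num.sqrt m)^-1 * a]; the fourth power of the latter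
    leaves one factor [m] in the denominator. *)
Lemma mixed_norm_solution :
  (\int[leb2 R]_(x in Q) (\int[leb]_(t in I) (sqmod (u t x))%:E) ^+ 2 <=
   (3 * tau ^+ 2 / m * a ^+ 4)%:E)%E.
Proof.
have m0 := detA_gt0 uA.
have a0 : 0 <= a by rewrite addr_ge0 ?sqrtr_ge0 // (massF_ge0 FL).
have cutE (h : R -> R * R -> R[i]) :
    (\int[plane_measure R]_x (\int[leb]_t (sqmod (cut h (t, x)))%:E) ^+ 2 =
     \int[leb2 R]_(x in Q) (\int[leb]_(t in I) (sqmod (h t x))%:E) ^+ 2)%E.
  rewrite [RHS]integral_mkcond; apply: eq_integral => x _.
  rewrite [X in (X ^+ 2)%E](energy_cut I Q (fun z => h z.1 z.2) x) !patchE.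
  by case: ifP => // _; rewrite expe2 mule0.
rewrite -cutE.
apply: (@mixed_norm_limit _ _ _ (timeR R) (planeR R) leb (plane_measure R)
   (cut u) (fun N => cut (U N)) Q) => //.
- exact: cell_lty.
- by move=> s x xQ; rewrite /cut indicX [\1_Q x]indicE memNset // mulr0 mul0r.
- move=> N; rewrite cutE; apply: (le_trans (duhamel_estimate uA g0 hspec (box_uniq N)
    (cintegrable_source uA u0 FL cZ))).
  have := integral_source uA u0L2 FL cZ N.
  set J := (\int[leb]_s _)%E => HJ.
  have J0 : (0 <= J)%E by apply: integral_ge0 => s _; rewrite lee_fin sqrtr_ge0.
  have JE : J = (fine J)%:E.
    by rewrite fineK // ge0_fin_numE // (le_lt_trans HJ) // ltry.
  move: HJ J0; rewrite JE !lee_fin => HJ J0.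
  suff H : 3 * tau ^+ 2 * m * fine J ^+ 4 <= 3 * tau ^+ 2 / m * a ^+ 4.
    by move: H; rewrite -lee_fin.
  apply: (@le_trans _ _ (3 * tau ^+ 2 * m * ((Num.sqrt m)^-1 * a) ^+ 4)).
    apply: ler_wpM2l; first by apply: mulr_ge0 => //; apply: mulr_ge0 => //; exact: sqr_ge0.
    by apply: lerXn2r; rewrite ?nnegrE // mulr_ge0 // invr_ge0 sqrtr_ge0.
  have mE : m = Num.sqrt m ^+ 2 by rewrite sqr_sqrtr // ltW.
  have s0 : Num.sqrt m != 0 by rewrite gt_eqF // sqrtr_gt0.
  rewrite le_eqVlt; apply/orP; left; apply/eqP; rewrite {1 3}mE.
  by move: (2 * pi / gamma) s0 => T s0; field.
Qed.

End Solution.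

Unset Implicit Arguments.

Theorem proposition4p3 (R : realType) (A : 'M[R]_2) (gamma : R)
    (u0 : R * R -> R[i]) (F u : R -> R * R -> R[i])
    (hA : A \in unitmx) (hgamma : 0 < gamma)
    (hspec : forall k : int * int, exists n : nat,
      eigval A k = gamma * n%:R)
    (hu0 : in_L2 A u0)
    (hF : in_L1L2 A `]0, 2 * pi / gamma[ F)
    (hu : is_mild_solution A (2 * pi / gamma) u0 F u) :
  (normL4L2 A (2 * pi / gamma) u <=
   ((12 * pi ^+ 2 / (gamma ^+ 2 * `|\det A|)) `^ (4^-1))%:E *
   (norm2 A u0 + normL1L2 A `]0%R, (2 * pi / gamma)%R[ F))%E.
Proof.
have [_ [S /ae_approx_cvg_off[Z cZ]] _] := hF.
have m0 : 0 < `|\det A| by exact: detA_gt0.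
have b0 := massF_ge0 hF.
rewrite (norm2_sqint hA (in_L2_sqint hu0)) (massFE hF) -EFinD -EFinM.
set a := Num.sqrt _ + _.
have a0 : 0 <= a by rewrite addr_ge0 // sqrtr_ge0.
have B0 : 0 <= 12 * pi ^+ 2 / (gamma ^+ 2 * `|\det A|) :> R.
  by rewrite divr_ge0 // mulr_ge0 // sqr_ge0.
have := mixed_norm_solution hA hgamma hspec hu0 hF hu cZ; rewrite -/a.
have -> : 3 * (2 * pi / gamma) ^+ 2 / `|\det A| * a ^+ 4 =
    12 * pi ^+ 2 / (gamma ^+ 2 * `|\det A|) * a ^+ 4.
  by field; rewrite !gt_eqF.
move=> H; apply: (@le_trans _ _ ((12 * pi ^+ 2 / (gamma ^+ 2 * `|\det A|) * a ^+ 4)%:E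
    `^ 4^-1)%E).
  apply: le_poweR; rewrite ?invr_ge0 //.
  by apply: integral_ge0 => x _; apply: expe_ge0; apply: integral_ge0 => t _; rewrite lee_fin sqmod_ge0.
rewrite poweR_EFin lee_fin powRM ?exprn_ge0 //.
by rewrite -[a ^+ 4]powR_mulrn // -powRrM mulfV // powRr1.
Qed.
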